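(* Let $\Sigma^d\subset\mathbb{R}^N$ be a smooth closed embedded $d$-dimensional submanifold and let $\xi_1,\xi_2,\ldots$ be i.i.d. points of $\Sigma$, uniformly distributed with respect to the Riemannian volume $d\mathrm{vol}_\Sigma$. For $\sigma>0$ let $$t_n=n^{-\frac{1}{3d+3+\sigma}}.$$ (a) If $f\in C^\infty(\mathbb{R}^N)$, then $$\sup_{\xi\in\Sigma}\big|\Gamma_2(\hat L_{t_n},f,f)(\xi)-\Gamma_2(L_{t_n},f,f)(\xi)\big|\longrightarrow 0\quad\text{almost surely as } n\to\infty.$$ (b) If $M>0$ and $\mathscr{L}_M=\{f(\xi)=\langle\zeta,\xi\rangle:\zeta\in\mathbb{R}^N,\ \|\zeta\|\le M\}$, then $$\sup_{f\in\mathscr{L}_M}\sup_{\xi\in\Sigma}\big|\Gamma_2(\hat L_{t_n},f,f)(\xi)-\Gamma_2(L_{t_n},f,f)(\xi)\big|\longrightarrow 0\quad\text{almost surely as } n\to\infty.$$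
   Context: $\|\cdot\|$ and $\langle\cdot,\cdot\rangle$ are the Euclidean norm and inner product of $\mathbb{R}^N$; ''closed'' means compact without boundary. For $t>0$ and functions $f$ on $\Sigma$ (functions on $\mathbb{R}^N$ are restricted to $\Sigma$), with $\mu=d\mathrm{vol}_\Sigma$, $$\theta_t(x)=\int_\Sigma e^{-\frac{\|x-y\|^2}{2t}}d\mu(y),\qquad L_tf(x)=\frac{2}{t\,\theta_t(x)}\int_\Sigma\big(f(y)-f(x)\big)e^{-\frac{\|x-y\|^2}{2t}}d\mu(y).$$ Given the sample $\xi_1,\ldots,\xi_n$, the empirical version is $$\hat\theta_t(x)=\frac1n\sum_{j=1}^n e^{-\frac{\|\xi_j-x\|^2}{2t}},\qquad \hat L_tf(x)=\frac{2}{t\,\hat\theta_t(x)}\,\frac1n\sum_{j=1}^n e^{-\frac{\|\xi_j-x\|^2}{2t}}\big(f(\xi_j)-f(x)\big),$$ and $\hat L_{t_n}$ is formed with the first $n$ sample points. For a linear operator $L$ on functions, $\Gamma(L,u,v)=\frac12\big(L(uv)-(Lu)v-u(Lv)\big)$ and $\Gamma_2(L,u,v)=\frac12\big(L(\Gamma(L,u,v))-\Gamma(L,Lu,v)-\Gamma(L,u,Lv)\big)$. *)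

(* Defs.v *)
From HB Require Import structures.
From mathcomp Require Import all_boot all_order all_algebra.
From mathcomp Require Import all_classical all_reals all_analysis.
From mathcomp Require Import measurable_realfun.
Set Implicit Arguments.
Unset Strict Implicit.
Unset Printing Implicit Defensive.
Import Order.TTheory GRing.Theory Num.Theory.
Import numFieldNormedType.Exports.

Local Open Scope classical_set_scope.
Local Open Scope ring_scope.

(* R^n with its Borel sigma-algebra; as a type this is just 'rV[R]_n, whose
   topology (from the sup norm) is the Euclidean one. *)
Definition borelRV (R : realType) (n : nat) :=
  g_sigma_algebraType (open : set (set 'rV[R]_n)).

Section euclidean.
Context {R : realType} {n : nat}.
Implicit Types x y : 'rV[R]_n.

Definition dotv x y : R := \sum_(i < n) x 0 i * y 0 i.

(* `|x| on 'rV[R]_n is the sup norm, hence this separate Euclidean norm. *)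
Definition enorm x : R := Num.sqrt (dotv x x).

End euclidean.

Section lebesgue_measure_rV.
Context {R : realType}.

Definition cons_rV n (p : measurableTypeR R * borelRV R n) : borelRV R n.+1 :=
  (row_mx (p.1%:M : 'M[R]_1) p.2 : 'rV[R]_(1 + n)).

Definition head_rV n (v : borelRV R n.+1) : measurableTypeR R :=
  (v : 'rV[R]_(1 + n)) 0 0.

Definition behead_rV n (v : borelRV R n.+1) : borelRV R n :=
  rsubmx (v : 'rV[R]_(1 + n)).

Lemma cons_rVK n (v : borelRV R n.+1) : cons_rV (head_rV v, behead_rV v) = v.
Proof.
apply/rowP => i; rewrite /cons_rV /head_rV /behead_rV /=.
rewrite -[in RHS](@hsubmxK _ 1 1 n v); congr (row_mx _ _ _ _).
apply/rowP => j; rewrite !ord1 !mxE eqxx mulr1n; congr (v _ _).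
exact/val_inj.
Qed.

Lemma head_cons_rV n x (v : borelRV R n) : head_rV (cons_rV (x, v)) = x.
Proof.
rewrite /head_rV /cons_rV /=.
rewrite (_ : (0 : 'I_(1 + n)) = lshift n (0 : 'I_1)); last exact/val_inj.
by rewrite row_mxEl mxE eqxx mulr1n.
Qed.

Lemma behead_cons_rV n x (v : borelRV R n) : behead_rV (cons_rV (x, v)) = v.
Proof. exact: row_mxKr. Qed.

Lemma cons_rV_lift n x (v : borelRV R n) (j : 'I_n) :
  (cons_rV (x, v) : 'rV[R]_n.+1) 0 (lift 0 j) = (v : 'rV[R]_n) 0 j.
Proof.
rewrite (_ : lift 0 j = rshift 1 j); last exact/val_inj.
exact: (@row_mxEr _ 1 1 n (x%:M) v).
Qed.

Lemma behead_rVE n (v : borelRV R n.+1) (j : 'I_n) :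
  (behead_rV v : 'rV[R]_n) 0 j = (v : 'rV[R]_n.+1) 0 (lift 0 j).
Proof. by rewrite -[v in RHS]cons_rVK cons_rV_lift. Qed.

Lemma open_measurable_rV n (U : set 'rV[R]_n) :
  open U -> measurable (U : set (borelRV R n)).
Proof. by move=> oU; apply: sub_sigma_algebra. Qed.

Lemma ball_rVP n (x : 'rV[R]_n) (e : R) (y : 'rV[R]_n) : 0 < e ->
  ball x e y <-> forall j, ball (x 0 j) e (y 0 j).
Proof.
move=> e0; split => [[_ +] j|xy]; first exact.
by split=> // i j; rewrite ord1.
Qed.

Lemma open_bigcup_ratball n (U : set 'rV[R]_n) : open U ->
  U = \bigcup_(p in [set p : 'rV[rat]_n * nat |
        ball (map_mx ratr p.1 : 'rV[R]_n) p.2.+1%:R^-1 `<=` U])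
      ball (map_mx ratr p.1 : 'rV[R]_n) p.2.+1%:R^-1.
Proof.
move=> oU; apply/seteqP; split => [y Uy|y [p /= pU py]]; last exact: pU.
have /nbhs_ballP[e /= e0 yeU] : nbhs y U by exact: open_nbhs_nbhs.
pose k := Num.truncn (2 / e).
have ke : 2 * k.+1%:R^-1 < e.
  rewrite ltr_pdivrMr// mulrC -ltr_pdivrMr//.
  by rewrite -natr1 natr1; exact: Num.Theory.truncnS_gt.
have k0 : 0 < k.+1%:R^-1 :> R by rewrite invr_gt0.
have qP (j : 'I_n) : exists q : rat, ball (y 0 j) k.+1%:R^-1 (ratr q).
  have : y 0 j - k.+1%:R^-1 < y 0 j + k.+1%:R^-1.
    by rewrite ltrBlDr -addrA ltrDl addr_gt0.
  move=> /rat_in_itvoo[q]; rewrite in_itv/= => /andP[q1 q2]; exists q.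
  by rewrite /ball/= ltr_norml ltrBlDl ltrBrDl ltrBlDr in q1 q2 *;
     apply/andP; split; rewrite ?ltrNl ?opprB ?ltrBlDl// addrC.
pose q : 'rV[rat]_n := \row_j projT1 (cid (qP j)).
have yq : ball y k.+1%:R^-1 (map_mx ratr q : 'rV[R]_n).
  by apply/ball_rVP => // j; rewrite !mxE; case: cid.
exists (q, k) => /=; last exact/ball_sym.
move=> z qz; apply: yeU; apply: le_ball (ltW ke) _ _.
by rewrite mulr_natl mulr2n; exact: ball_triangle yq qz.
Qed.


Lemma measurable_cons_rV n : measurable_fun setT (@cons_rV n).
Proof.
apply: (measurability (open : set (set (borelRV R n.+1)))) => //.
move=> _ [U oU <-]; rewrite setTI (open_bigcup_ratball oU) preimage_bigcup.
rewrite bigcup_mkcond; apply: countable_bigcupT_measurable => [//|[q k]].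
case: ifPn => // _ /=; set e := k.+1%:R^-1.
pose q' : 'rV[R]_n.+1 := map_mx ratr q.
have e0 : 0 < e :> R by rewrite invr_gt0.
rewrite (_ : _ @^-1` _ = ball (head_rV q' : R) e `*`
    ball (behead_rV q' : 'rV[R]_n) e); last first.
  apply/seteqP; split => -[x v] /=.
    move=> /(ball_rVP _ _ e0) qxv; split.
      by move: (qxv 0); rewrite -[X in ball _ _ X]/(head_rV _) head_cons_rV.
    apply/ball_rVP => // j; move: (qxv (lift 0 j)).
    by rewrite cons_rV_lift behead_rVE.
  move=> [qx /(ball_rVP _ _ e0) qv]; apply/ball_rVP => // j.
  have [j' ->|->] := unliftP 0 j.
    by rewrite cons_rV_lift -behead_rVE; exact: qv.
  by rewrite -[X in ball _ _ X]/(head_rV _) head_cons_rV.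
apply: measurableX.
  exact: (open_measurable (ball_open (head_rV q' : R) e)).
by apply: open_measurable_rV; exact: ball_open.
Qed.

HB.instance Definition _ n :=
  isMeasurableFun.Build _ _ _ _ (@cons_rV n) (@measurable_cons_rV n).

Lemma measurable_head_rV n : measurable_fun setT (@head_rV n).
Proof.
apply: (measurability _ (RGenOpens.measurableE R)).
move=> _ [_ [a [b ->] <-]]; rewrite setTI; apply: open_measurable_rV.
apply: open_comp => [v _|]; [exact: coord_continuous|exact: interval_open].
Qed.

Lemma measurable_behead_rV n : measurable_fun setT (@behead_rV n).
Proof.
apply: (measurability (open : set (set (borelRV R n)))) => //.
move=> _ [U oU <-]; rewrite setTI; apply: open_measurable_rV.
apply: open_comp => // v _ A /= /nbhs_ballP[e /= e0 vA].
apply/nbhs_ballP; exists e => //= w /(ball_rVP _ _ e0) vw; apply: vA.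
by apply/ball_rVP => // j; rewrite !behead_rVE.
Qed.

Section lebesgue_step.
Context {n : nat} (m : {sigma_finite_measure set (borelRV R n) -> \bar R}).

(* Lebesgue measure on R x R^n, transported to R^(n+1) *)
Definition lebesgue_rVS : set (borelRV R n.+1) -> \bar R :=
  pushforward (lebesgue_measure \x m)%E (@cons_rV n).

Let lebesgue_rVS0 : lebesgue_rVS set0 = 0%E.
Proof. exact: measure0. Qed.

Let lebesgue_rVS_ge0 A : (0 <= lebesgue_rVS A)%E.
Proof. exact: measure_ge0. Qed.

Let lebesgue_rVS_sigma_additive : semi_sigma_additive lebesgue_rVS.
Proof. exact: measure_semi_sigma_additive. Qed.

HB.instance Definition _ := isMeasure.Build _ _ _ lebesgue_rVS
  lebesgue_rVS0 lebesgue_rVS_ge0 lebesgue_rVS_sigma_additive.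

Let lebesgue_rVS_sigma_finite : sigma_finite setT lebesgue_rVS.
Proof.
have [F TF Foo] : sigma_finite setT (lebesgue_measure \x m)%E.
  have /sigma_finiteP[F [TF ndF Foo]] := sigma_finiteT (@lebesgue_measure R).
  have /sigma_finiteP[G [TG ndG Goo]] := sigma_finiteT m.
  exists (fun k => F k `*` G k) => [|k].
    rewrite -setXTT TF TG predeqE => -[x y]; split; last first.
      by move=> [k _ []/= ? ?]; split; exists k.
    move=> [/= [i _ Fix] [j _ Gjy]]; exists (maxn i j) => //; split.
    - by move: x Fix; exact/subsetPset/ndF/leq_maxl.
    - by move: y Gjy; exact/subsetPset/ndG/leq_maxr.
  have [? ?] := Foo k; have [? ?] := Goo k.
  split; first exact: measurableX.
  by rewrite product_measure1E// lte_mul_pinfty// ge0_fin_numE.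
exists (fun k => (fun v => (head_rV v, behead_rV v)) @^-1` F k) => [|k].
  by rewrite -preimage_bigcup -TF preimage_setT.
have [mF Fk] := Foo k; split.
  rewrite -[X in measurable X]setTI; apply: measurable_fun_pair => //.
    exact: measurable_head_rV.
  exact: measurable_behead_rV.
rewrite /lebesgue_rVS /pushforward (_ : _ @^-1` _ = F k)//.
by apply/seteqP; split => -[x v] /=; rewrite head_cons_rV behead_cons_rV.
Qed.

HB.instance Definition _ :=
  Measure_isSigmaFinite.Build _ _ _ lebesgue_rVS lebesgue_rVS_sigma_finite.

End lebesgue_step.

Fixpoint lebesgue_rV (n : nat) :
    {sigma_finite_measure set (borelRV R n) -> \bar R} :=
  match n with
  | 0 => (@dirac _ (borelRV R 0) 0 R)
  | n'.+1 => lebesgue_rVS (lebesgue_rV n')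
  end.

Lemma lebesgue_rV_box n (A : 'I_n -> set (measurableTypeR R)) :
  (forall i, measurable (A i)) ->
  lebesgue_rV n [set v | forall i, A i ((v : 'rV[R]_n) 0 i)] =
  (\prod_(i < n) lebesgue_measure (A i))%E.
Proof.
elim: n A => [|n IHn] A mA.
  by rewrite big_ord0 /= diracE mem_set// => -[].
rewrite big_ord_recl -IHn//= /lebesgue_rVS /pushforward -product_measure1E//.
- congr (_ _); apply/seteqP; split => -[x v] /= H.
    split; first by move: (H 0); rewrite -[X in A 0 X]/(head_rV _) head_cons_rV.
    by move=> i; move: (H (lift 0 i)); rewrite cons_rV_lift.
  case: H => Ax Av i; have [j ->|->] := unliftP 0 i.
    by rewrite cons_rV_lift; exact: Av.
  by rewrite -[X in A 0 X]/(head_rV _) head_cons_rV.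
- rewrite (_ : [set v | _] = \bigcap_(i in [set: 'I_n])
    (fun v : borelRV R n => (v : 'rV[R]_n) 0 i) @^-1` A (lift 0 i)); last first.
    by apply/seteqP; split => [v Av i _|v Av i]; exact: Av.
  apply: fin_bigcap_measurable => // i _.
  rewrite -[X in measurable X]setTI.
  have : measurable_fun setT
      (fun v : borelRV R n => (v : 'rV[R]_n) 0 i : measurableTypeR R).
    apply: (measurability _ (RGenOpens.measurableE R)).
    move=> _ [_ [a [b ->] <-]]; rewrite setTI; apply: open_measurable_rV.
    apply: open_comp => [v _|]; first exact: coord_continuous.
    exact: interval_open.
  by apply.
Qed.

End lebesgue_measure_rV.

Section submanifold.
Context {R : realType}.

(* C^k on an open set U of R^n, through iterated partial derivatives *)
Fixpoint Ck_on {n : nat} {W : normedModType R} (k : nat)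
    (U : set 'rV[R]_n) (f : 'rV[R]_n -> W) : Prop :=
  (forall x, U x -> {for x, continuous f}) /\
  if k is k'.+1 then
    forall i : 'I_n, (forall x, U x -> derivable f x (delta_mx 0 i)) /\
                     Ck_on k' U ('D_(delta_mx 0 i) f)
  else True.

Definition smooth_on {n : nat} {W : normedModType R}
    (U : set 'rV[R]_n) (f : 'rV[R]_n -> W) : Prop :=
  forall k, Ck_on k U f.

(* psi restricted to V is an inverse chart of Sigma: a smooth immersion which is
   a homeomorphism from V onto a relatively open subset of Sigma. The rows of
   the d x N matrix 'J psi u are the partial derivatives of psi at u. *)
Definition local_param {N d : nat} (Sigma : set 'rV[R]_N)
    (V : set 'rV[R]_d) (psi : 'rV[R]_d -> 'rV[R]_N) : Prop :=
  [/\ open V,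
      smooth_on V psi,
      set_inj V psi,
      (forall u, V u -> row_free ('J psi u)) &
      forall W : set 'rV[R]_d, open W -> W `<=` V ->
        exists2 U : set 'rV[R]_N, open U & psi @` W = Sigma `&` U].

Definition smooth_submanifold {N : nat} (d : nat) (Sigma : set 'rV[R]_N) :=
  forall p, Sigma p -> exists (V : set 'rV[R]_d) (psi : 'rV[R]_d -> 'rV[R]_N),
    local_param Sigma V psi /\ (psi @` V) p.

(* the Gram matrix of the metric induced by the Euclidean inner product *)
Definition metric_mx {N d : nat} (psi : 'rV[R]_d -> 'rV[R]_N) (u : 'rV[R]_d) :
    'M[R]_d :=
  \matrix_(i, j) dotv ('D_(delta_mx 0 i) psi u) ('D_(delta_mx 0 j) psi u).

(* mu is dvol_Sigma, extended by 0 off Sigma: it has density sqrt (det g) in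
   every chart. Covering Sigma by countably many charts, this determines mu. *)
Definition riemannian_volume {N : nat} (d : nat) (Sigma : set 'rV[R]_N)
    (mu : {measure set (borelRV R N) -> \bar R}) : Prop :=
  mu (~` Sigma) = 0%E /\
  forall (V : set 'rV[R]_d) (psi : 'rV[R]_d -> 'rV[R]_N),
    local_param Sigma V psi ->
    forall A : set (borelRV R N), measurable A -> A `<=` psi @` V ->
      mu A = (\int[lebesgue_rV d]_(u in V `&` psi @^-1` A)
                (Num.sqrt (\det (metric_mx psi u)))%:E)%E.

End submanifold.

Section operators.
Context {R : realType} {N : nat}.
Implicit Types (f u v : 'rV[R]_N -> R) (x : 'rV[R]_N) (t : R).
Implicit Type L : ('rV[R]_N -> R) -> ('rV[R]_N -> R).

Definition gauss_kernel t x y : R := expR (- (enorm (x - y) ^+ 2 / (2 * t))).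

Definition theta (Sigma : set 'rV[R]_N)
    (mu : {measure set (borelRV R N) -> \bar R}) t x : R :=
  \int[mu]_(y in Sigma) gauss_kernel t x y.

Definition Lop (Sigma : set 'rV[R]_N)
    (mu : {measure set (borelRV R N) -> \bar R}) t f x : R :=
  2 / (t * theta Sigma mu t x) *
  \int[mu]_(y in Sigma) ((f y - f x) * gauss_kernel t x y).

Definition theta_hat (n : nat) (xi : nat -> 'rV[R]_N) t x : R :=
  n%:R^-1 * \sum_(j < n) gauss_kernel t (xi j) x.

Definition Lop_hat (n : nat) (xi : nat -> 'rV[R]_N) t f x : R :=
  2 / (t * theta_hat n xi t x) *
  (n%:R^-1 * \sum_(j < n) gauss_kernel t (xi j) x * (f (xi j) - f x)).

Definition Gamma L u v : 'rV[R]_N -> R :=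
  fun x => 2^-1 * (L (u \* v) x - L u x * v x - u x * L v x).

Definition Gamma2 L u v : 'rV[R]_N -> R :=
  fun x => 2^-1 * (L (Gamma L u v) x - Gamma L (L u) v x - Gamma L u (L v) x).

Definition linear_ball (M : R) : set ('rV[R]_N -> R) :=
  [set f | exists2 zeta : 'rV[R]_N, enorm zeta <= M & f = dotv zeta].

End operators.

Definition bandwidth {R : realType} (d : nat) (sigma : R) (n : nat) : R :=
  n%:R `^ (- (1 / (3 * d%:R + 3 + sigma))).

Section sampling.
Context {R : realType} {N : nat} {disp : measure_display}.
Context {Omega : measurableType disp} (P : probability Omega R).

Definition mutually_independent (xi : nat -> {RV P >-> borelRV R N}) : Prop :=
  forall (J : seq nat) (A : nat -> set (borelRV R N)), uniq J ->
    (forall j, measurable (A j)) ->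
    P (\bigcap_(j in [set` J]) (xi j @^-1` A j)) =
    (\prod_(j <- J) P (xi j @^-1` A j))%E.

Definition uniformly_distributed (Sigma : set 'rV[R]_N)
    (mu : {measure set (borelRV R N) -> \bar R})
    (X : {RV P >-> borelRV R N}) : Prop :=
  forall A : set (borelRV R N), measurable A ->
    distribution P X A = (fine (mu (A `&` Sigma)) / fine (mu Sigma))%:E.

End sampling.

(* Main.v *)
Require Import Defs.
From mathcomp Require Import all_boot all_order all_algebra.
From mathcomp Require Import all_classical all_reals all_analysis.
From mathcomp Require Import measurable_realfun ring lra.

(** Put tau = sqrt t. Both operators have the form
    L f (x) = (2/t) E((f - f(x)) k_x) / E(k_x), where k_x is the Gaussian kernel
    centred at x and E is the mean against the uniform law for L_t, the mean over
    the first n sample points for its empirical version [mean_laplacian]. The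
    theorem thus compares two means of functions multiplied by k_x, uniformly
    in x.

    - Denominators. In a chart the density of the volume is bounded below and the
      chart is Lipschitz, so by compactness the balls of small radius r centred
      on Sigma have volume at least c r^d [volume_ball_ge]. Hence E(k_x) is at
      least kappa, a multiple of tau^d [kernel_mean_ge].

    - Numerators. Let psi_n(x, y) be bounded by 1, with a Lipschitz constant in x
      that is polynomial in n. Almost surely, for n large, the empirical means of
      psi_n(x, .) differ from the expectations by at most
      delta = 3 n^(-1/2 + eps) for all x in Sigma [uniform_lln]: the inequality of
      Hoeffding applies at the polynomially many points of a fine grid, and the
      lemma of Borel and Cantelli to the union of these events.

    - Nested means. One has
      Gamma(u, v)(x) = (1/t) E((u - u(x)) (v - v(x)) k_x) / E(k_x), so Gamma_2
      contains means of Gamma(u, v), L u and L v. In the empirical Gamma_2 these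
      are random functions, beyond the reach of the law of large numbers. They
      are however uniformly close on Sigma to the functions formed with the law,
      and replacing them costs no more than this distance, because means are
      monotone and the sample lies in Sigma. What remains are means of
      deterministic functions times k_x. As an increment of a Lipschitz function
      times k_x is O(tau), the total error is O(delta tau^-3 kappa^-2)
      [Gamma2_dist_le].

    - Bandwidth. For t = n^(-a) with a (3d + 3 + sigma) = 1 and eps = a sigma / 4,
      the error is O(n^(-b)) with b = a sigma / 4 + a d / 2 > 0
      [Gamma2_dist_rate].

    A smooth function is Lipschitz on the compact set Sigma, which gives (a). For
    (b), Gamma_2 is bilinear and a linear form is a combination of the N
    coordinates with coefficients bounded by M, so that finitely many pairs of
    coordinates control all forms at once. *)

Set Implicit Arguments.
Unset Strict Implicit.
Unset Printing Implicit Defensive.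
Import Order.TTheory GRing.Theory Num.Theory.
Import numFieldNormedType.Exports.

Local Open Scope classical_set_scope.
Local Open Scope ring_scope.

(** * Gram determinants and Lipschitz bounds from partial derivatives *)

Lemma dotv_mulmx (R : realType) n (x y : 'rV[R]_n) : dotv x y = (x *m y^T) 0 0.
Proof. by rewrite mxE; apply: eq_bigr => i _; rewrite mxE. Qed.

Lemma dotv_ge0 (R : realType) n (x : 'rV[R]_n) : 0 <= dotv x x.
Proof. by apply: sumr_ge0 => i _; rewrite -expr2 sqr_ge0. Qed.

Lemma dotv_eq0 (R : realType) n (x : 'rV[R]_n) : dotv x x <= 0 -> x = 0.
Proof.
move=> x0; have /eqP : dotv x x == 0 by rewrite eq_le x0 dotv_ge0.
move=> /psumr_eq0P x00; apply/rowP => i; rewrite mxE; apply/eqP.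
by rewrite -sqrf_eq0 expr2; apply/eqP/x00 => // j _; rewrite -expr2 sqr_ge0.
Qed.

(** For s >= 0 the matrix J J^T + s is injective, so the monic polynomial
    det (s + J J^T) has no root on the half line; its value at 0 is therefore
    positive, like its values at infinity. *)
Lemma det_gram_gt0 (R : realType) d N (J : 'M[R]_(d, N)) :
  row_free J -> 0 < \det (J *m J^T).
Proof.
move=> Jfree; set A := J *m J^T; pose p := char_poly (- A).
have noroot s : 0 <= s -> ~~ root p s.
  move=> s0; rewrite -eigenvalue_root_char; apply/negP => /eigenvalueP[v vA v0].
  have vJ : dotv (v *m J) (v *m J) = - (s * dotv v v).
    rewrite !dotv_mulmx trmx_mul mulmxA -(mulmxA v) -/A.
    have -> : v *m A = - (s *: v) by rewrite -vA mulmxN opprK.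
    by rewrite mulNmx -scalemxAl !mxE.
  have : v *m J = 0.
    by apply: dotv_eq0; rewrite vJ oppr_le0 mulr_ge0// dotv_ge0.
  by move=> /eqP; rewrite mulmx_free_eq0// (negbTE v0).
have detp : \det A = p.[0].
  rewrite horner_coef0 char_poly_det -(scaleN1r A) detZ mulrA -exprD addnn -mul2n.
  by rewrite exprM sqrrN !expr1n mul1r.
rewrite detp ltNge; apply/negP => p0.
have [b pb] := monic_Cauchy_bound (char_poly_monic (- A)).
have b0 : 0 <= Num.max 0 b by rewrite le_max lexx.
have pb0 : 0 <= p.[Num.max 0 b] by rewrite ltW// pb// le_max lexx orbT.
have [|x] := @poly_ivt R p _ _ b0; first by rewrite p0 pb0.
by move=> /andP[x0 _]; exact/negP/noroot.
Qed.

Section euclidean_norm.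
Context {R : realType} {n : nat}.
Implicit Types x y : 'rV[R]_n.

Lemma coord_le_norm x i : `|x 0 i| <= `|x|.
Proof.
rewrite [leRHS]/Num.norm /= mx_normrE.
by apply/bigmax_geP; right => /=; exists (0, i).
Qed.

Lemma norm_le_coord x c : 0 <= c -> (forall i, `|x 0 i| <= c) -> `|x| <= c.
Proof.
move=> c0 xc; rewrite [leLHS]/Num.norm /= mx_normrE.
by apply/bigmax_leP; split=> // -[i j] _; rewrite ord1; exact: xc.
Qed.

Lemma dotv_le_norm x y : `|dotv x y| <= n%:R * (`|x| * `|y|).
Proof.
apply: le_trans (ler_norm_sum _ _ _) _.
have -> : n%:R * (`|x| * `|y|) = \sum_(i < n) `|x| * `|y|.
  by rewrite sumr_const card_ord mulr_natl.
by apply: ler_sum => i _; rewrite normrM ler_pM// coord_le_norm.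
Qed.

Lemma sqr_enorm x : enorm x ^+ 2 = dotv x x.
Proof. by rewrite sqr_sqrtr// dotv_ge0. Qed.

End euclidean_norm.

(** The differential at a point without derivative is the default value 0, whose
    matrix is not row-free in positive dimension. *)
Lemma jacobian_row_free_differentiable (R : realType) d N
    (psi : 'rV[R]_d.+1 -> 'rV[R]_N) (u : 'rV[R]_d.+1) :
  row_free ('J psi u) -> differentiable psi u.
Proof.
move=> Jfree; apply: contrapT => nd.
have d0 v : 'd psi u v = 0.
  rewrite /diff getPN // => df [cdf dfP]; apply: nd; apply/diffP.
  suff : [set df : {linear 'rV[R]_d.+1 -> 'rV[R]_N} |
      continuous df /\ forall x, psi x = psi (lim (nbhs u)) +
        df (x - lim (nbhs u)) +o_(x \near nbhs u) (x - lim (nbhs u))]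
      (get (fun df : {linear 'rV[R]_d.+1 -> 'rV[R]_N} =>
      continuous df /\ forall x, psi x = psi (lim (nbhs u)) +
        df (x - lim (nbhs u)) +o_(x \near nbhs u) (x - lim (nbhs u)))) by [].
  by apply: getPex; exists df; split.
have J0 : 'J psi u = 0.
  by apply/matrixP => i j; rewrite !mxE d0 mxE.
by move: Jfree; rewrite J0 /row_free mxrank0.
Qed.

(** Differentiability makes the partial derivatives the rows of the Jacobian, and
    the metric its Gram matrix. *)
Lemma metric_mx_gt0 (R : realType) d N (psi : 'rV[R]_d -> 'rV[R]_N) u :
  row_free ('J psi u) -> 0 < \det (metric_mx psi u).
Proof.
case: d psi u => [psi u _|d psi u Jfree]; first by rewrite det_mx00.
have dpsi := jacobian_row_free_differentiable Jfree.
rewrite (_ : metric_mx psi u = 'J psi u *m ('J psi u)^T); first exact: det_gram_gt0.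
apply/matrixP => i j; rewrite !mxE; apply: eq_bigr => k _.
by rewrite !deriveEjacobian// -!rowE !mxE.
Qed.

Section lipschitz_of_partials.
Context {R : realType} {n : nat}.

Lemma is_derive_line (f : 'rV[R]_n -> R) (x v : 'rV[R]_n) (s : R) :
  derivable f (s *: v + x) v ->
  is_derive s 1 (fun s' => f (s' *: v + x)) ('D_v f (s *: v + x)).
Proof.
move=> df; have E : (fun h : R => h^-1 *:
    (((fun s' => f (s' *: v + x)) \o shift s) (h *: 1) - f (s *: v + x))) =
    (fun h => h^-1 *: ((f \o shift (s *: v + x)) (h *: v) - f (s *: v + x))).
  apply/funext => h /=; congr (_ *: (f _ - _)).
  by rewrite -[h *: 1]/(h * 1) mulr1 scalerDl addrA.
by constructor; rewrite /derivable /derive E.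
Qed.

Lemma partial_step (f : 'rV[R]_n -> R) (x v : 'rV[R]_n) (K h : R) :
  (forall s, 0 <= s <= h -> derivable f (s *: v + x) v /\
     `|'D_v f (s *: v + x)| <= K) -> 0 <= h ->
  `|f (h *: v + x) - f x| <= K * h.
Proof.
move=> df h0.
have dg s : s \in `[0, h] ->
    is_derive s 1 (fun s' => f (s' *: v + x)) ('D_v f (s *: v + x)).
  by rewrite in_itv/= => /df[? _]; exact: is_derive_line.
have cg : {within `[0, h], continuous (fun s' => f (s' *: v + x))}.
  by apply: derivable_within_continuous => s /dg sh; exact: ex_derive.
have dg' s : s \in `]0, h[ ->
    is_derive s 1 (fun s' => f (s' *: v + x)) ('D_v f (s *: v + x)).
  by move=> /subset_itv_oo_cc; exact: dg.
have [c ch] := MVT_segment h0 dg' cg.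
rewrite scale0r add0r subr0 => ->; rewrite normrM (ger0_norm h0).
by rewrite ler_wpM2r//; move: ch; rewrite in_itv/= => /df[].
Qed.

(** Balls of the sup norm are cubes: x and y are joined inside the ball by n
    segments parallel to the axes, with the mean value theorem on each. *)
Lemma lipschitz_ball (f : 'rV[R]_n -> R) (c : 'rV[R]_n) (r K : R) :
  (forall x, ball c r x -> forall i, derivable f x (delta_mx 0 i) /\
     `|'D_(delta_mx 0 i) f x| <= K) ->
  forall x y, ball c r x -> ball c r y -> `|f x - f y| <= n%:R * K * `|x - y|.
Proof.
move=> df x y cx cy.
have r0 : 0 < r by case: cx.
(* replacing the coordinates of x by those of y one at a time stays in the cube *)
pose z k : 'rV[R]_n := \row_j (if (j < k)%N then y 0 j else x 0 j).
have zball p i s : ball c r p -> ball c r (p + s *: delta_mx 0 i) ->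
    forall s', (0 <= s' <= s) || (s <= s' <= 0) -> ball c r (p + s' *: delta_mx 0 i).
  move=> /(ball_rVP _ _ r0) cp /(ball_rVP _ _ r0) cps s' ss'.
  apply/ball_rVP => // j; move: (cp j) (cps j).
  rewrite /ball/= !mxE eqxx /=; case: (j == i); rewrite ?mulr0 ?addr0//= !mulr1.
  rewrite !ltr_norml => /andP[p1 p2] /andP[p3 p4].
  by case/orP : ss' => /andP[? ?]; apply/andP; split; lra.
have step p i s : ball c r p -> ball c r (p + s *: delta_mx 0 i) ->
    `|f (p + s *: delta_mx 0 i) - f p| <= K * `|s|.
  move=> cp cps; have [s0|s0] := leP 0 s.
    rewrite (ger0_norm s0) (addrC p); apply: partial_step => // s' ss'.
    by apply: df; rewrite (addrC _ p); apply: (zball _ _ s) => //; rewrite ss'.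
  rewrite distrC (ltr0_norm s0).
  have {1}-> : p = (- s) *: delta_mx 0 i + (p + s *: delta_mx 0 i).
    by rewrite addrCA scaleNr addNr addr0.
  apply: partial_step => [s' ss'|]; last lra.
  apply: df; rewrite addrCA -scalerDl; apply: (zball _ _ s) => //.
  by apply/orP; right; lra.
have zb k : ball c r (z k).
  apply/ball_rVP => // j; rewrite mxE.
  by case: ifP => _; [exact: (ball_rVP _ _ r0).1 cy j|
    exact: (ball_rVP _ _ r0).1 cx j].
have K0 (i : 'I_n) : 0 <= K by apply: le_trans (df x cx i).2.
have zstep k : (k < n)%N -> `|f (z k.+1) - f (z k)| <= K * `|x - y|.
  move=> kn; pose i := Ordinal kn.
  have zE : z k.+1 = z k + (y 0 i - x 0 i) *: delta_mx 0 i.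
    apply/rowP => j; rewrite !mxE ltnS leq_eqVlt eqxx /=.
    have [->|ji] := eqVneq j i; first by rewrite eqxx ltnn mulr1 addrC subrK.
    by rewrite mulr0 addr0 [(_ == _ :> nat)](negbTE ji).
  rewrite zE; apply: (@le_trans _ _ (K * `|y 0 i - x 0 i|)).
    by apply: step; rewrite -?zE.
  rewrite ler_wpM2l ?(K0 i)// distrC.
  by have := coord_le_norm (x - y) i; rewrite !mxE.
have zn : z n = y by apply/rowP => j; rewrite mxE ltn_ord.
have z0 : z 0 = x by apply/rowP => j; rewrite mxE.
have zk k : (k <= n)%N -> `|f (z k) - f x| <= k%:R * (K * `|x - y|).
  elim: k => [|k IH] kn; first by rewrite z0 subrr normr0 mul0r.
  rewrite -(subrK (f (z k)) (f (z k.+1))) -addrA -natr1 mulrDl mul1r addrC.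
  by apply: le_trans (ler_normD _ _) _; rewrite lerD ?zstep ?IH// ltnW.
by rewrite distrC -mulrA; have := zk n (leqnn n); rewrite zn.
Qed.

End lipschitz_of_partials.

(** * Volume of small balls of a submanifold *)

Lemma continuous_measurable_rV (R : realType) n (D : set 'rV[R]_n)
    (f : 'rV[R]_n -> R) :
  measurable (D : set (borelRV R n)) -> {within D, continuous f} ->
  measurable_fun (D : set (borelRV R n)) (f : borelRV R n -> R).
Proof.
move=> mD cf; apply: (measurability _ (RGenOpens.measurableE R)).
move=> _ [_ [a [b ->] <-]].
have oab : open `]a, b[%classic by exact: interval_open.
have /open_subspaceP[V oV VD] := (continuousP (f : subspace D -> R)).1 cf _ oab.
rewrite setIC -VD; apply: measurableI => //; exact: open_measurable_rV.
Qed.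

Lemma compact_measurable_rV (R : realType) n (K : set 'rV[R]_n) :
  compact K -> measurable (K : set (borelRV R n)).
Proof.
move=> cK; rewrite -(setCK K); apply: measurableC; apply: open_measurable_rV.
by apply/closed_openC; apply: compact_closed.
Qed.

Lemma cvg_sum_real (R : realType) (T I : Type) (F : set_system T) (r : seq I)
    (f : I -> T -> R) (l : I -> R) : Filter F ->
  (forall i, f i x @[x --> F] --> l i) ->
  \sum_(i <- r) f i x @[x --> F] --> \sum_(i <- r) l i.
Proof.
by move=> FF fl; apply: cvg_big => //; exact: add_continuous.
Qed.

Lemma cvg_prod_real (R : realType) (T I : Type) (F : set_system T) (r : seq I)
    (f : I -> T -> R) (l : I -> R) : Filter F ->
  (forall i, f i x @[x --> F] --> l i) ->
  \prod_(i <- r) f i x @[x --> F] --> \prod_(i <- r) l i.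
Proof.
by move=> FF fl; apply: cvg_big => //; exact: mul_continuous.
Qed.

Lemma cvg_det (R : realType) (T : Type) (F : set_system T) n
    (A : T -> 'M[R]_n) (B : 'M[R]_n) : Filter F ->
  (forall i j, A x i j @[x --> F] --> B i j) ->
  \det (A x) @[x --> F] --> \det B.
Proof.
move=> FF AB; apply: cvg_sum_real => s; apply: cvgM; first exact: cvg_cst.
by apply: cvg_prod_real => i; exact: AB.
Qed.

Section local_volume.
Context {R : realType} {N d : nat} (Sigma : set 'rV[R]_N).
Context (V : set 'rV[R]_d) (psi : 'rV[R]_d -> 'rV[R]_N).
Hypothesis chart : local_param Sigma V psi.

Lemma chart_C1 u : V u -> forall i,
  derivable psi u (delta_mx 0 i) /\ {for u, continuous ('D_(delta_mx 0 i) psi)}.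
Proof.
case: chart => _ sm _ _ _ Vu i; have [_ /(_ i)[dpsi [cD _]]] := sm 1%N.
by split; [exact: dpsi|exact: cD].
Qed.

Lemma chart_density_continuous u : V u ->
  {for u, continuous (fun v => Num.sqrt (\det (metric_mx psi v)))}.
Proof.
move=> Vu; apply: (@continuous_comp _ _ _ (fun v => \det (metric_mx psi v))).
  apply: (@cvg_det _ _ (nbhs u)) => i j; rewrite mxE.
  under eq_cvg do rewrite mxE.
  apply: (@cvg_sum_real _ _ _ (nbhs u)) => k; have [_ ci] := chart_C1 Vu i.
  have [_ cj] := chart_C1 Vu j.
  have coordc := @coord_continuous R 1 N 0 k.
  apply: cvgM; first exact: (continuous_comp ci (coordc _)).
  exact: (continuous_comp cj (coordc _)).
exact: sqrt_continuous.
Qed.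

(** The partial derivatives are continuous, hence bounded near u0. *)
Lemma chart_lipschitz u0 : V u0 ->
  exists2 K : R, 0 < K & \forall s \near 0^'+,
    forall u v, ball u0 s u -> ball u0 s v -> `|psi u - psi v| <= K * `|u - v|.
Proof.
move=> Vu0; have [oV _ _ _ _] := chart.
pose K := 1 + \sum_(i < d) `|'D_(delta_mx 0 i) psi u0|.
have K1 : 1 <= K by rewrite lerDl sumr_ge0.
have bnd : \forall u \near u0, V u /\
    forall i, `|'D_(delta_mx 0 i) psi u| <= K.
  apply: filterI; first exact: open_nbhs_nbhs.
  apply: (@filter_forall _ _
    (fun i u => `|'D_(delta_mx 0 i) psi u| <= K) (nbhs u0)) => i.
  have [_ ci] := chart_C1 Vu0 i.
  near=> u.
  have : `|'D_(delta_mx 0 i) psi u0 - 'D_(delta_mx 0 i) psi u| < 1.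
    by near: u; move/cvgrPdist_lt : ci => /(_ 1 ltr01).
  move=> uu0; rewrite (@le_trans _ _ (1 + `|'D_(delta_mx 0 i) psi u0|))//.
    rewrite -[X in `|X| <= _](subKr ('D_(delta_mx 0 i) psi u0)).
    by rewrite (le_trans (ler_normB _ _))// addrC lerD// ltW.
  by rewrite lerD2l (bigD1 i)//= lerDl sumr_ge0.
(* the summand 1 keeps the constant positive in dimension 0 *)
exists (1 + d%:R * K).
  by rewrite addrC ltr_wpDl// mulr_ge0// (le_trans _ K1).
have [e /= e0 eV] := (nbhs_ballP _ _).1 bnd.
near=> s => u v su sv.
have se : s <= e by near: s; apply: nbhs_right_le.
have sV w : ball u0 s w -> V w /\ forall i, `|'D_(delta_mx 0 i) psi w| <= K.
  by move=> sw; apply: eV; exact: le_ball sw.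
apply: norm_le_coord.
  by rewrite mulr_ge0// addr_ge0// mulr_ge0// (le_trans _ K1).
move=> j; rewrite !mxE.
apply: (@le_trans _ _ (d%:R * K * `|u - v|)); last first.
  by rewrite ler_wpM2r// lerDr.
apply: (@lipschitz_ball _ _ (fun w => psi w 0 j) u0 s) => // w sw i.
have [Vw Dw] := sV _ sw; have [dw _] := chart_C1 Vw i.
split; first by move/derivable_mxP : dw; exact.
apply: le_trans (Dw i); have := coord_le_norm ('D_(delta_mx 0 i) psi w) j.
by rewrite (derive_mx dw) mxE.
Unshelve. all: by end_near. Qed.

End local_volume.

Lemma lebesgue_rV_ball (R : realType) d (u : 'rV[R]_d) (r : R) : 0 < r ->
  lebesgue_rV d (ball u r : set (borelRV R d)) = ((r *+ 2) ^+ d)%:E.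
Proof.
move=> r0; pose A i : set (measurableTypeR R) := ball (u 0 i : R) r.
have mA i : measurable (A i) by exact: (open_measurable (ball_open _ _)).
rewrite (_ : ball u r = [set v | forall i, A i (v 0 i)]); last first.
  by apply/seteqP; split => v /(ball_rVP _ _ r0).
rewrite (lebesgue_rV_box mA) (eq_bigr (fun=> (r *+ 2)%:E)) => [|i _].
  by rewrite prodEFin prodr_const card_ord.
by rewrite /A lebesgue_measure_ball// ltW.
Qed.

(** Near a point of a chart, the density of the volume is bounded below and the
    chart is Lipschitz, so the image of the cube of half-side r/K has volume at
    least a multiple of r^d and lies in the ball of radius r. *)
Lemma chart_volume_ge (R : realType) N d (Sigma : set 'rV[R]_N)
    (mu : {measure set (borelRV R N) -> \bar R})
    (V : set 'rV[R]_d) (psi : 'rV[R]_d -> 'rV[R]_N) (u0 : 'rV[R]_d) :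
  measurable (Sigma : set (borelRV R N)) ->
  riemannian_volume d Sigma mu -> local_param Sigma V psi -> V u0 ->
  exists c : R, [/\ 0 < c & exists2 r0 : R, 0 < r0 & \forall x \near psi u0,
    Sigma x -> forall r, 0 < r < r0 ->
      ((c * r ^+ d)%:E <= mu (Sigma `&` ball x r))%E].
Proof.
move=> mSigma [_ vol] chart Vu0; have [oV _ psiinj Jfree psiopen] := chart.
pose rho u := Num.sqrt (\det (metric_mx psi u)).
have rho0 : 0 < rho u0 by rewrite sqrtr_gt0 metric_mx_gt0//; exact: Jfree.
have [K K0 lipK] := chart_lipschitz chart Vu0.
exists (rho u0 / 2 * (2 / K) ^+ d); split.
  by rewrite mulr_gt0 ?exprn_gt0 ?divr_gt0.
have [e /= e0 eV] : exists2 e : R, 0 < e &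
    forall u, ball u0 e u -> V u /\ rho u0 / 2 <= rho u.
  apply/nbhs_ballP; apply: filterI; first exact: open_nbhs_nbhs.
  have crho : {for u0, continuous rho} by exact: chart_density_continuous chart _ Vu0.
  have rho20 : 0 < rho u0 / 2 by rewrite divr_gt0.
  have /cvgrPdist_lt/(_ _ rho20) := crho.
  clearbody rho; apply: filterS => u; rewrite ltr_norml => /andP[_]; lra.
have [s [s0 se lips]] : exists s, [/\ 0 < s, s + s < e & forall u v,
    ball u0 (s + s) u -> ball u0 (s + s) v -> `|psi u - psi v| <= K * `|u - v|].
  have : \forall s \near 0^'+, [/\ 0 < s, s < e & forall u v,
      ball u0 s u -> ball u0 s v -> `|psi u - psi v| <= K * `|u - v|].
    near=> s; split; [by []|by []|by near: s].
  move=> /filter_ex[s [s0 se sK]]; exists (s / 2).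
  by rewrite divr_gt0// -splitr; split.
have sV u : ball u0 (s + s) u -> V u /\ rho u0 / 2 <= rho u.
  by move=> us; apply: eV; apply: le_ball us; exact: ltW.
exists (s * K); first by rewrite mulr_gt0.
have [U oU psiU] : exists2 U : set 'rV[R]_N, open U &
    psi @` (ball u0 s) = Sigma `&` U.
  apply: psiopen; first exact: ball_open.
  by move=> u us; apply: (sV _ _).1; apply: le_ball us; rewrite lerDl ltW.
have Upsi : U (psi u0).
  suff : (Sigma `&` U) (psi u0) by case.
  by rewrite -psiU; exists u0 => //; exact: ballxx.
have : \forall x \near psi u0, U x by exact: open_nbhs_nbhs.
apply: filterS => x Ux Sx r /andP[r0 rsK].
have rs : r / K < s by rewrite ltr_pdivrMr.
have rK0 : 0 < r / K by rewrite divr_gt0.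
have [u us ux] : (psi @` ball u0 s) x by rewrite psiU.
have uV : ball u (r / K) `<=` ball u0 (s + s).
  by move=> v uv; apply: (ball_triangle us); apply: le_ball uv; exact: ltW.
have uVV : ball u (r / K) `<=` V by move=> v /uV/sV[].
have [U' oU' psiU'] := psiopen _ (ball_open u _) uVV.
pose A := psi @` ball u (r / K).
have mSU : measurable (A : set (borelRV R N)).
  by rewrite /A psiU'; apply: measurableI => //; exact: open_measurable_rV.
have AE : V `&` psi @^-1` A = ball u (r / K).
  apply/seteqP; split => [v [Vv [w uw wv]]|v uv].
    suff -> : v = w by [].
    by apply: psiinj; rewrite ?inE//; exact: uVV.
  by split; [exact: uVV|exists v].
have Ax : A `<=` Sigma `&` ball x r.
  rewrite /A; move=> y Ay; split; first by move: Ay; rewrite psiU' => -[].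
  case: Ay => v uv <-; rewrite -ux -ball_normE /=.
  apply: le_lt_trans (lips _ _ (uV _ (ballxx _ rK0)) (uV _ uv)) _.
  by rewrite mulrC -ltr_pdivlMr//; move: uv; rewrite -ball_normE.
have mux : (mu A <= mu (Sigma `&` ball x r))%E.
  apply: le_measure => //; rewrite inE//; apply: measurableI => //.
  by apply: open_measurable_rV; exact: ball_open.
apply: le_trans mux; rewrite (vol V psi)//; last by move=> y [v /uVV Vv <-]; exists v.
rewrite AE; apply: (@le_trans _ _
    (\int[lebesgue_rV d]_(v in ball u (r / K)) (rho u0 / 2)%:E)%E).
  rewrite integral_cst//; last by apply: open_measurable_rV; exact: ball_open.
  rewrite [X in (_ <= _ * X)%E](_ : _ = ((r / K *+ 2) ^+ d)%:E); last first.
    exact: lebesgue_rV_ball.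
  rewrite -EFinM lee_fin (_ : r / K *+ 2 = 2 / K * r).
    by rewrite [in leRHS]exprMn mulrA.
  by rewrite -mulr_natl mulrA mulrAC.
apply: ge0_le_integral.
- by apply: open_measurable_rV; exact: ball_open.
- by move=> v _; rewrite lee_fin ltW// divr_gt0.
- exact: measurable_cst.
- apply/measurable_EFinP; apply: continuous_measurable_rV.
    by apply: open_measurable_rV; exact: ball_open.
  apply: continuous_in_subspaceT => v; rewrite inE => /uVV Vv.
  exact: (chart_density_continuous chart Vv).
- by move=> v /uV/sV[_]; rewrite lee_fin.
Unshelve. all: by end_near. Qed.

(** Compactness makes the local bounds uniform. One number c serves as constant
    and as bound on the radius, so that the property for c implies it for all
    smaller values. *)
Lemma volume_ball_ge (R : realType) N d (Sigma : set 'rV[R]_N)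
    (mu : {measure set (borelRV R N) -> \bar R}) :
  compact Sigma -> smooth_submanifold d Sigma -> riemannian_volume d Sigma mu ->
  \forall c \near 0^'+, forall x r, Sigma x -> 0 < r < c ->
    ((c * r ^+ d)%:E <= mu (Sigma `&` ball x r))%E.
Proof.
move=> cSigma smSigma vol.
have mSigma := compact_measurable_rV cSigma.
pose Q (c : R) (x : 'rV[R]_N) := Sigma x -> forall r, 0 < r < c ->
  ((c * r ^+ d)%:E <= mu (Sigma `&` ball x r))%E.
suff : \forall c \near 0^'+, Sigma `<=` Q c.
  by apply: filterS => c cQ x r Sx; exact: cQ.
move: cSigma => /compact_near_coveringP; apply => p Sp.
have [V [psi [chart [u0 Vu0 <-]]]] := smSigma _ Sp.
have [c [c0 [r0 r00 volc]]] := chart_volume_ge mSigma vol chart Vu0.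
near=> x b.
have volx : Sigma x -> forall r, 0 < r < r0 ->
    ((c * r ^+ d)%:E <= mu (Sigma `&` ball x r))%E by near: x.
move=> Sx r /andP[rgt0 rb].
have bc : b <= c by near: b; exact: nbhs_right_le.
have br0 : b <= r0 by near: b; exact: nbhs_right_le.
apply: le_trans (volx Sx r _); last by rewrite rgt0 (lt_le_trans rb).
by rewrite lee_fin ler_wpM2r// exprn_ge0// ltW.
Unshelve. all: by end_near. Qed.

(** * Expectation of products of independent variables *)

Section independent_factor.
Context {d1 d2 : measure_display} {T : measurableType d1} {T' : measurableType d2}.
Context {R : realType} (mu : {measure set T -> \bar R}) (nu : {measure set T' -> \bar R}).
Variables (X : T -> T') (Z : T -> \bar R) (c : \bar R).
Hypotheses (mX : measurable_fun setT X) (mZ : measurable_fun setT Z).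
Hypothesis Z0 : forall w, (0 <= Z w)%E.
Hypothesis XZ : forall B, measurable B ->
  (\int[mu]_(w in X @^-1` B) Z w = c * nu B)%E.

Import HBNNSimple.

Let XZ_nnsfun (h : {nnsfun T' >-> R}) :
  (\int[mu]_w ((h (X w))%:E * Z w) = c * \int[nu]_y (h y)%:E)%E.
Proof.
have mXh r : measurable (X @^-1` (h @^-1` [set r])).
  by rewrite -[X in measurable X]setTI; exact: mX.
have h0 r : preimage h [set r] !=set0 -> 0 <= r.
  by move=> [x /= <-].
have c0 : (0 <= c * nu setT)%E by rewrite -XZ//; exact: integral_ge0.
transitivity (\sum_(r \in range h)
    \int[mu]_w (r%:E * (Z \_ (X @^-1` (h @^-1` [set r]))) w))%E.
  rewrite -ge0_integral_fsum//.
  - apply: eq_integral => w _; rewrite fimfunE -fsumEFin// ge0_mule_fsuml; last first.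
      by move=> r; rewrite nnfun_muleindic_ge0.
    apply: eq_fsbigr => r _; rewrite epatch_indic /= EFinM -muleA; congr (_ * _)%E.
    by rewrite muleC.
  - move=> r; apply: measurable_funeM.
    by apply/(measurable_restrictT _ _).1 => //; exact: measurable_funTS.
  - move=> r w _; rewrite patchE; case: ifPn => [|_]; last by rewrite mule0.
    by rewrite inE => /= hr; rewrite mule_ge0// lee_fin -hr.
rewrite [in RHS]integralT_nnsfun sintegralE ge0_mule_fsumr; last first.
  by move=> r; exact: nnsfun_mulemu_ge0.
apply: eq_fsbigr => r; rewrite inE => -[y _ yr].
have r0 : 0 <= r by rewrite -yr.
rewrite ge0_integralZl_EFin//; last 2 first.
  - by move=> w _; rewrite patchE; case: ifPn.
  - by apply/(measurable_restrictT _ _).1 => //; exact: measurable_funTS.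
by rewrite -integral_mkcond XZ// muleCA.
Qed.

(** Linearity for simple functions, then monotone convergence, extend the
    hypothesis XZ from indicator functions to g. When nu is the law of X and c
    the mean of Z, XZ expresses the independence of X and Z. *)
Lemma integral_comp_factor (g : T' -> \bar R) : c \is a fin_num ->
  (forall w, Z w \is a fin_num) ->
  measurable_fun setT g -> (forall y, 0 <= g y)%E ->
  (\int[mu]_w (g (X w) * Z w) = c * \int[nu]_y g y)%E.
Proof.
move=> cfin Zfin mg g0; pose h := nnsfun_approx measurableT mg.
have hg y : (h n y)%:E @[n --> \oo] --> g y by exact: cvg_nnsfun_approx.
have ndh m n y : (m <= n)%N -> h m y <= h n y.
  by move=> mn; exact/lefP/nd_nnsfun_approx.
have mhX n : measurable_fun setT (fun w => (h n (X w))%:E).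
  by apply/measurable_EFinP; apply: measurableT_comp.
have L : (\int[mu]_w ((h n (X w))%:E * Z w))%E @[n --> \oo] -->
    (\int[mu]_w (g (X w) * Z w))%E.
  rewrite [X in _ --> X](_ : _ =
      (\int[mu]_w (limn (fun n => (h n (X w))%:E * Z w)))%E); last first.
    apply: eq_integral => w _; apply/esym/cvg_lim => //.
    by apply: cvgeZr => //; exact: hg.
  apply: cvg_monotone_convergence => //.
  - by move=> n; exact: emeasurable_funM.
  - by move=> n w _; rewrite mule_ge0// lee_fin.
  - by move=> w _ m n mn; rewrite lee_wpmul2r// lee_fin ndh.
have Rg : (c * \int[nu]_y (h n y)%:E)%E @[n --> \oo] -->
    (c * \int[nu]_y g y)%E.
  apply: cvgeZl => //.
  rewrite [X in _ --> X](_ : _ = (\int[nu]_y (limn (fun n => (h n y)%:E)))%E); last first.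
    by apply: eq_integral => y _; apply/esym/cvg_lim => //; exact: hg.
  apply: cvg_monotone_convergence => //.
  - by move=> n; apply/measurable_EFinP.
  - by move=> n y _; rewrite lee_fin.
  - by move=> y _ m n mn; rewrite lee_fin ndh.
rewrite -(cvg_lim (@ereal_hausdorff R) L) -(cvg_lim (@ereal_hausdorff R) Rg).
by under eq_fun do rewrite XZ_nnsfun.
Qed.
End independent_factor.

Section product_expectation.
Context {R : realType} {N : nat} {disp : measure_display}.
Context {Omega : measurableType disp} (P : probability Omega R).
Variables (xi : nat -> {RV P >-> borelRV R N}) (nu : {measure set (borelRV R N) -> \bar R}).
Hypothesis indep : mutually_independent xi.
Hypothesis law : forall j B, measurable B -> P (xi j @^-1` B) = nu B.

(** Without indicators the induction on the number of factors g (xi j) would not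
    close: splitting off one factor requires the expectation of the others over
    the event that xi j lies in B, which is again a mixed product. When only
    indicators are left, this is the definition of mutual independence. *)
Lemma expectation_prod_mixed (g : borelRV R N -> R) (J1 J2 : seq nat)
    (A : nat -> set (borelRV R N)) :
  measurable_fun setT g -> (forall y, 0 <= g y) ->
  (\int[nu]_y (g y)%:E)%E \is a fin_num ->
  (forall j, measurable (A j)) -> uniq (J1 ++ J2) ->
  (\int[P]_w ((\prod_(j <- J1) g (xi j w)) *
     \prod_(j <- J2) \1_(A j) (xi j w))%:E =
   (\int[nu]_y (g y)%:E) ^+ size J1 * \prod_(j <- J2) nu (A j))%E.
Proof.
move=> mg g0 gfin; have mxi j : measurable_fun setT (xi j) by [].
have mgx j : measurable_fun setT (fun w => g (xi j w)) by exact: measurableT_comp.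
elim: J1 J2 A => [|j J1 IH] J2 A mA.
  rewrite cat0s [size _]/= expe0 mul1e => uJ2.
  under eq_integral do rewrite big_nil mul1r.
  rewrite (_ : (fun w => _) =
      (fun w => (\1_(\bigcap_(j in [set` J2]) (xi j @^-1` A j)) w)%:E)); last first.
    apply/funext => w; congr (_%:E); rewrite indicE.
    case: (boolP (w \in _)) => [|/negP nw].
      rewrite inE => wA; rewrite big_seq big1// => j jJ2.
      by rewrite indicE mem_set//; exact: wA.
    have [j jJ2 Aj] : exists2 j, j \in J2 & ~ A j (xi j w).
      apply: contrapT => nex; apply: nw; rewrite inE => j /= jJ2.
      by apply: contrapT => nA; apply: nex; exists j.
    apply/eqP; rewrite prodf_seq_eq0; apply/hasP; exists j => //=.
    by rewrite indicE memNset.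
  rewrite integral_indic ?setIT//; last first.
    apply: fin_bigcap_measurable; first exact: finite_seq.
    by move=> j _; rewrite -[X in measurable X]setTI; exact: mxi.
  rewrite [LHS](indep uJ2 mA); apply: eq_bigr => j _; exact: law.
rewrite cat_cons cons_uniq => /andP[jJ uJ].
pose Z w := ((\prod_(i <- J1) g (xi i w)) * \prod_(i <- J2) \1_(A i) (xi i w))%:E.
rewrite (_ : (fun w => _) = (fun w => (g (xi j w))%:E * Z w)%E); last first.
  by apply/funext => w; rewrite big_cons -mulrA EFinM.
have nuA i : nu (A i) \is a fin_num.
  rewrite -(law i)//; apply: fin_num_measure.
  by rewrite -[X in measurable X]setTI; exact: mxi.
pose c := ((\int[nu]_y (g y)%:E) ^+ size J1 * \prod_(j <- J2) nu (A j))%E.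
have XZ B : measurable B -> (\int[P]_(w in xi j @^-1` B) Z w = c * nu B)%E.
  move=> mB; pose A' i := if i == j then B else A i.
  have mA' i : measurable (A' i) by rewrite /A'; case: ifP.
  have A'E i : i \in J2 -> A' i = A i.
    move=> iJ2; rewrite /A'; case: eqP => // ij.
    by move: jJ; rewrite mem_cat -ij iJ2 orbT.
  have := IH (j :: J2) A' mA'; rewrite !big_cons.
  rewrite [X in uniq X](_ : _ = J1 ++ [:: j] ++ J2)//.
  rewrite uniq_catCA /= jJ uJ => /(_ isT) E.
  rewrite /c -muleA [X in (_ * X)%E]muleC; transitivity
    ((\int[nu]_y (g y)%:E) ^+ size J1 * (nu (A' j) * \big[*%E/1%E]_(j0 <- J2) nu (A' j0)))%E.
    rewrite -[RHS]E integral_mkcond; apply: eq_integral => w _.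
    rewrite patchE big_cons /A' eqxx indicE; case: ifPn => [wB|wB].
      rewrite mem_set//= ?mul1r; last by move: wB; rewrite inE.
      rewrite /Z; congr ((_ * _)%:E); apply: eq_big_seq => i iJ2.
      by rewrite -[if _ then _ else _]/(A' i) A'E.
    rewrite memNset//= ?mul0r ?mulr0//; move/negP: wB; apply: contra_not.
    by rewrite inE.
  rewrite /A' eqxx; congr (_ * (_ * _))%E; apply: eq_big_seq => i iJ2.
  by rewrite -[if _ then _ else _]/(A' i) A'E.
transitivity (c * \int[nu]_y (g y)%:E)%E; last first.
  by rewrite /c [size _]/= expeS muleAC (muleC (_ ^+ _)%E).
apply: integral_comp_factor => //.
- apply/measurable_EFinP; apply: measurable_funM.
    exact: measurable_prod.
  by apply: measurable_prod => i _; exact: measurableT_comp.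
- move=> w; rewrite lee_fin mulr_ge0// prodr_ge0// => i _; exact: indic_ge0.
- rewrite fin_numM//; first by rewrite fin_numX.
  by rewrite prode_fin_num.
- exact/measurable_EFinP.
Qed.

End product_expectation.

(** * Hoeffding's inequality *)

Lemma bounded_integrable (R : realType) d (T : measurableType d)
    (nu : {measure set T -> \bar R}) (D : set T) (h : T -> R) (B : R) :
  measurable D -> (nu D < +oo)%E -> measurable_fun D h ->
  (forall x, D x -> `|h x| <= B) -> nu.-integrable D (EFin \o h).
Proof.
move=> mD nuD mh hB; apply: measurable_bounded_integrable => //.
exists B; split; first exact: num_real.
by move=> M BM x Dx; apply: (le_trans (hB x Dx)); exact: ltW.
Qed.

(** Inverting 1 - x <= exp(-x) bounds the exponential by 1/(1 - x). *)
Lemma expR_le_quad (R : realType) (x : R) :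
  x <= 2^-1 -> expR x <= 1 + x + 2 * x ^+ 2.
Proof.
move=> x2; have x1 : 0 < 1 - x by lra.
have : expR x <= (1 - x)^-1.
  by rewrite -[expR x]invrK lef_pV2 ?posrE ?invr_gt0 ?expR_gt0// -expRN expR_ge1Dx.
move=> /le_trans; apply; rewrite -[leLHS]mul1r ler_pdivrMr//.
have : 0 <= x ^+ 2 * (1 - 2 * x) by rewrite mulr_ge0 ?sqr_ge0//; lra.
nra.
Qed.

Section chernoff.
Context {R : realType} {N : nat} {disp : measure_display}.
Context {Omega : measurableType disp} (P : probability Omega R).
Variables (xi : nat -> {RV P >-> borelRV R N}) (nu : probability (borelRV R N) R).
Hypothesis indep : mutually_independent xi.
Hypothesis law : forall j B, measurable B -> P (xi j @^-1` B) = nu B.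

Section one_function.
Variable phi : borelRV R N -> R.
Hypothesis mphi : measurable_fun setT phi.
Hypothesis phi1 : forall y, `|phi y| <= 1.
Let m := \int[nu]_y phi y.

Let nuT : (nu setT < +oo)%E.
Proof. by rewrite probability_setT ltry. Qed.

Let iphi : nu.-integrable setT (EFin \o phi).
Proof. exact: (@bounded_integrable _ _ _ _ _ _ 1). Qed.

Let Rint_le (f g : borelRV R N -> R) (B : R) : measurable_fun setT f ->
  measurable_fun setT g -> (forall y, `|f y| <= B) -> (forall y, `|g y| <= B) ->
  (forall y, f y <= g y) -> \int[nu]_y f y <= \int[nu]_y g y.
Proof.
by move=> mf mg fB gB fg; apply: le_Rintegral => //;
  apply: (@bounded_integrable _ _ _ _ _ _ B).
Qed.

Let m1 : `|m| <= 1.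
Proof.
have cst_int (r : R) : \int[nu]_y r = r.
  by rewrite Rintegral_cst//= probability_setT/= mulr1.
rewrite ler_norml; apply/andP; split.
  rewrite -[leLHS]cst_int; apply: (@Rint_le _ _ 1) => // y.
    by rewrite normrN normr1.
  by have := phi1 y; rewrite ler_norml => /andP[].
rewrite -[leRHS]cst_int; apply: (@Rint_le _ _ 1) => // y.
  by rewrite normr1.
by have := phi1 y; rewrite ler_norml => /andP[].
Qed.

(** In the quadratic bound on the exponential the linear term has mean 0. *)
Lemma mgf_le s : 0 <= s <= 4^-1 ->
  (\int[nu]_y (expR (s * (phi y - m)))%:E <= (1 + 8 * s ^+ 2)%:E)%E.
Proof.
move=> /andP[s0 s4].
have mq : measurable_fun setT (fun y => s * (phi y - m)).
  by apply: measurable_funM => //; exact: measurable_funB.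
have sb y : `|s * (phi y - m)| <= 2 * s.
  rewrite normrM (ger0_norm s0) mulrC ler_wpM2r//.
  by apply: le_trans (ler_normB _ _) _; have := phi1 y; have := m1; lra.
have iq : nu.-integrable setT (EFin \o (fun y => s * (phi y - m))).
  exact: (@bounded_integrable _ _ _ _ _ _ (2 * s)).
apply: (@le_trans _ _ (\int[nu]_y ((1 + 8 * s ^+ 2) + s * (phi y - m))%:E)%E).
  apply: ge0_le_integral => //.
  - by apply/measurable_EFinP; exact: measurableT_comp.
  - by apply/measurable_EFinP; exact: measurable_funD.
  - move=> y _; rewrite lee_fin; have := sb y; set x := s * _ => xs.
    have x2 : x <= 2^-1 by have := ler_norm x; lra.
    apply: le_trans (expR_le_quad x2) _.
    have : x ^+ 2 <= (2 * s) ^+ 2.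
      by rewrite -[leLHS]real_normK ?num_real// lerXn2r ?nnegrE//; lra.
    by rewrite exprMn; lra.
rewrite integralD_EFin//; last first.
  exact: (@bounded_integrable _ _ _ _ _ _ `|1 + 8 * s ^+ 2|).
rewrite integral_cst//= probability_setT mule1.
have -> : (\int[nu]_y (s * (phi y - m))%:E = 0)%E; last by rewrite adde0.
rewrite -[LHS]fineK ?integrable_fin_num//; congr (_%:E).
transitivity (\int[nu]_y (s * (phi y - m))) => //.
rewrite RintegralZl//; last first.
  apply: (@bounded_integrable _ _ _ _ _ _ 2) => //.
    exact: measurable_funB.
  by move=> y _; apply: le_trans (ler_normB _ _) _; have := phi1 y; have := m1; lra.
rewrite RintegralB//; last exact: (@bounded_integrable _ _ _ _ _ _ `|m|).
by rewrite Rintegral_cst//= probability_setT mulr1 subrr mulr0.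
Qed.

(** Chernoff's method: the exponential of s times the sum has mean at most
    exp(8 n s^2), and s = delta/16 minimizes 8 s^2 - s delta. *)
Lemma hoeffding_upper n (delta : R) : 0 <= delta <= 4 ->
  (P [set w | (n%:R * delta <= \sum_(j < n) (phi (xi j w) - m))%R]
     <= (expR (- (n%:R * (delta ^+ 2 / 32))))%R%:E)%E.
Proof.
move=> /andP[d0 d4]; pose s := delta / 16.
pose g y := expR (s * (phi y - m) - s * delta).
have mg : measurable_fun setT g.
  apply: measurableT_comp => //; apply: measurable_funB => //.
  by apply: measurable_funM => //; exact: measurable_funB.
have mxi j : measurable_fun setT (fun w => phi (xi j w)) by exact: measurableT_comp.
have mS : measurable_fun setT (fun w => \sum_(j < n) (phi (xi j w) - m)).
  by apply: measurable_sum => j; exact: measurable_funB.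
set A := [set w | _].
have mA : measurable A.
  rewrite /A -[X in measurable X]setTI.
  exact: measurable_fun_le.
have gE w : \prod_(j <- iota 0 n) g (xi j w) =
    expR (s * (\sum_(j < n) (phi (xi j w) - m) - n%:R * delta)).
  rewrite -[n in iota _ n]subn0 -/(index_iota 0 n) big_mkord /g.
  rewrite -expR_sum; congr expR.
  by rewrite sumrB -!mulr_sumr sumr_const card_ord -[delta *+ n]mulr_natl -mulrBr.
have gint : (\int[nu]_y (g y)%:E <= (expR (- (delta ^+ 2 / 32)))%:E)%E.
  rewrite (_ : (fun y => _) =
      (fun y => (expR (- (s * delta)))%:E * (expR (s * (phi y - m)))%:E)%E); last first.
    by apply/funext => y; rewrite -EFinM -expRD addrC.
  rewrite ge0_integralZl_EFin ?expR_ge0//; last first.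
    apply/measurable_EFinP/measurableT_comp => //.
    by apply: measurable_funM => //; exact: measurable_funB.
  apply: (@le_trans _ _ ((expR (- (s * delta)))%:E * (1 + 8 * s ^+ 2)%:E)%E).
    by rewrite lee_wpmul2l ?lee_fin ?expR_ge0// mgf_le// /s; lra.
  rewrite -EFinM lee_fin.
  apply: (@le_trans _ _ (expR (- (s * delta)) * expR (8 * s ^+ 2))).
    by rewrite ler_wpM2l ?expR_ge0// expR_ge1Dx.
  by rewrite -expRD ler_expR /s; lra.
have g0 y : 0 <= g y by exact: expR_ge0.
have gfin : (\int[nu]_y (g y)%:E)%E \is a fin_num.
  rewrite ge0_fin_numE; last by apply: integral_ge0 => y _; rewrite lee_fin.
  by rewrite (le_lt_trans gint)// ltry.
rewrite -(setIT A) -integral_indic//.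
apply: (@le_trans _ _ (\int[P]_w ((\prod_(j <- iota 0 n) g (xi j w)) *
     \prod_(j <- [::]) \1_(setT : set (borelRV R N)) (xi j w))%:E)%E).
  apply: ge0_le_integral => //.
  - by apply/measurable_EFinP; exact: measurable_indic.
  - apply/measurable_EFinP; under eq_fun do rewrite big_nil mulr1.
    by apply: measurable_prod => j _; exact: measurableT_comp.
  - move=> w _; rewrite lee_fin big_nil mulr1 gE indicE.
    case: (boolP (w \in A)) => [|_]; last exact: expR_ge0.
    rewrite inE /A /= => wA; rewrite -[leLHS]expR0 ler_expR mulr_ge0 ?subr_ge0//.
    by rewrite /s divr_ge0.
rewrite (expectation_prod_mixed indep law (A := fun=> setT))//; last first.
  by rewrite cats0 iota_uniq.
rewrite big_nil mule1 size_iota -[X in (X ^+ _)%E]fineK// -EFin_expe lee_fin.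
rewrite -mulrN expRM_natl lerXn2r ?nnegrE ?expR_ge0//.
  by rewrite fine_ge0// integral_ge0// => y _; rewrite lee_fin.
by rewrite -lee_fin fineK.
Qed.

End one_function.

End chernoff.

Definition bounded_measurable (R : realType) N (D : set 'rV[R]_N)
    (h : 'rV[R]_N -> R) :=
  measurable_fun (D : set (borelRV R N)) (h : borelRV R N -> R) /\
  exists B : R, forall x, D x -> `|h x| <= B.

Section mean_on.
Context {R : realType} {N : nat} (nu : {measure set (borelRV R N) -> \bar R}).
Variable D : set 'rV[R]_N.
Hypothesis mD : measurable (D : set (borelRV R N)).
Hypothesis nuD : nu D = 1%E.
Implicit Types (h g : 'rV[R]_N -> R) (c : R).

Local Notation good := (bounded_measurable D).
Let E h : R := \int[nu]_(y in (D : set (borelRV R N))) h y.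

Lemma bounded_measurable_integrable h : good h ->
  nu.-integrable (D : set (borelRV R N)) (EFin \o (h : borelRV R N -> R)).
Proof.
move=> [mh [B hB]]; apply: (@bounded_integrable _ _ _ _ _ _ B) => //.
by rewrite nuD ltry.
Qed.

Lemma bounded_measurable_cst c : good (fun=> c).
Proof. by split=> //; exists `|c|. Qed.

Lemma bounded_measurableD h g : good h -> good g -> good (fun y => h y + g y).
Proof.
move=> [mh [B hB]] [mg [C gC]]; split; first exact: measurable_funD.
exists (B + C) => x Dx; apply: le_trans (ler_normD _ _) _.
by rewrite lerD ?hB ?gC.
Qed.

Lemma bounded_measurableM h g : good h -> good g -> good (fun y => h y * g y).
Proof.
move=> [mh [B hB]] [mg [C gC]]; split; first exact: measurable_funM.
exists (B * C) => x Dx; rewrite normrM.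
by apply: ler_pM => //; [exact: hB|exact: gC].
Qed.

Lemma bounded_measurableZ c h : good h -> good (fun y => c * h y).
Proof. by move=> gh; apply: (bounded_measurableM (bounded_measurable_cst c) gh). Qed.

Lemma bounded_measurableB h g : good h -> good g -> good (fun y => h y - g y).
Proof.
move=> gh gg; apply: bounded_measurableD => //.
by rewrite (_ : (fun y => - g y) = (fun y => -1 * g y));
  [exact: bounded_measurableZ|apply/funext => y; rewrite mulN1r].
Qed.

Lemma mean_cst c : E (fun=> c) = c.
Proof. by rewrite /E Rintegral_cst//= nuD mulr1. Qed.

Lemma meanD h g : good h -> good g -> E (fun y => h y + g y) = E h + E g.
Proof. by move=> gh gg; apply: RintegralD => //; exact: bounded_measurable_integrable. Qed.

Lemma meanZ c h : good h -> E (fun y => c * h y) = c * E h.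
Proof. by move=> gh; apply: RintegralZl => //; exact: bounded_measurable_integrable. Qed.

Lemma mean_le h g : good h -> good g -> (forall y, D y -> h y <= g y) -> E h <= E g.
Proof.
by move=> gh gg hg; apply: le_Rintegral => //; exact: bounded_measurable_integrable.
Qed.

Lemma mean_dist_le h g c : good h -> good g ->
  (forall y, D y -> `|h y - g y| <= c) -> `|E h - E g| <= c.
Proof.
move=> gh gg hgc; have le h1 g1 : good h1 -> good g1 ->
    (forall y, D y -> `|h1 y - g1 y| <= c) -> E h1 <= E g1 + c.
  move=> gh1 gg1 hg1; rewrite -(mean_cst c) -meanD//; last exact: bounded_measurable_cst.
  apply: mean_le => //.
    by apply: bounded_measurableD => //; exact: bounded_measurable_cst.
  by move=> y /hg1; rewrite ler_norml => /andP[_]; rewrite lerBlDl.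
rewrite ler_norml; apply/andP; split.
  by rewrite lerBrDr addrC lerBlDr le// => y Dy; rewrite distrC hgc.
by rewrite lerBlDl le.
Qed.

End mean_on.

Definition empirical_mean (R : realType) N n (x : nat -> 'rV[R]_N)
  (h : 'rV[R]_N -> R) : R := n%:R^-1 * \sum_(j < n) h (x j).

Section empirical_deviation.
Context {R : realType} {N : nat} {disp : measure_display}.
Context {Omega : measurableType disp} (P : probability Omega R).
Variables (xi : nat -> {RV P >-> borelRV R N}) (nu : probability (borelRV R N) R).
Hypothesis indep : mutually_independent xi.
Hypothesis law : forall j B, measurable B -> P (xi j @^-1` B) = nu B.
Variable D : set 'rV[R]_N.
Hypothesis mD : measurable (D : set (borelRV R N)).
Hypothesis xiD : forall j w, D (xi j w).

Let xi_ w j : 'rV[R]_N := xi j w.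
Let E h : R := \int[nu]_(y in (D : set (borelRV R N))) h y.

Lemma sample_law_support : nu D = 1%E.
Proof.
rewrite -(law 0)// (_ : xi 0%N @^-1` D = setT) ?probability_setT//.
by apply/seteqP; split => // w _; exact: xiD.
Qed.

Lemma empirical_mean_measurable n h :
  measurable_fun (D : set (borelRV R N)) (h : borelRV R N -> R) ->
  measurable_fun setT (fun w => empirical_mean n (xi_ w) h).
Proof.
move=> mh; apply: measurable_funM => //; apply: measurable_sum => j.
have -> : (fun w => h (xi_ w j)) = (h \_ D) \o xi j.
  by apply/funext => w; rewrite /= patchE mem_set.
by apply: measurableT_comp => //; exact/(measurable_restrictT _ _).1.
Qed.

(** The function is extended by 0 off D, which changes no mean since the sample
    stays in D; the one-sided bound is then used for it and its opposite. *)
Lemma hoeffding n (h : 'rV[R]_N -> R) (delta : R) : (0 < n)%N ->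
  0 <= delta <= 4 ->
  measurable_fun (D : set (borelRV R N)) (h : borelRV R N -> R) ->
  (forall y, D y -> `|h y| <= 1) ->
  (P [set w | (delta <= `|empirical_mean n (xi_ w) h - E h|)%R] <=
   (2 * expR (- (n%:R * (delta ^+ 2 / 32))))%R%:E)%E.
Proof.
move=> n0 d4 mh h1; have nR0 : 0 < n%:R :> R by rewrite ltr0n.
pose phi : borelRV R N -> R := h \_ D.
have mphi : measurable_fun setT phi by exact/(measurable_restrictT _ _).1.
have phi1 y : `|phi y| <= 1.
  by rewrite /phi patchE; case: ifPn => [|_]; rewrite ?normr0// inE; exact: h1.
have Ephi : \int[nu]_y phi y = E h by rewrite /E [RHS]Rintegral_mkcond.
have phixi j w : phi (xi j w) = h (xi_ w j) by rewrite /phi patchE mem_set.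
have mNphi : measurable_fun setT (fun y => - phi y) by exact: measurableT_comp.
have Nphi1 y : `|- phi y| <= 1 by rewrite normrN.
have nuT : (nu setT < +oo)%E by rewrite probability_setT ltry.
have ENphi : \int[nu]_y (- phi y) = - E h.
  rewrite -Ephi -mulN1r -RintegralZl//; first by apply: eq_Rintegral => y _; rewrite mulN1r.
  exact: (@bounded_integrable _ _ _ _ _ _ 1).
have U := hoeffding_upper indep law mphi phi1 n d4.
have L := hoeffding_upper indep law mNphi Nphi1 n d4.
rewrite Ephi in U; rewrite ENphi in L.
set A := [set w | _] in U; set B := [set w | _] in L.
have mx j : measurable_fun setT (fun w => phi (xi j w)) by exact: measurableT_comp.
have mA : measurable A.
  rewrite /A -[X in measurable X]setTI; apply: measurable_fun_le => //.
  by apply: measurable_sum => j; exact: measurable_funB.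
have mB : measurable B.
  rewrite /B -[X in measurable X]setTI; apply: measurable_fun_le => //.
  apply: measurable_sum => j; apply: measurable_funB => //.
  exact: measurableT_comp.
apply: (@le_trans _ _ (P (A `|` B))).
  apply: le_measure; rewrite ?inE.
  - rewrite -[X in measurable X]setTI; apply: measurable_fun_le => //.
    apply: measurableT_comp => //; apply: measurable_funB => //.
    exact: empirical_mean_measurable.
  - exact: measurableU.
  - move=> w /=; rewrite /A /B /= => dw.
    have SE : \sum_(j < n) (phi (xi j w) - E h) =
        n%:R * (empirical_mean n (xi_ w) h - E h).
      rewrite sumrB sumr_const card_ord mulrBr /empirical_mean mulVKf ?gt_eqF//.
      rewrite [n%:R * E h]mulr_natl.
      by congr (_ - _); apply: eq_bigr => j _.
    have SN : \sum_(j < n) (- phi (xi j w) - - E h) =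
        - \sum_(j < n) (phi (xi j w) - E h).
      by rewrite -sumrN; apply: eq_bigr => j _; rewrite opprB opprK addrC.
    rewrite SN SE -mulrN !ler_pM2l//.
    by move: dw; rewrite ler_normr => /orP[]; [left|right].
apply: (le_trans (measureU2 _ _ _)) => //.
by rewrite mulr_natl mulr2n EFinD leeD.
Qed.

End empirical_deviation.

(** * Uniform law of large numbers *)

(** The cube of radius A is cut into cells of side 2A/m, and a point of D is
    chosen in each cell that meets D. *)
Lemma grid_net (R : realType) N (D : set 'rV[R]_N) (A : R) (m : nat) :
  0 < A -> (forall x, D x -> `|x| <= A) -> (0 < m)%N -> D !=set0 ->
  exists p : nat -> 'rV[R]_N, (forall i, D (p i)) /\
    forall x, D x -> exists2 i, (i < m.+1 ^ N)%N & `|x - p i| <= 2 * A / m%:R.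
Proof.
move=> A0 DA m0 [x0 Dx0]; pose h : R := 2 * A / m%:R.
have mR0 : 0 < m%:R :> R by rewrite ltr0n.
have h0 : 0 < h by rewrite divr_gt0// mulr_gt0.
pose u (x : 'rV[R]_N) i : R := (x 0 i + A) / h.
have u0 x i : D x -> 0 <= u x i <= m%:R.
  move=> Dx; have := le_trans (coord_le_norm x i) (DA x Dx).
  rewrite ler_norml => /andP[xA1 xA2]; rewrite /u; apply/andP; split.
    by rewrite divr_ge0 ?(ltW h0)//; lra.
  rewrite ler_pdivrMr// /h mulrCA divff ?gt_eqF// mulr1; lra.
(* u x i can be equal to m, hence m.+1 values in each direction *)
pose cell x : {ffun 'I_N -> 'I_m.+1} := [ffun i => inord (Num.truncn (u x i))].
have cellE x i : D x -> (cell x i : nat) = Num.truncn (u x i).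
  move=> /(u0 x i)/andP[ux0 uxm]; rewrite ffunE inordK// ltnS.
  rewrite -(ler_nat R); apply: le_trans uxm.
  by have /andP[] := truncn_itv ux0.
have near_cell x y : D x -> D y -> cell x = cell y -> `|x - y| <= h.
  move=> Dx Dy xy; apply: norm_le_coord; first exact: ltW.
  move=> i; rewrite !mxE.
  have Exy : Num.truncn (u x i) = Num.truncn (u y i) by rewrite -!cellE// xy.
  have /andP[/truncn_itv + _] := u0 x i Dx.
  have /andP[/truncn_itv + _] := u0 y i Dy.
  rewrite Exy -natr1 => /andP[y1 y2] /andP[x1 x2].
  have uxy : `|u x i - u y i| <= 1 by rewrite ler_norml; lra.
  rewrite (_ : x 0 i - y 0 i = (u x i - u y i) * h).
    by rewrite normrM (gtr0_norm h0) ler_piMl// ltW.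
  by rewrite /u -mulrBl divfK ?gt_eqF//; lra.
pose center c := if pselect (exists x, D x /\ cell x = c) is left ex
  then projT1 (cid ex) else x0.
have Dcenter c : D (center c).
  by rewrite /center; case: pselect => // ex; case: cid => x [].
exists (fun i => center (nth (cell x0) (enum {ffun 'I_N -> 'I_m.+1}) i)); split=> //.
move=> x Dx; exists (index (cell x) (enum {ffun 'I_N -> 'I_m.+1})).
  have <- : #|{ffun 'I_N -> 'I_m.+1}| = (m.+1 ^ N)%N.
    by rewrite card_ffun !card_ord.
  by rewrite cardE index_mem mem_enum.
rewrite nth_index ?mem_enum//; apply: near_cell => //.
rewrite /center; case: pselect => [ex|nex]; last by exfalso; apply: nex; exists x.
by case: cid => y [].
Qed.

(** A single term of the exponential series, of order K with K eps >= q + 2, is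
    enough. *)
Lemma poly_expR_le (R : realType) (q : nat) (eps : R) : 0 < eps ->
  exists2 C : R, 0 <= C & forall n, (0 < n)%N ->
    n%:R ^+ q * expR (- (n%:R `^ eps / 32)) <= C / n%:R ^+ 2.
Proof.
move=> e0; pose K := (Num.truncn ((q.+2)%:R / eps)).+1.
have Kq : (q.+2)%:R <= eps * K%:R.
  by rewrite mulrC -ler_pdivrMr// ltW// truncnS_gt.
exists (32 ^+ K * K`!%:R); first by rewrite mulr_ge0 ?exprn_ge0.
move=> n n0; have nR1 : 1 <= n%:R :> R by rewrite ler1n.
have nR0 : 0 < n%:R :> R by rewrite ltr0n.
set y := n%:R `^ eps / 32; have y0 : 0 <= y by rewrite divr_ge0// powR_ge0.
rewrite ler_pdivlMr ?exprn_gt0// mulrAC -exprD addn2 expRN ler_pdivrMr ?expR_gt0//.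
have -> : n%:R ^+ q.+2 = n%:R `^ (q.+2)%:R :> R by rewrite powR_mulrn// ltW.
apply: (@le_trans _ _ (n%:R `^ (eps * K%:R))); first exact: ler_powR.
rewrite powRrM powR_mulrn ?powR_ge0//.
have -> : n%:R `^ eps = 32 * y by rewrite /y mulrC divfK.
rewrite exprMn -mulrA ler_wpM2l ?exprn_ge0// mulrC -ler_pdivrMr ?ltr0n ?fact_gt0//.
by apply: le_trans (expR_ge1Dxn K.-1 y0); rewrite lerDr.
Qed.

(** The sums telescope after bounding 1/(k+1)^2 by 1/k - 1/(k+1). *)
Lemma sum_inv_sqr_le (R : realType) n :
  \sum_(0 <= i < n) (i.+1%:R ^+ 2)^-1 <= 2 :> R.
Proof.
suff : \sum_(0 <= i < n.+1) (i.+1%:R ^+ 2)^-1 <= 2 - n.+1%:R^-1 :> R.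
  rewrite big_nat_recr//= => le2; apply: le_trans (le_trans le2 _).
    by rewrite lerDl invr_ge0 exprn_ge0.
  by rewrite lerBlDr lerDl invr_ge0.
elim: n => [|n IH]; first by rewrite big_nat1 expr1n invr1; lra.
rewrite big_nat_recr//=; apply: le_trans (lerD IH (lexx _)) _.
set a : R := n.+1%:R; have a0 : 0 < a by rewrite ltr0n.
have -> : n.+2%:R = a + 1 :> R by rewrite natr1.
have a10 : 0 < a + 1 by lra.
have : 0 <= (a * (a + 1) ^+ 2)^-1.
  by rewrite invr_ge0 mulr_ge0 ?exprn_ge0// ltW.
have <- : a^-1 - (a + 1)^-1 - ((a + 1) ^+ 2)^-1 = (a * (a + 1) ^+ 2)^-1.
  by field; rewrite !gt_eqF.
move: a^-1 (a + 1)^-1 ((a + 1) ^+ 2)^-1 => b c e; lra.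
Qed.

(** The lemma of Borel and Cantelli for probabilities O(n^-2). *)
Lemma ae_eventually_not (R : realType) d (T : measurableType d)
    (P : probability T R) (F : nat -> set T) (C : R) :
  (forall n, measurable (F n)) -> 0 <= C ->
  (forall n, (0 < n)%N -> (P (F n) <= (C / n%:R ^+ 2)%:E)%E) ->
  {ae P, forall w, \forall n \near \oo, ~ F n w}.
Proof.
move=> mF C0 PF; exists (lim_sup_set F); split.
- apply: bigcap_measurable => // k _; exact: bigcup_measurable.
- apply: lim_sup_set_cvg0 => //.
  apply: (@le_lt_trans _ _ (1 + C * 2)%:E); last exact: ltry.
  apply: lime_le; first exact: is_cvg_nneseries.
  apply: nearW => n; apply: (@le_trans _ _ (\sum_(0 <= i < n.+1) P (F i))%E).
    by rewrite big_nat_recr//= leeDl.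
  rewrite big_nat_recl// EFinD; apply: leeD; first exact: probability_le1.
  apply: (@le_trans _ _ (\sum_(0 <= i < n) (C / i.+1%:R ^+ 2)%:E)%E).
    by apply: lee_sum => i _; exact: PF.
  by rewrite sumEFin lee_fin -mulr_sumr ler_wpM2l// sum_inv_sqr_le.
- move=> w /= nF; rewrite /lim_sup_set => n _; apply: contrapT => nFw; apply: nF.
  exists n => // k /= nk Fk; apply: nFw; exists k => //.
Qed.

Lemma near_powR_ge (R : realType) (e c : R) : 0 < e ->
  \forall n \near \oo, c <= n%:R `^ e.
Proof.
move=> e0; near=> n; apply: (@le_trans _ _ (Num.max c 1)).
  by rewrite le_max lexx.
set b := Num.max c 1; have b0 : 0 <= b by rewrite le_max ler01 orbT.
have -> : b = (b `^ e^-1) `^ e by rewrite -powRrM mulVf ?gt_eqF// powRr1.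
rewrite ge0_ler_powR ?nnegrE ?powR_ge0//; first exact: ltW.
by near: n; exact: nbhs_infty_ger.
Unshelve. all: by end_near. Qed.

Lemma empirical_mean_dist_le (R : realType) N n (x : nat -> 'rV[R]_N)
    (h g : 'rV[R]_N -> R) (c : R) : (0 < n)%N ->
  (forall j, `|h (x j) - g (x j)| <= c) ->
  `|empirical_mean n x h - empirical_mean n x g| <= c.
Proof.
move=> n0 hg; have nR0 : 0 < n%:R :> R by rewrite ltr0n.
rewrite /empirical_mean -mulrBr -sumrB normrM normfV (gtr0_norm nR0).
rewrite mulrC ler_pdivrMr//; apply: le_trans (ler_norm_sum _ _ _) _.
apply: (@le_trans _ _ (\sum_(j < n) c)); first exact: ler_sum.
by rewrite sumr_const card_ord mulr_natr.
Qed.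

Section uniform_lln.
Context {R : realType} {N : nat} {disp : measure_display}.
Context {Omega : measurableType disp} (P : probability Omega R).
Variables (xi : nat -> {RV P >-> borelRV R N}) (nu : probability (borelRV R N) R).
Hypothesis indep : mutually_independent xi.
Hypothesis law : forall j B, measurable B -> P (xi j @^-1` B) = nu B.
Variable D : set 'rV[R]_N.
Hypothesis mD : measurable (D : set (borelRV R N)).
Hypothesis xiD : forall j w, D (xi j w).
Variable A : R.
Hypothesis A0 : 0 < A.
Hypothesis DA : forall x, D x -> `|x| <= A.
Hypothesis D0 : D !=set0.

Let xi_ w j : 'rV[R]_N := xi j w.
Let E h : R := \int[nu]_(y in (D : set (borelRV R N))) h y.

(** At one point the deviation reaches n^(eps - 1/2) with probability at most
    2 exp(-n^(2 eps)/32), which outweighs the polynomial number of points in a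
    grid of mesh O(n^-(p+1)). Between these points both means vary by at most
    C n^p times the mesh. *)
Lemma uniform_lln (psi : nat -> 'rV[R]_N -> 'rV[R]_N -> R) (p : nat) (C eps : R) :
  0 < eps -> eps <= 2^-1 -> 0 <= C ->
  (forall n x, (0 < n)%N -> D x ->
    measurable_fun (D : set (borelRV R N)) (psi n x : borelRV R N -> R)) ->
  (forall n x y, (0 < n)%N -> D x -> D y -> `|psi n x y| <= 1) ->
  (forall n x x' y, (0 < n)%N -> D x -> D x' -> D y ->
    `|psi n x y - psi n x' y| <= C * n%:R ^+ p * `|x - x'|) ->
  {ae P, forall w, \forall n \near \oo, forall x, D x ->
    `|empirical_mean n (xi_ w) (psi n x) - E (psi n x)| <= 3 * n%:R `^ (eps - 2^-1)}.
Proof.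
move=> e0 e2 C0 mpsi psi1 psiL.
pose delta n : R := n%:R `^ (eps - 2^-1).
have delta0 n : 0 <= delta n by exact: powR_ge0.
have delta4 n : (0 < n)%N -> 0 <= delta n <= 4.
  move=> n0; rewrite delta0/=; apply: (@le_trans _ _ (n%:R `^ 0)).
    by apply: ler_powR; rewrite ?ler1n//; lra.
  by rewrite powRr0; lra.
pose m n := (n ^ p.+1)%N.
have [q qP] : exists q : nat -> nat -> 'rV[R]_N, forall n, (forall i, D (q n i)) /\
    ((0 < n)%N -> forall x, D x -> exists2 i, (i < (m n).+1 ^ N)%N &
      `|x - q n i| <= 2 * A / (m n)%:R).
  suff H n : exists qn : nat -> 'rV[R]_N, (forall i, D (qn i)) /\
      ((0 < n)%N -> forall x, D x -> exists2 i, (i < (m n).+1 ^ N)%N &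
        `|x - qn i| <= 2 * A / (m n)%:R).
    by have [q qP] := choice H; exists q.
  case: n => [|n].
    by have [x0 Dx0] := D0; exists (fun=> x0).
  have mn0 : (0 < m n.+1)%N by rewrite expn_gt0.
  by have [qn [Dqn qnP]] := grid_net A0 DA mn0 D0; exists qn.
have Dq n i : D (q n i) by exact: (qP n).1.
pose G n i := [set w | delta n <= `|empirical_mean n (xi_ w) (psi n (q n i)) -
                                   E (psi n (q n i))|].
pose F n := if n is 0 then set0 else \big[setU/set0]_(i < (m n).+1 ^ N) G n i.
have mG n i : (0 < n)%N -> measurable (G n i).
  move=> n0; rewrite /G -[X in measurable X]setTI; apply: measurable_fun_le => //.
  apply: measurableT_comp => //; apply: measurable_funB => //.
  by apply: (empirical_mean_measurable mD xiD); exact: mpsi.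
have mF n : measurable (F n).
  by case: n => [|n]; rewrite /F//; apply: bigsetU_measurable => i _; exact: mG.
have FE n : (0 < n)%N -> F n = \big[setU/set0]_(i < (m n).+1 ^ N) G n i.
  by case: n.
have [C1 C10 C1P] : exists2 C1 : R, 0 <= C1 & forall n, (0 < n)%N ->
    n%:R ^+ (p.+1 * N) * expR (- (n%:R `^ (2 * eps) / 32)) <= C1 / n%:R ^+ 2.
  by apply: poly_expR_le; lra.
have PF n : (0 < n)%N -> (P (F n) <= (2 ^+ N.+1 * C1 / n%:R ^+ 2)%:E)%E.
  move=> n0; have nR1 : 1 <= n%:R :> R by rewrite ler1n.
  rewrite FE//.
  apply: (@le_trans _ _ (\sum_(i < (m n).+1 ^ N)
      (2 * expR (- (n%:R * (delta n ^+ 2 / 32))))%:E)%E).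
    apply: le_trans (Boole_inequality _ _) _ => [i _|]; first exact: mG.
    apply: lee_sum => i _; apply: hoeffding => //; [exact: delta4|exact: mpsi|].
    by move=> y Dy; exact: psi1.
  rewrite sumEFin lee_fin sumr_const card_ord -[leLHS]mulr_natl.
  have -> : n%:R * (delta n ^+ 2 / 32) = n%:R `^ (2 * eps) / 32.
    rewrite mulrA; congr (_ / _).
    rewrite /delta -powR_mulrn ?powR_ge0// -powRrM -{1}(@powRr1 _ n%:R)//.
    rewrite -powRD; last by rewrite pnatr_eq0 -lt0n n0 implybT.
    by congr (_ `^ _); lra.
  apply: (@le_trans _ _ (2 ^+ N.+1 *
      (n%:R ^+ (p.+1 * N) * expR (- (n%:R `^ (2 * eps) / 32))))); last first.
    by rewrite -mulrA ler_wpM2l// C1P.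
  rewrite !mulrA ler_wpM2r ?expR_ge0//.
  rewrite mulrC exprS -mulrA ler_wpM2l//.
  rewrite natrX exprM -exprMn lerXn2r ?nnegrE ?mulr_ge0 ?exprn_ge0//.
  rewrite -natr1 natrX mulr_natl mulr2n lerD2l; exact: exprn_ege1.
have := ae_eventually_not mF _ PF; rewrite mulr_ge0// => /(_ isT).
apply: filterS => w nF; near=> n => x Dx.
have n0 : (0 < n)%N by near: n; exists 1%N.
have nR0 : 0 < n%:R :> R by rewrite ltr0n.
have [i iK xi_q] := (qP n).2 n0 x Dx.
set qi := q n i in xi_q; have Dqi : D qi by exact: Dq.
have step : C * n%:R ^+ p * `|x - qi| <= delta n.
  apply: (@le_trans _ _ (C * n%:R ^+ p * (2 * A / (m n)%:R))).
    by rewrite ler_wpM2l// mulr_ge0// exprn_ge0.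
  rewrite /m natrX exprS.
  have -> : C * n%:R ^+ p * (2 * A / (n%:R * n%:R ^+ p)) = 2 * A * C / n%:R.
    by field; rewrite expf_neq0 ?gt_eqF.
  rewrite ler_pdivrMr// mulrC -{1}(@powRr1 _ n%:R)// /delta.
  rewrite -powRD; last by rewrite pnatr_eq0 -lt0n n0 implybT.
  by near: n; apply: near_powR_ge; lra.
have nG : `|empirical_mean n (xi_ w) (psi n qi) - E (psi n qi)| <= delta n.
  apply/ltW; rewrite ltNge; apply/negP => dG.
  have : ~ F n w by near: n.
  by rewrite FE// -bigcup_mkord; apply; exists i.
have nuD := sample_law_support law mD xiD.
have gpsi x' : D x' -> bounded_measurable D (psi n x').
  by move=> Dx'; split; [exact: mpsi|exists 1 => y Dy; exact: psi1].
have EE : `|E (psi n x) - E (psi n qi)| <= delta n.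
  apply: (mean_dist_le mD nuD); [exact: gpsi|exact: gpsi|].
  by move=> y Dy; apply: le_trans step; exact: psiL.
have MM : `|empirical_mean n (xi_ w) (psi n x) -
            empirical_mean n (xi_ w) (psi n qi)| <= delta n.
  apply: empirical_mean_dist_le => // j; apply: le_trans step.
  by apply: psiL => //; exact: xiD.
rewrite -/(delta n); move: nG EE MM.
move: (empirical_mean _ _ _) (empirical_mean _ _ _) (E _) (E _) => a b c d.
rewrite !ler_norml => /andP[? ?] /andP[? ?] /andP[? ?]; lra.
Unshelve. all: by end_near. Qed.

End uniform_lln.

(** * Comparison of the iterated Gamma operators of two means *)

(** The domain on which a mean is linear: the bounded measurable functions for an
    integral, all functions for an empirical mean. *)
Record function_algebra (R : realType) N (G : ('rV[R]_N -> R) -> Prop) := {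
  algebra_cst : forall c, G (fun=> c);
  algebraD : forall f g, G f -> G g -> G (fun y => f y + g y);
  algebraM : forall f g, G f -> G g -> G (fun y => f y * g y) }.

(** D carries the mean: monotonicity for the order on D makes the values off D
    irrelevant. *)
Record mean_functional (R : realType) N (D : set 'rV[R]_N)
    (G : ('rV[R]_N -> R) -> Prop) (E : ('rV[R]_N -> R) -> R) := {
  mean_functional_cst : forall c, E (fun=> c) = c;
  mean_functional_lin : forall c f g, G f -> G g ->
    E (fun y => f y + c * g y) = E f + c * E g;
  mean_functional_le : forall f g, G f -> G g ->
    (forall y, D y -> f y <= g y) -> E f <= E g }.

Definition weighted_mean (R : realType) N (k : 'rV[R]_N -> 'rV[R]_N -> R)
    (E : ('rV[R]_N -> R) -> R) (f : 'rV[R]_N -> R) x : R :=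
  E (fun y => f y * k x y) / E (k x).

Definition mean_laplacian (R : realType) N (k : 'rV[R]_N -> 'rV[R]_N -> R)
    (t : R) (E : ('rV[R]_N -> R) -> R) (f : 'rV[R]_N -> R) x : R :=
  2 / t * weighted_mean k E (fun y => f y - f x) x.

Lemma GammaC (R : realType) N (L : ('rV[R]_N -> R) -> 'rV[R]_N -> R) u v :
  Gamma L u v = Gamma L v u.
Proof.
apply/funext => y; rewrite /Gamma (_ : u \* v = v \* u).
  by congr (_ * _); ring.
by apply/funext => z /=; rewrite mulrC.
Qed.

Section mean_functional_theory.
Context {R : realType} {N : nat} (D : set 'rV[R]_N).
Context (k : 'rV[R]_N -> 'rV[R]_N -> R) (t : R).
Context (G : ('rV[R]_N -> R) -> Prop) (E : ('rV[R]_N -> R) -> R).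
Hypotheses (algG : function_algebra G) (mE : mean_functional D G E).
Hypothesis Gk : forall x, G (k x).
Hypothesis k0 : forall x y, 0 <= k x y.
Implicit Types (f g u v : 'rV[R]_N -> R).

Lemma algebraZ c f : G f -> G (fun y => c * f y).
Proof. by move=> Gf; apply: (algebraM algG (algebra_cst algG c)). Qed.

Lemma algebraB f g : G f -> G g -> G (fun y => f y - g y).
Proof.
move=> Gf Gg; rewrite (_ : (fun y => _) = (fun y => f y + -1 * g y)).
  by apply: (algebraD algG) => //; exact: algebraZ.
by apply/funext => y; rewrite mulN1r.
Qed.

Lemma algebra_centered f x : G f -> G (fun y => f y - f x).
Proof. by move=> Gf; apply: algebraB => //; exact: (algebra_cst algG). Qed.

Lemma mean_functional0 : E (fun=> 0) = 0.
Proof. exact: mean_functional_cst mE 0. Qed.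

Lemma mean_functionalD f g : G f -> G g -> E (fun y => f y + g y) = E f + E g.
Proof.
move=> Gf Gg; rewrite -[in RHS](mul1r (E g)) -(mean_functional_lin mE)//.
by congr E; apply/funext => y; rewrite mul1r.
Qed.

Lemma mean_functionalZ c f : G f -> E (fun y => c * f y) = c * E f.
Proof.
move=> Gf; rewrite -[RHS]add0r -mean_functional0 -(mean_functional_lin mE)//.
  by congr E; apply/funext => y; rewrite add0r.
exact: algebra_cst algG 0.
Qed.

Lemma mean_functionalB f g : G f -> G g -> E (fun y => f y - g y) = E f - E g.
Proof.
move=> Gf Gg; rewrite -mulN1r -(mean_functional_lin mE)//.
by congr E; apply/funext => y; rewrite mulN1r.
Qed.

Lemma mean_functional_norm_le f B : G f -> (forall y, D y -> `|f y| <= B) -> `|E f| <= B.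
Proof.
move=> Gf fB; rewrite ler_norml; apply/andP; split.
  rewrite -[leLHS](mean_functional_cst mE); apply: (mean_functional_le mE) => //.
    exact: (algebra_cst algG).
  by move=> y /fB; rewrite ler_norml => /andP[].
rewrite -[leRHS](mean_functional_cst mE); apply: (mean_functional_le mE) => //.
  exact: (algebra_cst algG).
by move=> y /fB; rewrite ler_norml => /andP[].
Qed.

Lemma algebraMk f x : G f -> G (fun y => f y * k x y).
Proof. by move=> Gf; apply: (algebraM algG). Qed.

Lemma weighted_mean_norm_le f x B : G f -> 0 < E (k x) ->
  (forall y, D y -> `|f y| <= B) -> `|weighted_mean k E f x| <= B.
Proof.
move=> Gf Ek0 fB; rewrite /weighted_mean normrM normfV (gtr0_norm Ek0).
rewrite ler_pdivrMr// -mean_functionalZ//.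
have fBk y : D y -> `|f y * k x y| <= B * k x y.
  by move=> Dy; rewrite normrM (ger0_norm (k0 x y)) ler_wpM2r// fB.
have GB : G (fun y => B * k x y) by exact: algebraZ.
have Gfk := algebraMk x Gf.
have up : E (fun y => f y * k x y) <= E (fun y => B * k x y).
  by apply: (mean_functional_le mE) => // y /fBk; rewrite ler_norml => /andP[].
have lo : E (fun y => -1 * (B * k x y)) <= E (fun y => f y * k x y).
  apply: (mean_functional_le mE) => //; first exact: algebraZ.
  by move=> y /fBk; rewrite mulN1r ler_norml => /andP[].
rewrite mean_functionalZ// mulN1r in lo.
by rewrite ler_norml lo up.
Qed.

Lemma weighted_meanD f g x : G f -> G g ->
  weighted_mean k E (fun y => f y + g y) x =
  weighted_mean k E f x + weighted_mean k E g x.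
Proof.
move=> Gf Gg; rewrite /weighted_mean -mulrDl -mean_functionalD; do ?exact: algebraMk.
by congr (E _ / _); apply/funext => y; rewrite mulrDl.
Qed.

Lemma weighted_meanZ c f x : G f ->
  weighted_mean k E (fun y => c * f y) x = c * weighted_mean k E f x.
Proof.
move=> Gf; rewrite /weighted_mean mulrA -mean_functionalZ; last exact: algebraMk.
by congr (E _ / _); apply/funext => y; rewrite mulrA.
Qed.

(** The defect of the Leibniz rule only sees the increments of both functions. *)
Lemma Gamma_mean_laplacianE u v : G u -> G v ->
  Gamma (mean_laplacian k t E) u v =
  fun x => t^-1 * weighted_mean k E (fun y => (u y - u x) * (v y - v x)) x.
Proof.
move=> Gu Gv; apply/funext => x; rewrite /Gamma /mean_laplacian.
rewrite (_ : weighted_mean k E (fun y => (u \* v) y - (u \* v) x) x =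
    weighted_mean k E (fun y => (u y - u x) * (v y - v x)) x +
    v x * weighted_mean k E (fun y => u y - u x) x +
    u x * weighted_mean k E (fun y => v y - v x) x); last first.
  have Gux := algebra_centered x Gu; have Gvx := algebra_centered x Gv.
  have Guv := algebraM algG Gux Gvx.
  rewrite -!weighted_meanZ// -!weighted_meanD//; do ?exact: algebraZ.
    by congr weighted_mean; apply/funext => y /=; ring.
  by apply: (algebraD algG) => //; exact: algebraZ.
by move: (t^-1) => s; field.
Qed.

End mean_functional_theory.

Lemma function_algebra_all (R : realType) N :
  function_algebra (fun _ : 'rV[R]_N -> R => True).
Proof. by []. Qed.

Section laplacian_comparison.
Context {R : realType} {N : nat} (D : set 'rV[R]_N).
Context (k : 'rV[R]_N -> 'rV[R]_N -> R) (tau kappa : R).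
Context (G : ('rV[R]_N -> R) -> Prop) (E F : ('rV[R]_N -> R) -> R).
Hypotheses (algG : function_algebra G) (mE : mean_functional D G E).
Hypothesis mF : mean_functional D (fun=> True) F.
Hypothesis Gk : forall x, G (k x).
Hypothesis k0 : forall x y, 0 <= k x y.
Hypotheses (tau0 : 0 < tau) (tau1 : tau <= 1) (kappa0 : 0 < kappa) (kappa1 : kappa <= 1).
Hypothesis Ek : forall x, D x -> kappa <= E (k x).
Hypothesis Fk : forall x, D x -> kappa <= F (k x).
Variable delta : R.
Hypothesis delta0 : 0 <= delta.
Hypothesis Hk : forall x, D x -> `|F (k x) - E (k x)| <= delta.

Local Notation err f x := `|F (fun y => f y * k x y) - E (fun y => f y * k x y)|.

(** Subtracting the ratios over the denominator of F leaves the errors on the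
    numerator and on the denominator, the latter weighted by a bounded ratio: a
    single factor 1/kappa appears. *)
Lemma weighted_mean_dist_le f x a q : D x ->
  err f x <= a -> `|weighted_mean k E f x| <= q ->
  `|weighted_mean k F f x - weighted_mean k E f x| <= (a + q * delta) / kappa.
Proof.
move=> Dx fa fq; have Ex := Ek Dx; have Fx := Fk Dx.
have Ex0 := lt_le_trans kappa0 Ex; have Fx0 := lt_le_trans kappa0 Fx.
have -> : weighted_mean k F f x - weighted_mean k E f x =
    ((F (fun y => f y * k x y) - E (fun y => f y * k x y)) -
     weighted_mean k E f x * (F (k x) - E (k x))) / F (k x).
  by rewrite /weighted_mean; field; rewrite !gt_eqF.
rewrite normrM normfV (gtr0_norm Fx0).
apply: ler_pM; rewrite ?invr_ge0 ?(ltW Fx0)//; last by rewrite lef_pV2 ?posrE.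
apply: le_trans (ler_normB _ _) _; rewrite lerD// normrM.
by apply: ler_pM => //; exact: Hk.
Qed.

Let algF := function_algebra_all R N.
Local Notation LE := (mean_laplacian k (tau ^+ 2) E).
Local Notation LF := (mean_laplacian k (tau ^+ 2) F).
Local Notation incr f x := (fun y => f y - f x).

(* in terms of s and i the estimates are monomials in quantities at least 1 *)
Let s := tau^-1.
Let i := kappa^-1.
Let s1 : 1 <= s. Proof. by rewrite invf_ge1. Qed.
Let i1 : 1 <= i. Proof. by rewrite invf_ge1. Qed.
Let taus : tau * s = 1. Proof. by rewrite mulfV// gt_eqF. Qed.
Let tau2 : (tau ^+ 2)^-1 = s ^+ 2. Proof. by rewrite exprVn. Qed.
Let s0 : 0 <= s. Proof. by rewrite (le_trans _ s1). Qed.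
Let i0 : 0 <= i. Proof. by rewrite (le_trans _ i1). Qed.

Lemma weighted_mean_le_kappa f x B : D x -> G f -> 0 <= B ->
  (forall y, D y -> `|f y * k x y| <= B) -> `|weighted_mean k E f x| <= B * i.
Proof.
move=> Dx Gf B0 fB; have Ex0 := lt_le_trans kappa0 (Ek Dx).
rewrite /weighted_mean normrM normfV (gtr0_norm Ex0); apply: ler_pM => //.
- by rewrite invr_ge0 ltW.
- by apply: (mean_functional_norm_le algG mE) => //; exact: (algebraMk algG Gk x Gf).
- by rewrite lef_pV2 ?posrE// Ek.
Qed.

(** The increment of u times the kernel is O(tau), against the factor tau^-2. *)
Lemma laplacian_norm_le u C x : 0 <= C -> D x -> G u ->
  (forall y, D y -> `|(u y - u x) * k x y| <= C * tau) ->
  `|LE u x| <= 2 * C * s * i.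
Proof.
move=> C0 Dx Gu uC; rewrite /mean_laplacian tau2 normrM ger0_norm; last first.
  by rewrite mulr_ge0 ?exprn_ge0.
have Ct : 0 <= C * tau by rewrite mulr_ge0// ltW.
have Q := weighted_mean_le_kappa Dx (algebra_centered algG x Gu) Ct uC.
have s2 : 0 <= 2 * s ^+ 2 by rewrite mulr_ge0 ?exprn_ge0.
apply: le_trans (ler_wpM2l s2 Q) _.
rewrite (_ : 2 * s ^+ 2 * (C * tau * i) = 2 * C * s * i * (tau * s)); last by ring.
by rewrite taus mulr1.
Qed.

Lemma laplacian_dist_le u C x : 0 <= C -> D x -> G u ->
  (forall y, D y -> `|(u y - u x) * k x y| <= C * tau) ->
  err (incr u x) x <= C * tau * delta ->
  `|LF u x - LE u x| <= 4 * C * delta * s * i ^+ 2.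
Proof.
move=> C0 Dx Gu uC eu; rewrite /mean_laplacian tau2 -mulrBr normrM ger0_norm; last first.
  by rewrite mulr_ge0 ?exprn_ge0.
have Ct : 0 <= C * tau by rewrite mulr_ge0// ltW.
have Q := weighted_mean_le_kappa Dx (algebra_centered algG x Gu) Ct uC.
have := weighted_mean_dist_le Dx eu Q; rewrite -/i.
set d := `|_ - _| => dle.
apply: (@le_trans _ _ (2 * s ^+ 2 * ((C * tau * delta + C * tau * i * delta) * i))).
  by rewrite ler_wpM2l// mulr_ge0 ?exprn_ge0.
rewrite (_ : 2 * s ^+ 2 * _ =
    2 * C * delta * s * i * (1 + i) * (tau * s)); last by ring.
rewrite taus mulr1 -subr_ge0 (_ : _ - _ = 2 * C * delta * s * i * (i - 1)); last by ring.
by rewrite !mulr_ge0// subr_ge0.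
Qed.

Lemma Gamma_norm_le u v C x : 0 <= C -> D x -> G u -> G v ->
  (forall y, D y -> `|(u y - u x) * (v y - v x) * k x y| <= C * tau ^+ 2) ->
  `|Gamma LE u v x| <= C * i.
Proof.
move=> C0 Dx Gu Gv uvC.
rewrite (Gamma_mean_laplacianE _ algG mE)// tau2 normrM ger0_norm ?exprn_ge0//.
have Ct : 0 <= C * tau ^+ 2 by rewrite mulr_ge0// exprn_ge0// ltW.
have Guv : G (fun y => (u y - u x) * (v y - v x)).
  exact: (algebraM algG (algebra_centered algG x Gu) (algebra_centered algG x Gv)).
have Q := weighted_mean_le_kappa Dx Guv Ct uvC.
apply: le_trans (ler_wpM2l (exprn_ge0 2 s0) Q) _.
rewrite (_ : s ^+ 2 * (C * tau ^+ 2 * i) = C * i * (tau * s) ^+ 2); last by ring.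
by rewrite taus expr1n mulr1.
Qed.

Lemma Gamma_dist_le u v C x : 0 <= C -> D x -> G u -> G v ->
  (forall y, D y -> `|(u y - u x) * (v y - v x) * k x y| <= C * tau ^+ 2) ->
  err (fun y => (u y - u x) * (v y - v x)) x <= C * tau ^+ 2 * delta ->
  `|Gamma LF u v x - Gamma LE u v x| <= 2 * C * delta * i ^+ 2.
Proof.
move=> C0 Dx Gu Gv uvC euv.
rewrite (Gamma_mean_laplacianE _ algG mE)// (Gamma_mean_laplacianE _ algF mF)//.
rewrite tau2 -mulrBr normrM ger0_norm ?exprn_ge0//.
have Ct : 0 <= C * tau ^+ 2 by rewrite mulr_ge0// exprn_ge0// ltW.
have Guv : G (fun y => (u y - u x) * (v y - v x)).
  exact: (algebraM algG (algebra_centered algG x Gu) (algebra_centered algG x Gv)).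
have Q := weighted_mean_le_kappa Dx Guv Ct uvC.
have := weighted_mean_dist_le Dx euv Q; rewrite -/i; set d := `|_ - _| => dle.
apply: (@le_trans _ _ (s ^+ 2 * ((C * tau ^+ 2 * delta + C * tau ^+ 2 * i * delta) * i))).
  by rewrite ler_wpM2l// exprn_ge0.
rewrite (_ : s ^+ 2 * _ = C * delta * i * (1 + i) * (tau * s) ^+ 2); last by ring.
rewrite taus expr1n mulr1 -subr_ge0 (_ : _ - _ = C * delta * i * (i - 1)); last by ring.
by rewrite !mulr_ge0// subr_ge0.
Qed.

(** Both means are monotone, so the empirical Laplacian of a small function is
    small; the remaining difference only involves the fixed function h. *)
Lemma laplacian_dist2_le hF h a B x : 0 <= B -> D x -> G h ->
  (forall y, D y -> `|hF y - h y| <= a) -> (forall y, D y -> `|h y| <= B) ->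
  err h x <= B * delta ->
  `|LF hF x - LE h x| <= 4 * a * s ^+ 2 + 8 * B * delta * s ^+ 2 * i.
Proof.
move=> B0 Dx Gh hFa hB eh.
have Fx0 := lt_le_trans kappa0 (Fk Dx); have Ex0 := lt_le_trans kappa0 (Ek Dx).
pose g y := hF y - h y.
have g2 : `|weighted_mean k F (incr g x) x| <= 2 * a.
  apply: (weighted_mean_norm_le algF mF) => // y Dy.
  apply: le_trans (ler_normB _ _) _.
  by have := hFa y Dy; have := hFa x Dx; rewrite -/(g _) -/(g _); lra.
have h2 : `|weighted_mean k E (incr h x) x| <= 2 * B.
  apply: (weighted_mean_norm_le algG mE) => //; first exact: (algebra_centered algG x Gh).
  move=> y Dy; apply: le_trans (ler_normB _ _) _.
  by have := hB y Dy; have := hB x Dx; lra.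
have eh2 : err (incr h x) x <= 2 * B * delta.
  have -> : F (fun y => incr h x y * k x y) - E (fun y => incr h x y * k x y) =
      (F (fun y => h y * k x y) - E (fun y => h y * k x y)) -
      h x * (F (k x) - E (k x)).
    have -> : (fun y => incr h x y * k x y) = (fun y => h y * k x y - h x * k x y).
      by apply/funext => y; rewrite mulrBl.
    rewrite (mean_functionalB mF)// (mean_functionalB mE); last 2 first.
    - exact: (algebraMk algG Gk x Gh).
    - exact: (algebraZ algG (h x) (Gk x)).
    rewrite (mean_functionalZ algF mF)// (mean_functionalZ algG mE)//; ring.
  apply: le_trans (ler_normB _ _) _; rewrite normrM.
  have : `|h x| * `|F (k x) - E (k x)| <= B * delta.
    by apply: ler_pM => //; [exact: hB|exact: Hk].
  lra.
have := weighted_mean_dist_le Dx eh2 h2; rewrite -/i => d2.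
have -> : LF hF x - LE h x = 2 * s ^+ 2 * (weighted_mean k F (incr g x) x +
    (weighted_mean k F (incr h x) x - weighted_mean k E (incr h x) x)).
  rewrite /mean_laplacian tau2 -mulrBr addrA -(weighted_meanD algF mF)//.
  congr (_ * (weighted_mean k F _ x - _)); apply/funext => y.
  by rewrite /g; ring.
rewrite normrM ger0_norm; last by rewrite mulr_ge0 ?exprn_ge0.
apply: (@le_trans _ _ (2 * s ^+ 2 * (2 * a + (2 * B * delta + 2 * B * delta) * i))).
  rewrite ler_wpM2l ?mulr_ge0 ?exprn_ge0//.
  by apply: le_trans (ler_normD _ _) _; rewrite lerD.
by rewrite le_eqVlt; apply/orP; left; apply/eqP; ring.
Qed.

(** Again gF is replaced by g at the cost of their distance, and the increments of
    g are expanded so that only means of fixed functions, times an increment of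
    v and the kernel, are compared. *)
Lemma Gamma_dist2_le gF g v C a B x : 0 <= C -> 0 <= B -> D x -> G g -> G v ->
  (forall y, D y -> `|gF y - g y| <= a) -> (forall y, D y -> `|g y| <= B) ->
  (forall y, D y -> `|v y - v x| <= C) ->
  err (incr v x) x <= C * tau * delta ->
  err (fun y => g y * (v y - v x)) x <= B * (C * tau * delta) ->
  `|Gamma LF gF v x - Gamma LE g v x| <=
    2 * a * C * s ^+ 2 + 4 * B * C * delta * s ^+ 2 * i.
Proof.
move=> C0 B0 Dx Gg Gv gFa gB vC ev egv.
have Fx0 := lt_le_trans kappa0 (Fk Dx); have Ex0 := lt_le_trans kappa0 (Ek Dx).
rewrite (Gamma_mean_laplacianE _ algG mE)// (Gamma_mean_laplacianE _ algF mF)//.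
rewrite tau2 -mulrBr normrM ger0_norm ?exprn_ge0//.
pose e y := gF y - g y.
have e2 : `|weighted_mean k F (fun y => (e y - e x) * (v y - v x)) x| <= 2 * a * C.
  apply: (weighted_mean_norm_le algF mF) => // y Dy; rewrite normrM.
  apply: ler_pM => //; last exact: vC.
  apply: le_trans (ler_normB _ _) _.
  by have := gFa y Dy; have := gFa x Dx; rewrite -/(e _) -/(e _); lra.
have Ggv : G (fun y => (g y - g x) * (v y - v x)).
  exact: (algebraM algG (algebra_centered algG x Gg) (algebra_centered algG x Gv)).
have g2 : `|weighted_mean k E (fun y => (g y - g x) * (v y - v x)) x| <= 2 * B * C.
  apply: (weighted_mean_norm_le algG mE) => // y Dy; rewrite normrM.
  apply: ler_pM => //; last exact: vC.
  apply: le_trans (ler_normB _ _) _.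
  by have := gB y Dy; have := gB x Dx; lra.
have eg2 : err (fun y => (g y - g x) * (v y - v x)) x <= 2 * B * C * delta.
  have Gvk := algebraMk algG Gk x (algebra_centered algG x Gv).
  have Ggvk := algebraMk algG Gk x (algebraM algG Gg (algebra_centered algG x Gv)).
  have -> : (fun y => (g y - g x) * (v y - v x) * k x y) =
     (fun y => g y * (v y - v x) * k x y + - g x * ((v y - v x) * k x y)).
    by apply/funext => y; ring.
  rewrite (mean_functional_lin mE)// (mean_functional_lin mF)//.
  rewrite opprD addrACA -mulrBr; apply: le_trans (ler_normD _ _) _.
  rewrite normrM normrN.
  have T : B * (C * tau * delta) <= B * (C * delta).
    by rewrite ler_wpM2l// -mulrA ler_wpM2l// ler_piMl.
  have : `|g x| * err (incr v x) x <= B * (C * tau * delta).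
    by apply: ler_pM => //; exact: gB.
  lra.
have := weighted_mean_dist_le Dx eg2 g2; rewrite -/i => d2.
have -> : weighted_mean k F (fun y => (gF y - gF x) * (v y - v x)) x =
    weighted_mean k F (fun y => (e y - e x) * (v y - v x)) x +
    weighted_mean k F (fun y => (g y - g x) * (v y - v x)) x.
  rewrite -(weighted_meanD algF mF)//; congr (weighted_mean k F _ x).
  by apply/funext => y; rewrite /e; ring.
rewrite -addrA.
apply: (@le_trans _ _ (s ^+ 2 * (2 * a * C + (2 * B * C * delta + 2 * B * C * delta) * i))).
  rewrite ler_wpM2l ?exprn_ge0//.
  by apply: le_trans (ler_normD _ _) _; rewrite lerD.
by rewrite le_eqVlt; apply/orP; left; apply/eqP; ring.
Qed.

Lemma algebra_Gamma (L : ('rV[R]_N -> R) -> 'rV[R]_N -> R) u v :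
  (forall f, G f -> G (L f)) -> G u -> G v -> G (Gamma L u v).
Proof.
move=> GL Gu Gv; apply: (algebraZ algG 2^-1); apply: (algebraB algG).
  apply: (algebraB algG); first by apply: GL; exact: (algebraM algG Gu Gv).
  by apply: (algebraM algG) => //; exact: GL.
by apply: (algebraM algG) => //; exact: GL.
Qed.

(** The terms containing L u and L v dominate: L u is of size 1/(tau kappa), its
    error of size delta/(tau kappa^2), and the outer operator costs a further
    factor tau^-2. *)
Lemma Gamma2_dist_le u v C x : 1 <= C -> D x -> G u -> G v ->
  (forall f, G f -> G (LE f)) ->
  (forall x y, D x -> D y -> `|u y - u x| <= C) ->
  (forall x y, D x -> D y -> `|v y - v x| <= C) ->
  (forall x y, D x -> D y -> `|(u y - u x) * k x y| <= C * tau) ->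
  (forall x y, D x -> D y -> `|(v y - v x) * k x y| <= C * tau) ->
  (forall x y, D x -> D y ->
     `|(u y - u x) * (v y - v x) * k x y| <= C * tau ^+ 2) ->
  (forall x, D x -> err (incr u x) x <= C * tau * delta) ->
  (forall x, D x -> err (incr v x) x <= C * tau * delta) ->
  (forall x, D x ->
     err (fun y => (u y - u x) * (v y - v x)) x <= C * tau ^+ 2 * delta) ->
  (forall x, D x -> err (Gamma LE u v) x <= C * i * delta) ->
  (forall x, D x ->
     err (fun y => LE u y * (v y - v x)) x <= 2 * C * s * i * (C * tau * delta)) ->
  (forall x, D x ->
     err (fun y => LE v y * (u y - u x)) x <= 2 * C * s * i * (C * tau * delta)) ->
  `|Gamma2 LF u v x - Gamma2 LE u v x| <= 24 * C ^+ 2 * delta * s ^+ 3 * i ^+ 2.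
Proof.
move=> C1 Dx Gu Gv GL uC vC uk vk uvk eu ev euv eh egu egv.
have C0 : 0 <= C by rewrite (le_trans _ C1).
have du y : D y -> `|LF u y - LE u y| <= 4 * C * delta * s * i ^+ 2.
  by move=> Dy; apply: laplacian_dist_le => //; [move=> z; exact: uk|exact: eu].
have dv y : D y -> `|LF v y - LE v y| <= 4 * C * delta * s * i ^+ 2.
  by move=> Dy; apply: laplacian_dist_le => //; [move=> z; exact: vk|exact: ev].
have nu y : D y -> `|LE u y| <= 2 * C * s * i.
  by move=> Dy; apply: laplacian_norm_le => // z; exact: uk.
have nv y : D y -> `|LE v y| <= 2 * C * s * i.
  by move=> Dy; apply: laplacian_norm_le => // z; exact: vk.
have T1 := @laplacian_dist2_le (Gamma LF u v) (Gamma LE u v)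
  (2 * C * delta * i ^+ 2) (C * i) x (mulr_ge0 C0 i0) Dx (algebra_Gamma GL Gu Gv).
have {}T1 : `|LF (Gamma LF u v) x - LE (Gamma LE u v) x| <=
    4 * (2 * C * delta * i ^+ 2) * s ^+ 2 + 8 * (C * i) * delta * s ^+ 2 * i.
  apply: T1.
  - move=> y Dy; apply: Gamma_dist_le => //; [by move=> z; exact: uvk|exact: euv].
  - by move=> y Dy; apply: Gamma_norm_le => // z; exact: uvk.
  - exact: eh.
have B0 : 0 <= 2 * C * s * i by rewrite !mulr_ge0.
have T2 := Gamma_dist2_le C0 B0 Dx (GL _ Gu) Gv du nu (fun y => @vC x y Dx)
  (ev x Dx) (egu x Dx).
have T3 := Gamma_dist2_le C0 B0 Dx (GL _ Gv) Gu dv nv (fun y => @uC x y Dx)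
  (eu x Dx) (egv x Dx).
rewrite /Gamma2 (GammaC LF u (LF v)) (GammaC LE u (LE v)).
have M : 4 * (2 * C * delta * i ^+ 2) * s ^+ 2 + 8 * (C * i) * delta * s ^+ 2 * i <=
    16 * C ^+ 2 * delta * s ^+ 3 * i ^+ 2.
  rewrite (_ : _ + _ = 16 * C * delta * s ^+ 2 * i ^+ 2 * 1); last by ring.
  rewrite (_ : 16 * C ^+ 2 * delta * s ^+ 3 * i ^+ 2 =
    16 * C * delta * s ^+ 2 * i ^+ 2 * (C * s)); last by ring.
  by rewrite ler_wpM2l ?mulr_ge0 ?exprn_ge0// -[1]mulr1 ler_pM.
have M2 : 2 * (4 * C * delta * s * i ^+ 2) * C * s ^+ 2 +
    4 * (2 * C * s * i) * C * delta * s ^+ 2 * i =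
    16 * C ^+ 2 * delta * s ^+ 3 * i ^+ 2 by ring.
rewrite M2 in T2 T3; have {M}T1 := le_trans T1 M.
(* half of the sum of the three errors, each at most 16 C^2 delta s^3 i^2 *)
have -> : 24 * C ^+ 2 * delta * s ^+ 3 * i ^+ 2 =
    3 / 2 * (16 * C ^+ 2 * delta * s ^+ 3 * i ^+ 2) by field.
move: T1 T2 T3; set Z := 16 * _ * _ * _ * _.
move: (LF _ x) (LE _ x) (Gamma LF _ v x) (Gamma LE _ v x) (Gamma LF _ u x)
  (Gamma LE _ u x) => a b c d e f.
rewrite !ler_norml => /andP[? ?] /andP[? ?] /andP[? ?]; apply/andP; split; lra.
Qed.

End laplacian_comparison.

(** * The Gaussian kernel *)

Section gauss_kernel_bounds.
Context {R : realType} {N : nat}.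
Implicit Types (x y z : 'rV[R]_N) (tau : R).

Lemma gauss_kernelE tau x y :
  gauss_kernel (tau ^+ 2) x y = expR (- (dotv (x - y) (x - y) / (2 * tau ^+ 2))).
Proof. by rewrite /gauss_kernel sqr_enorm. Qed.

Lemma gauss_kernelC (t : R) x y : gauss_kernel t x y = gauss_kernel t y x.
Proof.
rewrite /gauss_kernel !sqr_enorm (_ : dotv (x - y) (x - y) = dotv (y - x) (y - x))//.
by apply: eq_bigr => i _; rewrite !mxE; ring.
Qed.

Lemma gauss_kernel_ge0 (t : R) x y : 0 <= gauss_kernel t x y.
Proof. exact: expR_ge0. Qed.

Lemma gauss_kernel_le1 tau x y : gauss_kernel (tau ^+ 2) x y <= 1.
Proof.
rewrite gauss_kernelE -expR0 ler_expR oppr_le0 divr_ge0 ?dotv_ge0//.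
by rewrite mulr_ge0 ?sqr_ge0.
Qed.

Lemma expRN_dist_le (a b : R) : 0 <= a -> 0 <= b -> `|expR (- a) - expR (- b)| <= `|a - b|.
Proof.
wlog ab : a b / a <= b.
  move=> W a0 b0; have [/W|/ltW/W] := leP a b; first exact.
  by move=> H; rewrite distrC (distrC a); exact: H.
move=> a0 b0; rewrite ger0_norm ?subr_ge0 ?ler_expR ?lerN2// distrC ger0_norm ?subr_ge0//.
have -> : expR (- a) - expR (- b) = expR (- a) * (1 - expR (- (b - a))).
  by rewrite mulrBr mulr1 -expRD; congr (_ - expR _); ring.
have e1 : expR (- a) <= 1 by rewrite -expR0 ler_expR; lra.
have e2 : 1 - expR (- (b - a)) <= b - a.
  by have := expR_ge1Dx (- (b - a)); lra.
have e3 : 0 <= 1 - expR (- (b - a)) by rewrite subr_ge0 -expR0 ler_expR; lra.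
by apply: le_trans e2; rewrite ler_piMl.
Qed.

Lemma gauss_kernel_lipschitz (A tau : R) x z y :
  `|x| <= A -> `|z| <= A -> `|y| <= A -> 0 < tau ->
  `|gauss_kernel (tau ^+ 2) x y - gauss_kernel (tau ^+ 2) z y| <=
    2 * N%:R * A / tau ^+ 2 * `|x - z|.
Proof.
move=> xA zA yA tau0; have t0 : 0 < 2 * tau ^+ 2 by rewrite mulr_gt0 ?exprn_gt0.
rewrite !gauss_kernelE; apply: le_trans (expRN_dist_le _ _) _.
- by rewrite divr_ge0 ?dotv_ge0 ?ltW.
- by rewrite divr_ge0 ?dotv_ge0 ?ltW.
rewrite -mulrBl normrM normfV (gtr0_norm t0) ler_pdivrMr//.
have -> : dotv (x - y) (x - y) - dotv (z - y) (z - y) =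
    dotv (x - z) ((x - y) + (z - y)).
  by rewrite /dotv -sumrB; apply: eq_bigr => i _; rewrite !mxE; ring.
apply: le_trans (dotv_le_norm _ _) _.
have n4 : `|(x - y) + (z - y)| <= 4 * A.
  apply: le_trans (ler_normD _ _) _.
  have := ler_normB x y; have := ler_normB z y; lra.
rewrite (_ : 2 * N%:R * A / tau ^+ 2 * `|x - z| * (2 * tau ^+ 2) =
  N%:R * (`|x - z| * (4 * A))); last by field; rewrite gt_eqF.
by rewrite ler_wpM2l// ler_wpM2l.
Qed.

Lemma sqr_norm_le_dotv x : `|x| ^+ 2 <= dotv x x.
Proof.
rewrite -(sqr_sqrtr (dotv_ge0 x)) lerXn2r ?nnegrE ?sqrtr_ge0//.
apply: norm_le_coord; first exact: sqrtr_ge0.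
move=> i; rewrite -sqrtr_sqr ler_wsqrtr// /dotv (bigD1 i)//= -expr2 lerDl.
by apply: sumr_ge0 => j _; rewrite -expr2 sqr_ge0.
Qed.

(** With z = |x - y|/tau, both bounds follow from
    exp(-z^2/2) <= 1/(1 + z^2/2). They turn each increment of a Lipschitz
    function into a factor tau. *)
Lemma gauss_kernel_moments tau x y : 0 < tau ->
  `|x - y| * gauss_kernel (tau ^+ 2) x y <= tau /\
  `|x - y| ^+ 2 * gauss_kernel (tau ^+ 2) x y <= 2 * tau ^+ 2.
Proof.
move=> tau0; pose z := `|x - y| / tau; have z0 : 0 <= z by rewrite divr_ge0// ltW.
have xyE : `|x - y| = z * tau by rewrite /z divfK ?gt_eqF.
have kz : gauss_kernel (tau ^+ 2) x y <= (1 + z ^+ 2 / 2)^-1.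
  rewrite gauss_kernelE expRN lef_pV2 ?posrE ?expR_gt0//; last first.
    by have := sqr_ge0 z; lra.
  apply: le_trans (expR_ge1Dx _) _; rewrite ler_expR.
  rewrite ler_pdivlMr; last by rewrite mulr_gt0 ?exprn_gt0.
  rewrite (_ : z ^+ 2 / 2 * (2 * tau ^+ 2) = (z * tau) ^+ 2); last by field.
  by rewrite -xyE; exact: sqr_norm_le_dotv.
have z2 : 0 < 1 + z ^+ 2 / 2 by have := sqr_ge0 z; lra.
have zk : z * gauss_kernel (tau ^+ 2) x y <= 1.
  apply: (@le_trans _ _ (z * (1 + z ^+ 2 / 2)^-1)); first by rewrite ler_wpM2l.
  by rewrite ler_pdivrMr// mul1r; nra.
have z2k : z ^+ 2 * gauss_kernel (tau ^+ 2) x y <= 2.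
  apply: (@le_trans _ _ (z ^+ 2 * (1 + z ^+ 2 / 2)^-1)).
    by rewrite ler_wpM2l// exprn_ge0.
  by rewrite ler_pdivrMr//; nra.
rewrite xyE; split.
  by rewrite mulrAC ler_piMl// ltW.
rewrite exprMn mulrAC; apply: ler_wpM2r => //; exact: sqr_ge0.
Qed.

Lemma gauss_kernel_continuous (t : R) x : continuous (fun y => gauss_kernel t x y).
Proof.
have -> : gauss_kernel t x = expR \o (fun y => - ((\sum_(i < N)
    (x 0 i - y 0 i) * (x 0 i - y 0 i)) / (2 * t))).
  apply/funext => y; rewrite /gauss_kernel sqr_enorm /=.
  by rewrite (_ : dotv _ _ = \sum_(i < N) (x 0 i - y 0 i) * (x 0 i - y 0 i))//;
    apply: eq_bigr => i _; rewrite !mxE.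
have cc i : continuous (fun z : 'rV[R]_N => x 0 i - z 0 i).
  move=> z; apply: continuousB; first exact: cst_continuous.
  exact: (@coord_continuous R 1 N 0 i).
have S : continuous (fun z : 'rV[R]_N => \sum_(i < N) (x 0 i - z 0 i) * (x 0 i - z 0 i)).
  apply: continuous_big => [|i _]; first exact: add_continuous.
  by move=> z; exact: (continuousM (cc i z) (cc i z)).
move=> y; apply: continuous_comp; last exact: continuous_expR.
exact: (continuousN (continuousM (S y) (@cst_continuous _ _ (2 * t)^-1 y))).
Qed.

End gauss_kernel_bounds.

Lemma bounded_measurable_gauss (R : realType) N (D : set 'rV[R]_N) tau x :
  measurable (D : set (borelRV R N)) -> bounded_measurable D (gauss_kernel (tau ^+ 2) x).
Proof.
move=> mD; split.
  apply: continuous_measurable_rV => //; apply: continuous_subspaceT.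
  exact: gauss_kernel_continuous.
by exists 1 => y _; rewrite ger0_norm ?gauss_kernel_ge0 ?gauss_kernel_le1.
Qed.

Lemma lipschitz_within_continuous (R : realType) N (D : set 'rV[R]_N)
    (f : 'rV[R]_N -> R) (K : R) :
  (forall x y, D x -> D y -> `|f x - f y| <= K * `|x - y|) ->
  {within D, continuous f}.
Proof.
move=> fK; apply/subspace_continuousP => x Dx; apply/cvgrPdist_le => e e0.
pose K' := 1 + `|K|; have K'0 : 0 < K' by rewrite ltr_wpDr.
rewrite near_withinE; near=> y => Dy.
apply: le_trans (fK x y Dx Dy) _.
have : `|x - y| <= e / K'.
  by near: y; apply: cvgr_dist_le => //; rewrite divr_gt0.
rewrite ler_pdivlMr// mulrC; apply: le_trans.
rewrite ler_wpM2r//; apply: le_trans (ler_norm K) _; rewrite /K'; lra.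
Unshelve. all: by end_near. Qed.

Lemma function_algebra_bounded_measurable (R : realType) N (D : set 'rV[R]_N) :
  function_algebra (bounded_measurable D).
Proof.
split; first exact: bounded_measurable_cst.
  exact: bounded_measurableD.
exact: bounded_measurableM.
Qed.

Lemma mean_functional_integral (R : realType) N
    (nu : {measure set (borelRV R N) -> \bar R}) (D : set 'rV[R]_N) :
  measurable (D : set (borelRV R N)) -> nu D = 1%E ->
  mean_functional D (bounded_measurable D)
    (fun h => \int[nu]_(y in (D : set (borelRV R N))) h y).
Proof.
move=> mD nuD; split.
- exact: mean_cst.
- move=> c f g gf gg; rewrite (meanD mD nuD gf); last exact: bounded_measurableZ.
  by rewrite (meanZ mD nuD).
- exact: mean_le.
Qed.

Lemma mean_functional_empirical (R : realType) N n (D : set 'rV[R]_N)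
    (x : nat -> 'rV[R]_N) : (0 < n)%N -> (forall j, D (x j)) ->
  mean_functional D (fun=> True) (empirical_mean n x).
Proof.
move=> n0 Dx; have nR0 : n%:R != 0 :> R by rewrite pnatr_eq0 -lt0n.
rewrite /empirical_mean; split.
- by move=> c; rewrite sumr_const card_ord -[c *+ n]mulr_natl mulKf.
- move=> c f g _ _; rewrite mulrCA -mulrDr; congr (_ * _).
  by rewrite mulr_sumr -big_split.
- move=> f g _ _ fg; rewrite ler_wpM2l ?invr_ge0//.
  by apply: ler_sum => j _; exact: fg.
Qed.

Lemma Lop_hatE (R : realType) N n (x : nat -> 'rV[R]_N) (t : R) :
  Lop_hat n x t = mean_laplacian (gauss_kernel t) t (empirical_mean n x).
Proof.
apply/funext => f; apply/funext => y.
rewrite /Lop_hat /mean_laplacian /weighted_mean /theta_hat /empirical_mean.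
have -> : \sum_(j < n) gauss_kernel t (x j) y = \sum_(j < n) gauss_kernel t y (x j).
  by apply: eq_bigr => j _; exact: gauss_kernelC.
have -> : \sum_(j < n) gauss_kernel t (x j) y * (f (x j) - f y) =
    \sum_(j < n) (f (x j) - f y) * gauss_kernel t y (x j).
  by apply: eq_bigr => j _; rewrite mulrC gauss_kernelC.
by rewrite !invfM; ring.
Qed.

(** * The operators of the uniform law *)

Lemma within_continuous_div (R : realType) N (D : set 'rV[R]_N) (f g : 'rV[R]_N -> R) :
  {within D, continuous f} -> {within D, continuous g} ->
  (forall x, D x -> g x != 0) -> {within D, continuous (fun x => f x / g x)}.
Proof.
move=> /subspace_continuousP cf /subspace_continuousP cg g0.
apply/subspace_continuousP => x Dx.
exact: (cvgM (cf x Dx) (cvgV (g0 x Dx) (cg x Dx))).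
Qed.

Section laplacian_regularity.
Context {R : realType} {N : nat} (nu : {measure set (borelRV R N) -> \bar R}).
Variables (D : set 'rV[R]_N) (A tau kappa : R).
Hypothesis mD : measurable (D : set (borelRV R N)).
Hypothesis nuD : nu D = 1%E.
Hypothesis DA : forall x, D x -> `|x| <= A.
Hypotheses (tau0 : 0 < tau) (kappa0 : 0 < kappa).

Local Notation k := (gauss_kernel (tau ^+ 2)).
Let E h : R := \int[nu]_(y in (D : set (borelRV R N))) h y.
Hypothesis Ek : forall x, D x -> kappa <= E (k x).

Let algG := function_algebra_bounded_measurable D.
Let mE : mean_functional D (bounded_measurable D) E := mean_functional_integral mD nuD.
Let Gk x : bounded_measurable D (k x) := bounded_measurable_gauss tau x mD.

(** Numerator and denominator are Lipschitz in the centre of the kernel, and the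
    denominator stays away from 0 on D. *)
Lemma weighted_mean_measurable f : bounded_measurable D f ->
  measurable_fun (D : set (borelRV R N)) (weighted_mean k E f : borelRV R N -> R).
Proof.
move=> Gf; have [_ [B fB]] := Gf.
have Ek_cont g (C : R) : bounded_measurable D g -> (forall x, D x -> `|g x| <= C) ->
    {within D, continuous (fun x => E (fun y => g y * k x y))}.
  move=> Gg gC; apply: (@lipschitz_within_continuous _ _ _ _
    (C * (2 * N%:R * A / tau ^+ 2))) => x x' Dx Dx'.
  apply: (mean_dist_le mD nuD); [exact: (algebraMk algG Gk x Gg)|
    exact: (algebraMk algG Gk x' Gg)|].
  move=> y Dy; rewrite -mulrBr normrM -mulrA; apply: ler_pM => //; first exact: gC.
  by apply: gauss_kernel_lipschitz => //; exact: DA.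
apply: continuous_measurable_rV => //; apply: within_continuous_div.
- exact: Ek_cont Gf fB.
- have -> : (fun x => E (k x)) = (fun x => E (fun y => 1 * k x y)).
    by apply/funext => x; congr E; apply/funext => y; rewrite mul1r.
  by apply: (Ek_cont _ 1 (bounded_measurable_cst _ 1)) => x _; rewrite normr1.
- by move=> x Dx; rewrite gt_eqF// (lt_le_trans kappa0)// Ek.
Qed.

(** This closure property is what allows the operator to be iterated. *)
Lemma mean_laplacian_bounded_measurable f : bounded_measurable D f ->
  bounded_measurable D (mean_laplacian k (tau ^+ 2) E f).
Proof.
move=> Gf; have [mf [B fB]] := Gf.
have Ek0 x : D x -> 0 < E (k x) by move=> Dx; rewrite (lt_le_trans kappa0)// Ek.
have LE x : D x -> mean_laplacian k (tau ^+ 2) E f x =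
    2 / tau ^+ 2 * (weighted_mean k E f x - f x).
  move=> Dx; rewrite /mean_laplacian /weighted_mean; congr (_ * _).
  have -> : (fun y => (f y - f x) * k x y) = (fun y => f y * k x y - f x * k x y).
    by apply/funext => y; rewrite mulrBl.
  rewrite (mean_functionalB mE); last 2 first.
  - exact: (algebraMk algG Gk x Gf).
  - exact: (algebraZ algG (f x) (Gk x)).
  rewrite (mean_functionalZ algG mE) ?mulrBl ?mulfK ?gt_eqF ?Ek0//; exact: Gk.
split.
  have H : measurable_fun (D : set (borelRV R N))
      (fun x : borelRV R N => 2 / tau ^+ 2 * (weighted_mean k E f x - f x)).
    apply: measurable_funM => //; apply: measurable_funB => //.
    exact: weighted_mean_measurable.
  by apply: eq_measurable_fun H => x; rewrite inE => /LE.
exists (2 / tau ^+ 2 * (2 * B)) => x Dx; rewrite /mean_laplacian normrM ger0_norm; last first.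
  by rewrite divr_ge0// sqr_ge0.
rewrite ler_wpM2l//; first by rewrite divr_ge0// sqr_ge0.
apply: (weighted_mean_norm_le algG mE Gk (@gauss_kernel_ge0 _ _ _)).
- exact: (algebra_centered algG x Gf).
- exact: Ek0.
- move=> y Dy; apply: le_trans (ler_normB _ _) _.
  by have := fB x Dx; have := fB y Dy; lra.
Qed.

End laplacian_regularity.

Section gamma_ext.
Context {R : realType} {N : nat} (G : ('rV[R]_N -> R) -> Prop).
Variables L L' : ('rV[R]_N -> R) -> 'rV[R]_N -> R.
Hypothesis algG : function_algebra G.
Hypothesis LL' : forall f, G f -> L f = L' f.
Hypothesis GL : forall f, G f -> G (L' f).

Lemma Gamma_ext u v : G u -> G v -> Gamma L u v = Gamma L' u v.
Proof.
by move=> Gu Gv; rewrite /Gamma !LL'//; exact: (algebraM algG Gu Gv).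
Qed.

(** Gamma2 only applies the operator to functions obtained from u and v by ring
    operations and the operator itself, and these stay in G. *)
Lemma Gamma2_ext u v : G u -> G v -> Gamma2 L u v = Gamma2 L' u v.
Proof.
move=> Gu Gv; have GLu := GL Gu; have GLv := GL Gv.
rewrite /Gamma2 Gamma_ext// (LL' Gu) (LL' Gv) !Gamma_ext// LL'//.
exact: (algebra_Gamma algG GL Gu Gv).
Qed.

End gamma_ext.

Section sampling_law.
Context {R : realType} {N : nat} {disp : measure_display}.
Context {Omega : measurableType disp} (P : probability Omega R).
Variables (Sigma : set 'rV[R]_N) (mu : {measure set (borelRV R N) -> \bar R}).
Variable X : {RV P >-> borelRV R N}.
Hypothesis mSigma : measurable (Sigma : set (borelRV R N)).
Hypothesis XSigma : forall w, Sigma (X w).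
Hypothesis unif : uniformly_distributed Sigma mu X.

Let nu := distribution P X.
Let m := fine (mu Sigma).

(** The law of X has mass 1, while division by a zero mass would make it 0. Since
    fine maps an infinite mass to 0, the mass of Sigma is finite too. *)
Lemma volume_gt0 : 0 < m.
Proof.
rewrite lt_neqAle fine_ge0// andbT eq_sym; apply/eqP => m0.
have := unif (@measurableT _ (borelRV R N)).
rewrite setTI -/m m0 invr0 mulr0 probability_setT => /eqP.
by rewrite eqe oner_eq0.
Qed.

Lemma volume_scale (A : set (borelRV R N)) : measurable A -> A `<=` Sigma ->
  mu A = (m%:E * nu A)%E.
Proof.
move=> mA ASigma; have m0 := volume_gt0.
have muS : (mu Sigma < +oo)%E.
  rewrite ltey; apply/eqP => muoo.
  by move: m0; rewrite /m muoo /= ltxx.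
have muA : mu A \is a fin_num.
  rewrite ge0_fin_numE//; apply: le_lt_trans muS.
  by apply: le_measure; rewrite ?inE.
rewrite /nu (unif mA) (setIidl ASigma) -EFinM mulrC -mulrA mulVf ?gt_eqF//.
by rewrite mulr1 fineK.
Qed.

Lemma Rintegral_volume h : bounded_measurable Sigma h ->
  \int[mu]_(y in (Sigma : set (borelRV R N))) h y =
  m * \int[nu]_(y in (Sigma : set (borelRV R N))) h y.
Proof.
move=> Gh; have [mh _] := Gh; have m0 := volume_gt0.
have nuS : nu Sigma = 1%E.
  rewrite /nu /distribution /pushforward (_ : _ @^-1` _ = setT) ?probability_setT//.
  by apply/seteqP; split => // w _; exact: XSigma.
have ih := bounded_measurable_integrable mSigma nuS Gh.
pose mk : {nonneg R} := NngNum (ltW m0).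
have scale (f : borelRV R N -> \bar R) : measurable_fun (Sigma : set (borelRV R N)) f ->
    (forall y, 0 <= f y)%E ->
    (\int[mu]_(y in Sigma) f y = m%:E * \int[nu]_(y in Sigma) f y)%E.
  move=> mf f0; rewrite (@eq_measure_integral _ _ _ _ (mscale mk nu)).
    by rewrite ge0_integral_mscale.
  by move=> A mA AS; rewrite /mscale /= volume_scale.
have mE : measurable_fun (Sigma : set (borelRV R N)) (EFin \o (h : borelRV R N -> R)).
  exact/measurable_EFinP.
have Ph : (\int[mu]_(y in Sigma) (h y)%:E = m%:E * \int[nu]_(y in Sigma) (h y)%:E)%E.
  rewrite integralE [in RHS]integralE scale//; last exact: measurable_funepos.
  rewrite scale//; last exact: measurable_funeneg.
  rewrite -muleBr//; exact: integrable_add_def.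
rewrite /Rintegral Ph fineM//; exact: integrable_fin_num.
Qed.

End sampling_law.

Lemma gauss_kernel_ball_ge (R : realType) N (tau : R) (x y : 'rV[R]_N) :
  0 < tau -> `|x - y| <= tau ->
  expR (- (N%:R / 2)) <= gauss_kernel (tau ^+ 2) x y.
Proof.
move=> tau0 xy; rewrite gauss_kernelE ler_expR lerN2.
rewrite ler_pdivrMr ?mulr_gt0 ?exprn_gt0//.
rewrite (_ : N%:R / 2 * (2 * tau ^+ 2) = N%:R * (tau * tau)); last by field.
apply: le_trans (ler_norm _) _; apply: le_trans (dotv_le_norm _ _) _.
by rewrite ler_wpM2l// ler_pM.
Qed.

Section kernel_mean_lower_bound.
Context {R : realType} {N : nat} {disp : measure_display}.
Context {Omega : measurableType disp} (P : probability Omega R).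
Variables (Sigma : set 'rV[R]_N) (mu : {measure set (borelRV R N) -> \bar R}).
Variables (d : nat) (X : {RV P >-> borelRV R N}).
Hypothesis cptSigma : compact Sigma.
Hypothesis smSigma : smooth_submanifold d Sigma.
Hypothesis vol_mu : riemannian_volume d Sigma mu.
Hypothesis XSigma : forall w, Sigma (X w).
Hypothesis unif : uniformly_distributed Sigma mu X.

Let nu := distribution P X.
Let m := fine (mu Sigma).
Let E h : R := \int[nu]_(y in (Sigma : set (borelRV R N))) h y.
Let mSigma := compact_measurable_rV cptSigma.

Lemma distribution_support : nu Sigma = 1%E.
Proof.
rewrite /nu /distribution /pushforward (_ : _ @^-1` _ = setT) ?probability_setT//.
by apply/seteqP; split => // w _; exact: XSigma.
Qed.

(** The kernel of bandwidth tau^2 is bounded below on balls of radius tau, whose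
    volume is at least a multiple of tau^d. *)
Lemma kernel_mean_ge : exists2 c : R, 0 < c & forall tau x,
  0 < tau <= 1 -> Sigma x -> c * tau ^+ d <= E (gauss_kernel (tau ^+ 2) x).
Proof.
have m0 : 0 < m := volume_gt0 unif.
have /filter_ex[c0 [c00 ballc]] : \forall c \near 0^'+, 0 < c /\
    forall x r, Sigma x -> 0 < r < c -> ((c * r ^+ d)%:E <= mu (Sigma `&` ball x r))%E.
  apply: filterI; last exact: volume_ball_ge.
  exact: nbhs_right_gt.
(* the radius rho * tau is within the range of the volume bound for all tau <= 1 *)
pose rho := Num.min 1 (c0 / 2).
have rho0 : 0 < rho by rewrite lt_min ltr01 divr_gt0.
have rhoc : rho < c0.
  by apply: (@le_lt_trans _ _ (c0 / 2)); [rewrite ge_min lexx orbT|lra].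
have rho1 : rho <= 1 by rewrite ge_min lexx.
exists (expR (- (N%:R / 2)) * (c0 * rho ^+ d / m)).
  by rewrite mulr_gt0 ?expR_gt0// divr_gt0// mulr_gt0// exprn_gt0.
move=> tau x /andP[tau0 tau1] Sx; pose r := tau * rho.
have r0 : 0 < r by rewrite mulr_gt0.
have rc : r < c0 by apply: le_lt_trans rhoc; rewrite ler_piMl// ltW.
have rtau : r <= tau by rewrite ler_piMr// ltW.
have mB : measurable (ball x r : set (borelRV R N)).
  by apply: open_measurable_rV; exact: ball_open.
have mSB : measurable (Sigma `&` ball x r : set (borelRV R N)) by exact: measurableI.
have := ballc x r Sx; rewrite r0 rc => /(_ isT).
rewrite (volume_scale mSigma unif mSB); last by move=> y [].
have nuB : nu (Sigma `&` ball x r) \is a fin_num by exact: fin_num_measure.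
rewrite -/m -/nu -(fineK nuB) -EFinM lee_fin => volB.
have GI : bounded_measurable Sigma (\1_(ball x r : set (borelRV R N))).
  split; first exact: measurable_indic.
  by exists 1 => y _; rewrite indicE ger0_norm// lern1 leq_b1.
have EI : E (\1_(ball x r : set (borelRV R N))) = fine (nu (Sigma `&` ball x r)).
  by rewrite /E /Rintegral integral_indic// setIC.
have mE : mean_functional Sigma (bounded_measurable Sigma) E :=
  mean_functional_integral mSigma distribution_support.
apply: (@le_trans _ _ (E (fun y =>
    expR (- (N%:R / 2)) * \1_(ball x r : set (borelRV R N)) y))).
  rewrite (mean_functionalZ (function_algebra_bounded_measurable _) mE)// EI -mulrA.
  rewrite ler_wpM2l ?expR_ge0//.
  rewrite mulrAC ler_pdivrMr// [leRHS]mulrC; apply: le_trans volB.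
  by rewrite -mulrA -exprMn [rho * _]mulrC.
apply: (mean_functional_le mE).
- exact: bounded_measurableZ.
- exact: bounded_measurable_gauss.
- move=> y Sy; rewrite indicE; case: (boolP (y \in _)) => [|_].
    rewrite inE -ball_normE /= mulr1 => xy.
    by apply: gauss_kernel_ball_ge => //; rewrite (le_trans (ltW xy)).
  by rewrite mulr0 gauss_kernel_ge0.
Qed.

(** The total mass of mu cancels between numerator and denominator. *)
Lemma LopE tau f : bounded_measurable Sigma f ->
  Lop Sigma mu (tau ^+ 2) f = mean_laplacian (gauss_kernel (tau ^+ 2)) (tau ^+ 2) E f.
Proof.
move=> Gf; apply/funext => x; have m0 : 0 < m := volume_gt0 unif.
have Gk := bounded_measurable_gauss tau x mSigma.
rewrite /Lop /mean_laplacian /weighted_mean /theta.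
rewrite (Rintegral_volume mSigma XSigma unif Gk).
rewrite (Rintegral_volume mSigma XSigma unif); last first.
  apply: bounded_measurableM => //; apply: bounded_measurableB => //.
  exact: bounded_measurable_cst.
have H (a b : R) : 2 / (tau ^+ 2 * (m * a)) * (m * b) = 2 / tau ^+ 2 * (b / a).
  rewrite !invfM -[RHS]mul1r -(mulVf (lt0r_neq0 m0)); ring.
exact: H.
Qed.

End kernel_mean_lower_bound.

(** * Bilinearity *)

Section gamma2_bilinear.
Context {R : realType} {N : nat} (G : ('rV[R]_N -> R) -> Prop).
Variable L : ('rV[R]_N -> R) -> 'rV[R]_N -> R.
Hypothesis algG : function_algebra G.
Hypothesis GL : forall f, G f -> G (L f).
Hypothesis linL : forall c f g, G f -> G g ->
  L (fun y => f y + c * g y) = fun x => L f x + c * L g x.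
Implicit Types f g u v : 'rV[R]_N -> R.

Let Gamma2C u v : Gamma2 L u v = Gamma2 L v u.
Proof.
apply/funext => y; rewrite /Gamma2 (GammaC L u v) (GammaC L (L u)) (GammaC L u).
by congr (_ * _); ring.
Qed.

Let linG c f g : G f -> G g -> G (fun y => f y + c * g y).
Proof. by move=> Gf Gg; apply: (algebraD algG) => //; exact: (algebraZ algG c Gg). Qed.

Lemma Gamma_lin c f g v : G f -> G g -> G v ->
  Gamma L (fun y => f y + c * g y) v = fun x => Gamma L f v x + c * Gamma L g v x.
Proof.
move=> Gf Gg Gv; apply/funext => x; rewrite /Gamma linL//.
rewrite (_ : (fun y => f y + c * g y) \* v = fun y => (f \* v) y + c * (g \* v) y).
  by rewrite linL; [ring|exact: (algebraM algG Gf Gv)|exact: (algebraM algG Gg Gv)].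
by apply/funext => y /=; ring.
Qed.

Lemma Gamma2_lin c f g v x : G f -> G g -> G v ->
  Gamma2 L (fun y => f y + c * g y) v x = Gamma2 L f v x + c * Gamma2 L g v x.
Proof.
move=> Gf Gg Gv; have Glf := GL Gf; have Glg := GL Gg; have Glv := GL Gv.
rewrite /Gamma2 linL// !Gamma_lin// linL; first by ring.
- exact: (algebra_Gamma algG GL Gf Gv).
- exact: (algebra_Gamma algG GL Gg Gv).
Qed.

Lemma algebra_sum (I : Type) (r : seq I) (a : I -> R) (e : I -> 'rV[R]_N -> R) :
  (forall i, G (e i)) -> G (fun y => \sum_(i <- r) a i * e i y).
Proof.
move=> Ge; elim: r => [|i r IH].
  rewrite (_ : (fun y => _) = fun=> 0); first exact: (algebra_cst algG 0).
  by apply/funext => y; rewrite big_nil.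
rewrite (_ : (fun y => _) = fun y => \sum_(i <- r) a i * e i y + a i * e i y).
  exact: linG.
by apply/funext => y; rewrite big_cons addrC.
Qed.

Lemma Gamma2_suml (I : Type) (r : seq I) (a : I -> R) (e : I -> 'rV[R]_N -> R) v x :
  (forall i, G (e i)) -> G v ->
  Gamma2 L (fun y => \sum_(i <- r) a i * e i y) v x =
  \sum_(i <- r) a i * Gamma2 L (e i) v x.
Proof.
move=> Ge Gv; elim: r => [|i r IH].
  rewrite big_nil (_ : (fun y => \sum_(i <- [::]) _) = fun=> 0); last first.
    by apply/funext => y; rewrite big_nil.
  (* by linearity z := Gamma2 L 0 v x satisfies z = z + z *)
  have G0 := algebra_cst algG (0 : R).
  have := Gamma2_lin 1 x G0 G0 Gv.
  have -> : (fun y : 'rV[R]_N => 0 + 1 * 0 : R) = fun=> 0.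
    by apply/funext => y; rewrite mulr0 addr0.
  by rewrite mul1r => /eqP; rewrite -subr_eq0 opprD addNKr oppr_eq0 => /eqP.
rewrite big_cons addrC -IH -Gamma2_lin//; last exact: algebra_sum.
by congr (Gamma2 L _ v x); apply/funext => y; rewrite big_cons addrC.
Qed.

Lemma Gamma2_sum (I : Type) (r : seq I) (a : I -> R) (e : I -> 'rV[R]_N -> R) x :
  (forall i, G (e i)) ->
  Gamma2 L (fun y => \sum_(i <- r) a i * e i y) (fun y => \sum_(i <- r) a i * e i y) x =
  \sum_(i <- r) \sum_(j <- r) a i * a j * Gamma2 L (e i) (e j) x.
Proof.
move=> Ge; rewrite Gamma2_suml//; last exact: algebra_sum.
apply: eq_bigr => i _; rewrite Gamma2C Gamma2_suml// mulr_sumr.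
by apply: eq_bigr => j _; rewrite Gamma2C mulrA.
Qed.

End gamma2_bilinear.

Lemma mean_laplacian_lin (R : realType) N (D : set 'rV[R]_N)
    (k : 'rV[R]_N -> 'rV[R]_N -> R) (t : R) (G : ('rV[R]_N -> R) -> Prop)
    (E : ('rV[R]_N -> R) -> R) c f g :
  function_algebra G -> mean_functional D G E -> (forall x, G (k x)) -> G f -> G g ->
  mean_laplacian k t E (fun y => f y + c * g y) =
  fun x => mean_laplacian k t E f x + c * mean_laplacian k t E g x.
Proof.
move=> algG mE Gk Gf Gg; apply/funext => x; rewrite /mean_laplacian.
have Gfx := algebra_centered algG x Gf; have Ggx := algebra_centered algG x Gg.
rewrite (_ : (fun y => _ - _) = fun y => (f y - f x) + c * (g y - g x)).
  rewrite (weighted_meanD algG mE)//; last exact: (algebraZ algG c Ggx).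
  by rewrite (weighted_meanZ algG mE)//; ring.
by apply/funext => y; ring.
Qed.

(** * Powers of the bandwidth and normalized kernels *)

Section bandwidth_powers.
Context {R : realType} (d : nat) (sigma : R).
Hypothesis sigma0 : 0 < sigma.

Definition bandwidth_exponent : R := 1 / (3 * d%:R + 3 + sigma).
Definition kernel_scale (n : nat) : R := n%:R `^ (- (bandwidth_exponent / 2)).
Local Notation a := bandwidth_exponent.
Local Notation tau := kernel_scale.

Let den0 : 0 < 3 * d%:R + 3 + sigma.
Proof. by rewrite ltr_wpDl// addr_ge0// mulr_ge0. Qed.

Lemma bandwidth_exponent_gt0 : 0 < a.
Proof. by rewrite divr_gt0. Qed.

Lemma bandwidth_exponentE : a * (3 * d%:R + 3 + sigma) = 1.
Proof. by rewrite /a divfK// gt_eqF. Qed.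

Lemma bandwidth_exponent_le : a <= 3^-1 /\ a * sigma <= 1.
Proof.
have a0 := bandwidth_exponent_gt0; have aE := bandwidth_exponentE.
have ad : 0 <= a * d%:R by rewrite mulr_ge0// ltW.
have as0 : 0 < a * sigma by rewrite mulr_gt0.
split; nra.
Qed.

(** With eps = a sigma / 4, delta of order n^(eps - 1/2) and kappa of order
    n^(- a d / 2): the first exponent is that of kappa/delta, and the second line
    computes that of delta tau^-3 kappa^-2. *)
Lemma rate_exponents :
  [/\ 0 < 2^-1 - a * sigma / 4 - a * d%:R / 2 &
    a * sigma / 4 - 2^-1 + 3 / 2 * a + a * d%:R = - (a * sigma / 4 + a * d%:R / 2)].
Proof.
have a0 := bandwidth_exponent_gt0.
have ad : 0 <= a * d%:R by rewrite mulr_ge0// ltW.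
have as0 : 0 < a * sigma by rewrite mulr_gt0.
have aE : 3 * (a * d%:R) + 3 * a + a * sigma = 1.
  by rewrite -[RHS]bandwidth_exponentE; ring.
move: (a * d%:R) (a * sigma) ad as0 aE => X Y X0 Y0 aE.
by split; lra.
Qed.

Lemma sqr_kernel_scale n : kernel_scale n ^+ 2 = bandwidth d sigma n.
Proof.
rewrite -powR_mulrn ?powR_ge0// -powRrM /bandwidth; congr (_ `^ _).
by rewrite mulNr divfK.
Qed.

Lemma kernel_scale_gt0 n : (0 < n)%N -> 0 < tau n.
Proof. by move=> n0; rewrite powR_gt0// ltr0n. Qed.

Lemma kernel_scale_le1 n : (0 < n)%N -> tau n <= 1.
Proof.
move=> n0; rewrite -(powRr0 n%:R); apply: ler_powR; first by rewrite ler1n.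
by rewrite oppr_le0 divr_ge0// ltW// bandwidth_exponent_gt0.
Qed.

Lemma kernel_scaleV n : (kernel_scale n)^-1 = n%:R `^ (a / 2).
Proof. by rewrite /kernel_scale powRN invrK. Qed.

Lemma kernel_scaleV_le n : (0 < n)%N -> (tau n)^-1 <= n%:R.
Proof.
move=> n0; rewrite kernel_scaleV -[leRHS](@powRr1 _ n%:R)//.
apply: ler_powR; first by rewrite ler1n.
by have [] := bandwidth_exponent_le; lra.
Qed.

Lemma kernel_scale_sqrV_le n : (0 < n)%N -> (tau n ^+ 2)^-1 <= n%:R.
Proof.
move=> n0; rewrite -exprVn kernel_scaleV -powR_mulrn ?powR_ge0// -powRrM.
rewrite -[leRHS](@powRr1 _ n%:R)//; apply: ler_powR; first by rewrite ler1n.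
by have [] := bandwidth_exponent_le; lra.
Qed.

End bandwidth_powers.

Section admissible_kernels.
Context {R : realType} {N : nat} (D : set 'rV[R]_N).

(** The hypotheses of the uniform law of large numbers. The Lipschitz constants
    are at most of order n^2 because t_n >= 1/n. *)
Definition admissible (Lam : R) (K : nat -> 'rV[R]_N -> 'rV[R]_N -> R) :=
  forall n, (0 < n)%N ->
  [/\ forall x y, D x -> D y -> `|K n x y| <= 1,
      forall x z y, D x -> D z -> D y ->
        `|K n x y - K n z y| <= Lam * n%:R ^+ 2 * `|x - z| &
      forall x, D x -> measurable_fun (D : set (borelRV R N)) (K n x : borelRV R N -> R)].

Variables (A : R) (d : nat) (sigma : R).
Hypothesis mD : measurable (D : set (borelRV R N)).
Hypothesis A0 : 0 <= A.
Hypothesis DA : forall x, D x -> `|x| <= A.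
Hypothesis sigma0 : 0 < sigma.
Variables (u v : 'rV[R]_N -> R) (C : R).
Hypothesis C1 : 1 <= C.
Hypotheses (mu : measurable_fun (D : set (borelRV R N)) (u : borelRV R N -> R)).
Hypotheses (mv : measurable_fun (D : set (borelRV R N)) (v : borelRV R N -> R)).
Hypothesis uL : forall x y, D x -> D y -> `|u x - u y| <= C * `|x - y|.
Hypothesis vL : forall x y, D x -> D y -> `|v x - v y| <= C * `|x - y|.
Hypothesis uC : forall x y, D x -> D y -> `|u y - u x| <= C.
Hypothesis vC : forall x y, D x -> D y -> `|v y - v x| <= C.

Local Notation tau := (kernel_scale d sigma).
Local Notation k n := (gauss_kernel (tau n ^+ 2)).
Hypothesis uk : forall n x y, (0 < n)%N -> D x -> D y ->
  `|(u y - u x) * k n x y| <= C * tau n.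
Hypothesis uvk : forall n x y, (0 < n)%N -> D x -> D y ->
  `|(u y - u x) * (v y - v x) * k n x y| <= C * tau n ^+ 2.

Let L1 : R := 2 * N%:R * A.
Let L10 : 0 <= L1. Proof. by rewrite !mulr_ge0. Qed.

Let kL n x z y : (0 < n)%N -> D x -> D z -> D y ->
  `|k n x y - k n z y| <= L1 * n%:R * `|x - z|.
Proof.
move=> n0 Dx Dz Dy.
have := gauss_kernel_lipschitz (DA Dx) (DA Dz) (DA Dy) (kernel_scale_gt0 d sigma n0).
move=> /le_trans; apply; rewrite ler_wpM2r//= ler_wpM2l//.
exact: kernel_scale_sqrV_le.
Qed.

Let mk n x : measurable_fun (D : set (borelRV R N)) (k n x : borelRV R N -> R).
Proof. by have [] := bounded_measurable_gauss (tau n) x mD. Qed.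

Let k1 n (x y : 'rV[R]_N) : `|k n x y| <= 1.
Proof. by rewrite ger0_norm ?gauss_kernel_ge0 ?gauss_kernel_le1. Qed.

Lemma admissible_gauss : admissible L1 (fun n => k n).
Proof.
move=> n n0; split => [x y _ _||x _]; [exact: k1| |exact: mk].
move=> x z y Dx Dz Dy; apply: (le_trans (kL n0 Dx Dz Dy)).
rewrite ler_wpM2r// ler_wpM2l// -natrX ler_nat.
by rewrite -{1}(expn1 n) leq_pexp2l.
Qed.

(** Moving the centre from x to z changes the increment and the kernel, one after
    the other. Division by C tau restores the bound 1. *)
Lemma admissible_incr : admissible (1 + L1)
  (fun n x y => (u y - u x) * k n x y / (C * tau n)).
Proof.
move=> n n0; have t0 : 0 < tau n := kernel_scale_gt0 d sigma n0.
have C0 : 0 < C by rewrite (lt_le_trans _ C1).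
have Ct0 : 0 < C * tau n by rewrite mulr_gt0.
split => [x y Dx Dy|x z y Dx Dz Dy|x Dx].
- by rewrite normrM normfV (gtr0_norm Ct0) ler_pdivrMr// mul1r uk.
- rewrite -mulrBl normrM normfV (gtr0_norm Ct0).
  have step : `|(u y - u x) * k n x y - (u y - u z) * k n z y| <=
      C * (1 + L1 * n%:R) * `|x - z|.
    rewrite (_ : _ - _ = (u z - u x) * k n x y + (u y - u z) * (k n x y - k n z y));
      last by ring.
    apply: le_trans (ler_normD _ _) _; rewrite !normrM.
    have s1 : `|u z - u x| * `|k n x y| <= C * `|x - z|.
      by rewrite -[leRHS]mulr1 ler_pM// distrC uL.
    have s2 : `|u y - u z| * `|k n x y - k n z y| <= C * (L1 * n%:R * `|x - z|).
      by apply: ler_pM => //; [exact: uC|exact: kL].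
    by apply: le_trans (lerD s1 s2) _; rewrite le_eqVlt; apply/orP; left; apply/eqP; ring.
  rewrite ler_pdivrMr//; apply: le_trans step _.
  rewrite [leRHS]mulrAC ler_wpM2r//.
  have n1 : 1 <= n%:R :> R by rewrite ler1n.
  have tn : 1 <= n%:R * tau n by rewrite -ler_pdivrMr// mul1r kernel_scaleV_le.
  have -> : (1 + L1) * n%:R ^+ 2 * (C * tau n) =
    C * ((n%:R * tau n) * ((1 + L1) * n%:R)) by ring.
  rewrite ler_wpM2l ?(ltW C0)//.
  apply: (@le_trans _ _ (1 * ((1 + L1) * n%:R))); last first.
    by rewrite ler_wpM2r// mulr_ge0// addr_ge0.
  by rewrite mul1r; nra.
- apply: measurable_funM => //; apply: measurable_funM => //.
  exact: measurable_funB.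
Qed.

Lemma admissible_incr2 : admissible (C * (2 + L1))
  (fun n x y => (u y - u x) * (v y - v x) * k n x y / (C * tau n ^+ 2)).
Proof.
move=> n n0; have t0 : 0 < tau n := kernel_scale_gt0 d sigma n0.
have C0 : 0 < C by rewrite (lt_le_trans _ C1).
have Ct0 : 0 < C * tau n ^+ 2 by rewrite mulr_gt0// exprn_gt0.
split => [x y Dx Dy|x z y Dx Dz Dy|x Dx].
- by rewrite normrM normfV (gtr0_norm Ct0) ler_pdivrMr// mul1r uvk.
- rewrite -mulrBl normrM normfV (gtr0_norm Ct0).
  have step : `|(u y - u x) * (v y - v x) * k n x y -
      (u y - u z) * (v y - v z) * k n z y| <= C ^+ 2 * (2 + L1 * n%:R) * `|x - z|.
    rewrite (_ : _ - _ = (u z - u x) * ((v y - v x) * k n x y) +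
      (v z - v x) * ((u y - u z) * k n x y) +
      (u y - u z) * ((v y - v z) * (k n x y - k n z y))); last by ring.
    have s1 : `|(u z - u x) * ((v y - v x) * k n x y)| <= C * `|x - z| * (C * 1).
      rewrite normrM; apply: ler_pM => //; first by rewrite distrC uL.
      by rewrite normrM ler_pM ?vC.
    have s2 : `|(v z - v x) * ((u y - u z) * k n x y)| <= C * `|x - z| * (C * 1).
      rewrite normrM; apply: ler_pM => //; first by rewrite distrC vL.
      by rewrite normrM ler_pM ?uC.
    have s3 : `|(u y - u z) * ((v y - v z) * (k n x y - k n z y))| <=
        C * (C * (L1 * n%:R * `|x - z|)).
      rewrite normrM; apply: ler_pM => //; first exact: uC.
      by rewrite normrM; apply: ler_pM => //; [exact: vC|exact: kL].
    apply: le_trans (ler_normD _ _) _.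
    apply: le_trans (lerD (ler_normD _ _) (lexx _)) _.
    apply: le_trans (lerD (lerD s1 s2) s3) _.
    by rewrite le_eqVlt; apply/orP; left; apply/eqP; ring.
  rewrite ler_pdivrMr//; apply: le_trans step _.
  rewrite [leRHS]mulrAC ler_wpM2r//.
  have n1 : 1 <= n%:R :> R by rewrite ler1n.
  have tn : 1 <= n%:R * tau n ^+ 2.
    by rewrite -ler_pdivrMr ?exprn_gt0// mul1r kernel_scale_sqrV_le.
  have -> : C * (2 + L1) * n%:R ^+ 2 * (C * tau n ^+ 2) =
    C ^+ 2 * ((n%:R * tau n ^+ 2) * ((2 + L1) * n%:R)) by ring.
  rewrite ler_wpM2l ?sqr_ge0//.
  apply: (@le_trans _ _ (1 * ((2 + L1) * n%:R))); last first.
    by rewrite ler_wpM2r// mulr_ge0// addr_ge0.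
  by rewrite mul1r; nra.
- apply: measurable_funM => //; apply: measurable_funM => //.
  by apply: measurable_funM; exact: measurable_funB.
Qed.

End admissible_kernels.

(** * Rate of convergence for a pair of Lipschitz functions *)

Section gamma2_convergence.
Context {R : realType} {N d : nat} {disp : measure_display}.
Context {Omega : measurableType disp} (P : probability Omega R).
Variables (Sigma : set 'rV[R]_N) (mu : {measure set (borelRV R N) -> \bar R}).
Variables (xi : nat -> {RV P >-> borelRV R N}) (sigma : R).
Hypothesis smSigma : smooth_submanifold d Sigma.
Hypothesis cptSigma : compact Sigma.
Hypothesis vol_mu : riemannian_volume d Sigma mu.
Hypothesis xi_Sigma : forall i w, Sigma (xi i w).
Hypothesis xi_indep : mutually_independent xi.
Hypothesis xi_unif : forall i, uniformly_distributed Sigma mu (xi i).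
Hypothesis sigma0 : 0 < sigma.

Let nu : probability (borelRV R N) R := distribution P (xi 0).
Let E h : R := \int[nu]_(y in (Sigma : set (borelRV R N))) h y.
Let xi_ w j : 'rV[R]_N := xi j w.
Let F w n := empirical_mean n (xi_ w).
Let mSigma : measurable (Sigma : set (borelRV R N)) := compact_measurable_rV cptSigma.

Local Notation a := (bandwidth_exponent d sigma).
Local Notation tau := (kernel_scale d sigma).
Local Notation k n := (gauss_kernel (tau n ^+ 2)).
Local Notation G := (bounded_measurable Sigma).
Let eps := a * sigma / 4.
Let delta n : R := 3 * n%:R `^ (eps - 2^-1).

Let a0 : 0 < a := bandwidth_exponent_gt0 d sigma0.

Let law j B : measurable B -> P (xi j @^-1` B) = nu B.
Proof.
by move=> mB; apply: (etrans (xi_unif j mB)); apply/esym; exact: (xi_unif 0 mB).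
Qed.

Let nuS : nu Sigma = 1%E.
Proof. exact: (distribution_support (X := xi 0)). Qed.

Let algG := function_algebra_bounded_measurable Sigma.
Let mE : mean_functional Sigma G E := mean_functional_integral mSigma nuS.
Let Gk n x : G (k n x) := bounded_measurable_gauss (tau n) x mSigma.
Let mF w n (n0 : (0 < n)%N) : mean_functional Sigma (fun=> True) (F w n) :=
  mean_functional_empirical n0 (fun j => xi_Sigma j w).

Lemma sample_space_nonempty : Sigma !=set0.
Proof.
have [w _] : [set: Omega] !=set0.
  apply/set0P/negP => /eqP T0; have := probability_setT P.
  by rewrite T0 measure0 => /esym/eqP; rewrite onee_eq0.
by exists (xi 0 w).
Qed.

Lemma compact_norm_bounded : exists2 A : R, 0 < A & forall x, Sigma x -> `|x| <= A.
Proof.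
have [M [_ MS]] := compact_bounded cptSigma.
exists (`|M| + 1); first by rewrite ltr_wpDl.
by move=> x Sx; apply: MS => //; rewrite (le_lt_trans (ler_norm M))// ltrDl.
Qed.

(** The bounded factor may vary with n but not with the centre x, so that it
    leaves the Lipschitz constants in x unchanged. *)
Lemma admissible_lln (Lam : R) K (H : nat -> 'rV[R]_N -> R) : 0 <= Lam ->
  admissible Sigma Lam K ->
  (forall n, (0 < n)%N -> G (H n) /\ forall y, Sigma y -> `|H n y| <= 1) ->
  {ae P, forall w, \forall n \near \oo, forall x, Sigma x ->
    `|F w n (fun y => H n y * K n x y) - E (fun y => H n y * K n x y)| <= delta n}.
Proof.
move=> Lam0 aK H1; have [A A0 SA] := compact_norm_bounded.
have as0 : 0 < a * sigma by rewrite mulr_gt0.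
have [_ as1] := bandwidth_exponent_le d sigma0.
apply: (uniform_lln xi_indep law mSigma xi_Sigma A0 SA sample_space_nonempty
  (psi := fun n x y => H n y * K n x y) (p := 2) (C := Lam)) => //.
- by rewrite /eps divr_gt0.
- by rewrite /eps; lra.
- move=> n x n0 Sx; apply: measurable_funM; first by have [[]] := H1 n n0.
  by have [_ _] := aK n n0; exact.
- move=> n x y n0 Sx Sy; rewrite normrM -[leRHS]mulr1; apply: ler_pM => //.
    by have [_] := H1 n n0; exact.
  by have [K1 _ _] := aK n n0; exact: K1.
- move=> n x z y n0 Sx Sz Sy; rewrite -mulrBr normrM -[leRHS]mul1r; apply: ler_pM => //.
    by have [_] := H1 n n0; exact.
  by have [_ KL _] := aK n n0; exact: KL.
Qed.

(** Undoes the normalization of a function whose deviation was bounded after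
    dividing it by c. *)
Lemma err_scale w n (n0 : (0 < n)%N) (f H K : 'rV[R]_N -> R) (c D : R) y0 :
  0 <= c -> G (fun y => H y * K y) ->
  (forall y, f y * k n y0 y = c * (H y * K y)) ->
  `|F w n (fun y => H y * K y) - E (fun y => H y * K y)| <= D ->
  `|F w n (fun y => f y * k n y0 y) - E (fun y => f y * k n y0 y)| <= c * D.
Proof.
move=> c0 GHK fE HKD.
have -> : (fun y => f y * k n y0 y) = (fun y => c * (H y * K y)) by apply/funext.
rewrite (mean_functionalZ (@function_algebra_all R N) (mF w n0))//.
rewrite (mean_functionalZ algG mE)// -mulrBr normrM (ger0_norm c0).
by rewrite ler_wpM2l.
Qed.

Variables (u v : 'rV[R]_N -> R) (K : R).
Hypothesis K0 : 0 <= K.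
Local Notation lip f :=
  (forall x y, Sigma x -> Sigma y -> `|f x - f y| <= K * `|x - y|).
Hypotheses (uK : lip u) (vK : lip v).

Lemma lipschitz_bounded_measurable f : lip f -> G f.
Proof.
move=> fK; split.
  by apply: continuous_measurable_rV => //; exact: lipschitz_within_continuous fK.
have [A A0 SA] := compact_norm_bounded; have [x0 Sx0] := sample_space_nonempty.
exists (`|f x0| + K * (2 * A)) => x Sx.
rewrite -[f x](subrK (f x0)) addrC; apply: le_trans (ler_normD _ _) _.
rewrite lerD2l; apply: le_trans (fK _ _ Sx Sx0) _; rewrite ler_wpM2l//.
by apply: le_trans (ler_normB _ _) _; have := SA x Sx; have := SA x0 Sx0; lra.
Qed.

(** The means entering the comparison of the two Gamma2 are brought to seven
    instances of the uniform law: the kernel k, its products with one increment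
    of u or v, or with both, are normalized by powers of tau, and the factors
    Gamma(u, v), L u and L v, formed with the law and hence deterministic, by
    their uniform bounds. *)
Lemma Gamma2_dist_rate : exists B b : R, [/\ 0 <= B, 0 < b &
  {ae P, forall w, \forall n \near \oo, forall x, Sigma x ->
    `|Gamma2 (Lop_hat n (fun j => xi j w) (bandwidth d sigma n)) u v x -
      Gamma2 (Lop Sigma mu (bandwidth d sigma n)) u v x| <= B * n%:R `^ (- b)}].
Proof.
have [A A0 SA] := compact_norm_bounded.
have Gu := lipschitz_bounded_measurable uK.
have Gv := lipschitz_bounded_measurable vK.
pose C := 1 + K + 2 * K ^+ 2 + K * (2 * A).
have K2 : 0 <= K ^+ 2 by exact: sqr_ge0.
have KA : 0 <= K * (2 * A) by rewrite !mulr_ge0// ltW.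
have C1 : 1 <= C by rewrite /C -!addrA lerDl !addr_ge0// mulr_ge0.
have C0 : 0 < C by rewrite (lt_le_trans _ C1).
have KC : K <= C.
  by rewrite /C -!addrA addrCA lerDl !addr_ge0// mulr_ge0.
have K2C : 2 * K ^+ 2 <= C.
  by rewrite /C -addrA addrCA lerDl !addr_ge0.
have KAC : K * (2 * A) <= C.
  by rewrite /C lerDr !addr_ge0// mulr_ge0.
have lipC (f : 'rV[R]_N -> R) : lip f ->
    forall x y, Sigma x -> Sigma y -> `|f x - f y| <= C * `|x - y|.
  by move=> fK x y Sx Sy; apply: le_trans (fK x y Sx Sy) _; rewrite ler_wpM2r.
have oscC (f : 'rV[R]_N -> R) : lip f ->
    forall x y, Sigma x -> Sigma y -> `|f y - f x| <= C.
  move=> fK x y Sx Sy; apply: le_trans (fK y x Sy Sx) _.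
  apply: le_trans KAC; rewrite ler_wpM2l//; apply: le_trans (ler_normB _ _) _.
  by have := SA x Sx; have := SA y Sy; lra.
have kC (f : 'rV[R]_N -> R) : lip f ->
    forall n x y, (0 < n)%N -> Sigma x -> Sigma y ->
    `|(f y - f x) * k n x y| <= C * tau n.
  move=> fK n x y n0 Sx Sy; have t0 := kernel_scale_gt0 d sigma n0.
  have [m1 _] := gauss_kernel_moments x y t0.
  rewrite normrM distrC [`|k n x y|]ger0_norm ?gauss_kernel_ge0//.
  apply: (@le_trans _ _ (K * (`|x - y| * k n x y))).
    by rewrite mulrA ler_wpM2r ?gauss_kernel_ge0// fK.
  by apply: ler_pM => //; rewrite mulr_ge0// gauss_kernel_ge0.
have uvk n x y : (0 < n)%N -> Sigma x -> Sigma y ->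
    `|(u y - u x) * (v y - v x) * k n x y| <= C * tau n ^+ 2.
  move=> n0 Sx Sy; have t0 := kernel_scale_gt0 d sigma n0.
  have [_ m2] := gauss_kernel_moments x y t0.
  rewrite normrM normrM distrC [`|k n x y|]ger0_norm ?gauss_kernel_ge0//.
  apply: (@le_trans _ _ (K ^+ 2 * (`|x - y| ^+ 2 * k n x y))).
    rewrite mulrA ler_wpM2r ?gauss_kernel_ge0// -exprMn expr2.
    by apply: ler_pM => //; [exact: uK|rewrite distrC; exact: vK].
  apply: (@le_trans _ _ (K ^+ 2 * (2 * tau n ^+ 2))); first by rewrite ler_wpM2l.
  by rewrite mulrA ler_wpM2r ?sqr_ge0// mulrC.
have [c c0 Ec] := kernel_mean_ge cptSigma smSigma vol_mu (xi_Sigma 0) (xi_unif 0).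
pose kappa n := c / 2 * tau n ^+ d.
have kappa0 n : (0 < n)%N -> 0 < kappa n.
  by move=> n0; rewrite mulr_gt0 ?divr_gt0// exprn_gt0// kernel_scale_gt0.
have Ek2 n x : (0 < n)%N -> Sigma x -> 2 * kappa n <= E (k n x).
  move=> n0 Sx; have := Ec (tau n) x; rewrite kernel_scale_gt0 ?kernel_scale_le1//=.
  move=> /(_ isT Sx); apply: le_trans.
  by rewrite /kappa mulrA (_ : 2 * (c / 2) = c)//; field.
have Ek n x : (0 < n)%N -> Sigma x -> kappa n <= E (k n x).
  by move=> n0 Sx; have := Ek2 n x n0 Sx; have := kappa0 n n0; lra.
have kappa1 n : (0 < n)%N -> kappa n <= 1.
  move=> n0; have [x0 Sx0] := sample_space_nonempty.
  apply: le_trans (Ek n x0 n0 Sx0) _; rewrite -(mean_functional_cst mE 1).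
  apply: (mean_functional_le mE) => //; first exact: bounded_measurable_cst.
  by move=> y _; exact: gauss_kernel_le1.
pose LE n := mean_laplacian (k n) (tau n ^+ 2) E.
have GLE n : (0 < n)%N -> forall f, G f -> G (LE n f).
  move=> n0 f Gf; apply: (mean_laplacian_bounded_measurable mSigma nuS SA
    (kernel_scale_gt0 d sigma n0) (kappa0 n n0)) => // x Sx; exact: Ek.
pose bL n := 2 * C / tau n / kappa n; pose bG n := C / kappa n.
have bL0 n : (0 < n)%N -> 0 < bL n.
  by move=> n0; rewrite !divr_gt0 ?kernel_scale_gt0 ?kappa0// mulr_gt0.
have bG0 n : (0 < n)%N -> 0 < bG n by move=> n0; rewrite divr_gt0 ?kappa0.
have nL f n y : lip f ->
    (0 < n)%N -> Sigma y -> `|LE n f y| <= bL n.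
  move=> fK n0 Sy; have Gf := lipschitz_bounded_measurable fK.
  apply: (laplacian_norm_le algG mE (Gk n) (kernel_scale_gt0 d sigma n0)
    (kernel_scale_le1 d sigma0 n0) (kappa0 n n0) (fun x => Ek n x n0) (ltW C0) Sy Gf).
  by move=> z Sz; exact: kC.
have nG n y : (0 < n)%N -> Sigma y -> `|Gamma (LE n) u v y| <= bG n.
  move=> n0 Sy.
  apply: (Gamma_norm_le algG mE (Gk n) (kernel_scale_gt0 d sigma n0)
    (kernel_scale_le1 d sigma0 n0) (kappa0 n n0) (fun x => Ek n x n0) (ltW C0) Sy Gu Gv).
  by move=> z Sz; exact: uvk.
(* the deterministic factors, normalized so as to be bounded by 1 *)
pose H1 (n : nat) (y : 'rV[R]_N) : R := 1.
pose HL f n y := (bL n)^-1 * LE n f y.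
pose HG n y := (bG n)^-1 * Gamma (LE n) u v y.
have H1P n : (0 < n)%N -> G (H1 n) /\ forall y, Sigma y -> `|H1 n y| <= 1.
  by move=> _; split=> [|y _]; [exact: bounded_measurable_cst|rewrite normr1].
have HLP f : lip f ->
    forall n, (0 < n)%N -> G (HL f n) /\ forall y, Sigma y -> `|HL f n y| <= 1.
  move=> fK n n0; split.
    by apply: bounded_measurableZ; apply: GLE => //; exact: lipschitz_bounded_measurable.
  move=> y Sy; rewrite normrM normfV (gtr0_norm (bL0 n n0)) mulrC ler_pdivrMr ?bL0//.
  by rewrite mul1r nL.
have HGP n : (0 < n)%N -> G (HG n) /\ forall y, Sigma y -> `|HG n y| <= 1.
  move=> n0; split.
    by apply: bounded_measurableZ; exact: (algebra_Gamma algG (GLE n n0) Gu Gv).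
  move=> y Sy; rewrite normrM normfV (gtr0_norm (bG0 n n0)) mulrC ler_pdivrMr ?bG0//.
  by rewrite mul1r nG.
pose T1 n (x y : 'rV[R]_N) : R := k n x y.
pose T2 (f : 'rV[R]_N -> R) n (x y : 'rV[R]_N) : R := (f y - f x) * k n x y / (C * tau n).
pose T3 n (x y : 'rV[R]_N) : R := (u y - u x) * (v y - v x) * k n x y / (C * tau n ^+ 2).
have L10 : 0 <= 2 * N%:R * A by rewrite !mulr_ge0// ltW.
have T1P : admissible Sigma (2 * N%:R * A) T1.
  exact: (admissible_gauss d mSigma (ltW A0) SA sigma0).
have T2P f : lip f ->
    admissible Sigma (1 + 2 * N%:R * A) (T2 f).
  move=> fK; have [mf _] := lipschitz_bounded_measurable fK.
  exact: (admissible_incr mSigma (ltW A0) SA sigma0 C1 mf (lipC f fK) (oscC f fK) (kC f fK)).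
have T3P : admissible Sigma (C * (2 + 2 * N%:R * A)) T3.
  exact: (admissible_incr2 mSigma (ltW A0) SA sigma0 C1 Gu.1 Gv.1 (lipC u uK) (lipC v vK)
    (oscC u uK) (oscC v vK) uvk).
have L20 : 0 <= 1 + 2 * N%:R * A by rewrite addr_ge0.
have L30 : 0 <= C * (2 + 2 * N%:R * A).
  by apply: mulr_ge0; [exact: ltW|exact: addr_ge0].
have Q1 := admissible_lln L10 T1P H1P.
have Q2 := admissible_lln L20 (T2P u uK) H1P.
have Q3 := admissible_lln L20 (T2P v vK) H1P.
have Q4 := admissible_lln L30 T3P H1P.
have Q5 := admissible_lln L10 T1P HGP.
have Q6 := admissible_lln L20 (T2P v vK) (HLP u uK).
have Q7 := admissible_lln L20 (T2P u uK) (HLP v vK).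
pose b := a * sigma / 4 + a * d%:R / 2.
exists (24 * C ^+ 2 * 3 * (2 / c) ^+ 2), b; split.
- by rewrite mulr_ge0 ?sqr_ge0// mulr_ge0// mulr_ge0 ?sqr_ge0.
- apply: ltr_wpDr; last by rewrite divr_gt0// mulr_gt0.
  by apply: divr_ge0 => //; apply: mulr_ge0 => //; exact: ltW.
have aE := bandwidth_exponentE d sigma0.
have Q := filterI Q1 (filterI Q2 (filterI Q3 (filterI Q4 (filterI Q5 (filterI Q6 Q7))))).
refine (@filterS _ _ (ae_filter_ringOfSetsType P) _ _ _ _); last exact: Q.
move=> w [w1 [w2 [w3 [w4 [w5 [w6 w7]]]]]] {Q Q1 Q2 Q3 Q4 Q5 Q6 Q7}.
near=> n => x Sx.
have n0 : (0 < n)%N by near: n; exists 1%N.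
have nR0 : 0 < n%:R :> R by rewrite ltr0n.
have nn0 : n%:R != 0 :> R by rewrite gt_eqF.
have t0 := kernel_scale_gt0 d sigma n0.
have tn0 : tau n != 0 by rewrite gt_eqF.
have Cn0 : C != 0 by rewrite gt_eqF.
have delta0 : 0 <= delta n by rewrite mulr_ge0// powR_ge0.
have kappaE : kappa n = c / 2 * n%:R `^ (- (a * d%:R / 2)).
  rewrite /kappa /kernel_scale -powR_mulrn ?powR_ge0// -powRrM.
  by congr (_ * _ `^ _); ring.
(* E (k n x) is at least 2 kappa, so a deviation of at most kappa leaves the
   lower bound kappa for the empirical denominators *)
have dk : delta n <= kappa n.
  pose h := 2^-1 - eps - a * d%:R / 2.
  have h0 : 0 < h by have [] := rate_exponents d sigma0.
  have hE : n%:R `^ (- (a * d%:R / 2)) = n%:R `^ (eps - 2^-1) * n%:R `^ h.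
    by rewrite -powRD; [congr (_ `^ _); rewrite /h; ring|rewrite nn0 implybT].
  rewrite kappaE /delta hE [leRHS]mulrCA mulrC ler_wpM2l ?powR_ge0//.
  rewrite -ler_pdivrMl ?divr_gt0//.
  by near: n; apply: near_powR_ge; have [] := rate_exponents d sigma0.
have nw1 : forall x, Sigma x -> `|F w n (fun y => H1 n y * T1 n x y) -
    E (fun y => H1 n y * T1 n x y)| <= delta n by near: n.
have nw2 : forall x, Sigma x -> `|F w n (fun y => H1 n y * T2 u n x y) -
    E (fun y => H1 n y * T2 u n x y)| <= delta n by near: n.
have nw3 : forall x, Sigma x -> `|F w n (fun y => H1 n y * T2 v n x y) -
    E (fun y => H1 n y * T2 v n x y)| <= delta n by near: n.
have nw4 : forall x, Sigma x -> `|F w n (fun y => H1 n y * T3 n x y) -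
    E (fun y => H1 n y * T3 n x y)| <= delta n by near: n.
have nw5 : forall x, Sigma x -> `|F w n (fun y => HG n y * T1 n x y) -
    E (fun y => HG n y * T1 n x y)| <= delta n by near: n.
have nw6 : forall x, Sigma x -> `|F w n (fun y => HL u n y * T2 v n x y) -
    E (fun y => HL u n y * T2 v n x y)| <= delta n by near: n.
have nw7 : forall x, Sigma x -> `|F w n (fun y => HL v n y * T2 u n x y) -
    E (fun y => HL v n y * T2 u n x y)| <= delta n by near: n.
have GT Lam T z : admissible Sigma Lam T -> Sigma z -> G (T n z).
  move=> TP Sz; have [Tb _ mT] := TP n n0; split; first exact: mT.
  by exists 1 => y Sy; exact: Tb.
have GHT Lam T (H : nat -> 'rV[R]_N -> R) z : admissible Sigma Lam T -> G (H n) ->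
    Sigma z -> G (fun y => H n y * T n z y).
  by move=> TP GH Sz; apply: bounded_measurableM => //; exact: GT TP Sz.
have e1 z : Sigma z -> `|F w n (k n z) - E (k n z)| <= delta n.
  move=> /nw1; rewrite (_ : (fun y => H1 n y * T1 n z y) = k n z)//.
  by apply/funext => y; rewrite /H1 /T1 mul1r.
have Fk z : Sigma z -> kappa n <= F w n (k n z).
  move=> Sz; have := e1 z Sz; rewrite ler_norml => /andP[lo _].
  have := Ek2 n z n0 Sz; lra.
have Ct : 0 <= C * tau n by rewrite mulr_ge0// ltW.
have Ct2 : 0 <= C * tau n ^+ 2 by rewrite mulr_ge0 ?sqr_ge0// ltW.
have bLn := bL0 n n0; have bGn := bG0 n n0.
have bLn0 : bL n != 0 by rewrite gt_eqF.
have bGn0 : bG n != 0 by rewrite gt_eqF.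
have Ctn0 : C * tau n != 0 by rewrite mulf_neq0.
rewrite -sqr_kernel_scale (Gamma2_ext algG (fun f Gf =>
  LopE cptSigma (xi_Sigma 0) (xi_unif 0) (tau n) Gf) (GLE n n0) Gu Gv) Lop_hatE.
have main := Gamma2_dist_le algG mE (mF w n0) (Gk n) (@gauss_kernel_ge0 _ _ _)
  t0 (kernel_scale_le1 d sigma0 n0) (kappa0 n n0) (kappa1 n n0)
  (fun x => Ek n x n0) Fk delta0 e1 C1 Sx Gu Gv (GLE n n0) (oscC u uK) (oscC v vK)
  (fun x y => @kC u uK n x y n0) (fun x y => @kC v vK n x y n0)
  (fun x y => @uvk n x y n0).
apply: le_trans (main _ _ _ _ _ _) _.
- move=> z Sz; apply: (@err_scale w n n0 (fun y => u y - u z) (H1 n) (T2 u n z)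
    _ _ z Ct _ _ (nw2 z Sz)).
    exact: GHT (T2P u uK) (H1P n n0).1 Sz.
  by move=> y; rewrite /H1 /T2; field; rewrite Cn0 tn0.
- move=> z Sz; apply: (@err_scale w n n0 (fun y => v y - v z) (H1 n) (T2 v n z)
    _ _ z Ct _ _ (nw3 z Sz)).
    exact: GHT (T2P v vK) (H1P n n0).1 Sz.
  by move=> y; rewrite /H1 /T2; field; rewrite Cn0 tn0.
- move=> z Sz; apply: (@err_scale w n n0 (fun y => (u y - u z) * (v y - v z)) (H1 n)
    (T3 n z) _ _ z Ct2 _ _ (nw4 z Sz)).
    exact: GHT T3P (H1P n n0).1 Sz.
  by move=> y; rewrite /H1 /T3; field; rewrite Cn0 tn0.
- move=> z Sz; apply: (@err_scale w n n0 (Gamma (LE n) u v) (HG n) (T1 n z)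
    _ _ z (ltW bGn) _ _ (nw5 z Sz)).
    exact: GHT T1P (HGP n n0).1 Sz.
  by move=> y; rewrite /HG /T1 [RHS]mulrA (mulVKf bGn0).
- move=> z Sz; rewrite mulrA.
  apply: (@err_scale w n n0 (fun y => LE n u y * (v y - v z)) (HL u n) (T2 v n z) _ _ z
    (mulr_ge0 (ltW bLn) Ct) _ _ (nw6 z Sz)).
    exact: GHT (T2P v vK) (HLP u uK n n0).1 Sz.
  move=> y; rewrite /HL /T2 -/(LE n) (_ : bL n * (C * tau n) * _ =
    (bL n / bL n) * ((C * tau n) / (C * tau n)) * (LE n u y * (v y - v z) * k n z y)).
    by rewrite (mulfV bLn0) (mulfV Ctn0) !mul1r.
  by ring.
- move=> z Sz; rewrite mulrA.
  apply: (@err_scale w n n0 (fun y => LE n v y * (u y - u z)) (HL v n) (T2 u n z) _ _ z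
    (mulr_ge0 (ltW bLn) Ct) _ _ (nw7 z Sz)).
    exact: GHT (T2P u uK) (HLP v vK n n0).1 Sz.
  move=> y; rewrite /HL /T2 -/(LE n) (_ : bL n * (C * tau n) * _ =
    (bL n / bL n) * ((C * tau n) / (C * tau n)) * (LE n v y * (u y - u z) * k n z y)).
    by rewrite (mulfV bLn0) (mulfV Ctn0) !mul1r.
  by ring.
- have E3 : (tau n)^-1 ^+ 3 = n%:R `^ (3 / 2 * a).
    rewrite kernel_scaleV -powR_mulrn ?powR_ge0// -powRrM.
    by congr (_ `^ _); ring.
  have E2 : (kappa n)^-1 ^+ 2 = (2 / c) ^+ 2 * n%:R `^ (a * d%:R).
    rewrite kappaE invfM invf_div -powRN opprK exprMn; congr (_ * _).
    rewrite -powR_mulrn ?powR_ge0// -powRrM.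
    by congr (_ `^ _); field.
  have ES : n%:R `^ (eps - 2^-1) * n%:R `^ (3 / 2 * a) * n%:R `^ (a * d%:R) =
      n%:R `^ (- b).
    rewrite -!powRD ?nn0 ?implybT//; congr (_ `^ _).
    by have [] := rate_exponents d sigma0.
  rewrite E3 E2 /delta -ES le_eqVlt; apply/orP; left; apply/eqP; ring.
Unshelve. all: by end_near. Qed.

End gamma2_convergence.

(** * Smooth functions and linear forms *)

Lemma cvg_rate0 (R : realType) (B b : R) : 0 < b -> B * n%:R `^ (- b) @[n --> \oo] --> 0.
Proof.
move=> b0; apply/cvgrPdist_le => e e0; near=> n.
have n0 : (0 < n)%N by near: n; exists 1%N.
rewrite sub0r normrN normrM (ger0_norm (powR_ge0 _ _)) powRN.
rewrite ler_pdivrMr ?powR_gt0 ?ltr0n// mulrC -ler_pdivrMr//.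
by near: n; exact: near_powR_ge.
Unshelve. all: by end_near. Qed.

Lemma ereal_sup_cvg0 (R : realType) (X : nat -> set (\bar R)) (r : nat -> R) :
  (forall n, X n !=set0) -> (forall n e, X n e -> 0 <= e)%E ->
  (\forall n \near \oo, forall e, X n e -> (e <= (r n)%:E)%E) ->
  r n @[n --> \oo] --> 0 -> ereal_sup (X n) @[n --> \oo] --> 0%E.
Proof.
move=> X0 Xge0 Xr r0; apply: (@squeeze_cvge _ _ _ _ (cst 0%E) _ (fun n => (r n)%:E)).
- near=> n; apply/andP; split.
    have [e Xe] := X0 n; apply: le_trans (Xge0 n e Xe) _.
    exact: ereal_sup_ubound.
  apply: ge_ereal_sup; near: n; exact: Xr.
- exact: cvg_cst.
- by apply: cvg_EFin => //; exact: nearW.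
Unshelve. all: by end_near. Qed.

(** The partial derivatives are continuous, hence bounded on a compact cube. *)
Lemma smooth_lipschitz (R : realType) N (f : 'rV[R]_N -> R) (A : R) :
  smooth_on setT f -> exists2 K : R, 0 <= K &
    forall x y, `|x| < A -> `|y| < A -> `|f x - f y| <= K * `|x - y|.
Proof.
move=> smf; have [_ f1] := smf 1%N.
pose Q := [set x : 'rV[R]_N | forall i, x 0 i \in `[- A, A]].
have cQ : compact Q.
  apply: (@rV_compact _ _ (fun=> `[- A, A]%classic)) => _; exact: segment_compact.
have /choice[M MP] : forall i : 'I_N, exists M : R, forall x, Q x ->
    `|'D_(delta_mx 0 i) f x| <= M.
  move=> i; have [_ [cD _]] := f1 i.
  have cDQ : {within Q, continuous ('D_(delta_mx 0 i) f)}.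
    by apply: continuous_subspaceT => x; exact: cD.
  have [M [_ MD]] := compact_bounded (continuous_compact cDQ cQ).
  exists (M + 1) => x Qx; apply: MD; first by rewrite ltrDl.
  by exists x.
exists (N%:R * \sum_(i < N) `|M i|); first by rewrite mulr_ge0// sumr_ge0.
move=> x y xA yA; have ball0 z : ball (0 : 'rV[R]_N) A z <-> `|z| < A.
  by rewrite -ball_normE /= sub0r normrN.
apply: (@lipschitz_ball _ _ f 0 A); try exact/ball0.
move=> z /ball0 zA i; split; first by have [dz _] := f1 i; exact: dz.
apply: (@le_trans _ _ (M i)).
  apply: MP => j; rewrite in_itv/= -ler_norml.
  exact: le_trans (coord_le_norm z j) (ltW zA).
rewrite (le_trans (ler_norm _))// (bigD1 i)//= lerDl; exact: sumr_ge0.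
Qed.

Lemma coord_le_enorm (R : realType) N (x : 'rV[R]_N) i : `|x 0 i| <= enorm x.
Proof.
apply: le_trans (coord_le_norm x i) _.
rewrite -(@ler_pXn2r _ 2)// ?nnegrE ?sqrtr_ge0// sqr_enorm.
exact: sqr_norm_le_dotv.
Qed.

(** Lop is linear only on functions whose integrals are additive. Gamma2 stays
    among the bounded measurable functions, which Lop preserves. *)
Lemma Lop_Gamma2_sum (R : realType) N d (disp : measure_display)
    (Omega : measurableType disp) (P : probability Omega R) (Sigma : set 'rV[R]_N)
    (mu : {measure set (borelRV R N) -> \bar R}) (X : {RV P >-> borelRV R N})
    (smSigma : smooth_submanifold d Sigma) (cptSigma : compact Sigma)
    (vol_mu : riemannian_volume d Sigma mu) (XSigma : forall w, Sigma (X w))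
    (unif : uniformly_distributed Sigma mu X)
    (tau : R) (I : Type) (r : seq I) (a : I -> R) (e : I -> 'rV[R]_N -> R) x :
  0 < tau <= 1 -> (forall i, bounded_measurable Sigma (e i)) ->
  Gamma2 (Lop Sigma mu (tau ^+ 2)) (fun y => \sum_(i <- r) a i * e i y)
    (fun y => \sum_(i <- r) a i * e i y) x =
  \sum_(i <- r) \sum_(j <- r) a i * a j * Gamma2 (Lop Sigma mu (tau ^+ 2)) (e i) (e j) x.
Proof.
move=> tau01 Ge; have /andP[tau0 tau1] := tau01.
have [c c0 Ec] := kernel_mean_ge cptSigma smSigma vol_mu XSigma unif.
have mSigma : measurable (Sigma : set (borelRV R N)) := compact_measurable_rV cptSigma.
have [A A0 SA] := compact_norm_bounded cptSigma.
have kappa0 : 0 < c * tau ^+ d by rewrite mulr_gt0// exprn_gt0.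
have nuS : distribution P X Sigma = 1%E := distribution_support XSigma.
have mE := mean_functional_integral mSigma nuS.
have GL := mean_laplacian_bounded_measurable mSigma nuS SA tau0 kappa0
  (fun x Sx => Ec tau x tau01 Sx).
have algG := function_algebra_bounded_measurable Sigma.
have LE := LopE cptSigma XSigma unif tau.
rewrite (Gamma2_ext algG LE GL); [|exact: algebra_sum..].
rewrite (Gamma2_sum algG GL)//.
  apply: eq_bigr => i _; apply: eq_bigr => j _.
  by rewrite (Gamma2_ext algG LE GL).
move=> b f g Gf Gg; apply: (mean_laplacian_lin _ _ algG mE) => // y.
exact: bounded_measurable_gauss.
Qed.

Lemma double_sum_dist_le (R : realType) (I : finType) (a : I -> R) (p q r : I -> I -> R) M :
  (forall i, `|a i| <= M) -> (forall i j, `|p i j - q i j| <= r i j) ->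
  `|\sum_i \sum_j a i * a j * p i j - \sum_i \sum_j a i * a j * q i j| <=
  \sum_i \sum_j M * M * r i j.
Proof.
move=> aM pq; rewrite -sumrB; apply: le_trans (ler_norm_sum _ _ _) _.
apply: ler_sum => i _; rewrite -sumrB; apply: le_trans (ler_norm_sum _ _ _) _.
apply: ler_sum => j _; rewrite -mulrBr !normrM.
by apply: ler_pM => //; exact: ler_pM.
Qed.

Theorem theorem3 (R : realType) (N d : nat) (Sigma : set 'rV[R]_N)
    (mu : {measure set (borelRV R N) -> \bar R})
    (disp : measure_display) (Omega : measurableType disp)
    (P : probability Omega R) (xi : nat -> {RV P >-> borelRV R N})
    (sigma : R)
    (smSigma : smooth_submanifold d Sigma) (cptSigma : compact Sigma)
    (vol_mu : riemannian_volume d Sigma mu)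
    (xi_Sigma : forall i w, Sigma (xi i w))
    (xi_indep : mutually_independent xi)
    (xi_unif : forall i, uniformly_distributed Sigma mu (xi i))
    (sigma_gt0 : 0 < sigma) :
  let t := bandwidth d sigma in
  let err (w : Omega) (n : nat) (f : 'rV[R]_N -> R) (x : 'rV[R]_N) : R :=
    `|Gamma2 (Lop_hat n (fun j => xi j w) (t n)) f f x -
      Gamma2 (Lop Sigma mu (t n)) f f x| in
  (forall f : 'rV[R]_N -> R, smooth_on setT f ->
    {ae P, forall w,
      ereal_sup [set (err w n f x)%:E | x in Sigma] @[n --> \oo] --> 0%E}) /\
  (forall M : R, 0 < M ->
    {ae P, forall w,
      ereal_sup [set ereal_sup [set (err w n f x)%:E | x in Sigma]
                | f in linear_ball M] @[n --> \oo] --> 0%E}).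
Proof.
move=> t err; have [x0 Sx0] := sample_space_nonempty xi_Sigma.
have [A A0 SA] := compact_norm_bounded cptSigma.
have rate := Gamma2_dist_rate smSigma cptSigma vol_mu xi_Sigma xi_indep xi_unif
  sigma_gt0.
split=> [f smf|M M0].
  have [K K0 fK] := smooth_lipschitz (A + 1) smf.
  have SfK x y : Sigma x -> Sigma y -> `|f x - f y| <= K * `|x - y|.
    by move=> Sx Sy; apply: fK; rewrite (le_lt_trans (SA _ _))// ltrDl.
  have [B [b [B0 b0 Bb]]] := rate f f K K0 SfK SfK.
  refine (@filterS _ _ (ae_filter_ringOfSetsType P) _ _ _ _); last exact: Bb.
  move=> w wB; apply: (@ereal_sup_cvg0 _ _ (fun n => B * n%:R `^ (- b))).
  - by move=> n; exists (err w n f x0)%:E, x0.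
  - by move=> n _ [x _ <-]; rewrite lee_fin normr_ge0.
  - by apply: filterS wB => n nB _ [x Sx <-]; rewrite lee_fin; exact: nB.
  - exact: cvg_rate0.
(* the coordinates: by bilinearity the rates for their finitely many pairs bound
   the error for all linear forms in the ball *)
pose e (i : 'I_N) (x : 'rV[R]_N) : R := x 0 i.
have eL i x y : Sigma x -> Sigma y -> `|e i x - e i y| <= 1 * `|x - y|.
  by move=> _ _; rewrite mul1r; have := coord_le_norm (x - y) i; rewrite !mxE.
have /choice[q qP] : forall ij : 'I_N * 'I_N, exists q : R * R,
    [/\ 0 <= q.1, 0 < q.2 &
  {ae P, forall w, \forall n \near \oo, forall x, Sigma x ->
    `|Gamma2 (Lop_hat n (fun j => xi j w) (t n)) (e ij.1) (e ij.2) x -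
      Gamma2 (Lop Sigma mu (t n)) (e ij.1) (e ij.2) x| <= q.1 * n%:R `^ (- q.2)}].
  move=> [i j]; have [B [b [B0 b0 Bb]]] := rate (e i) (e j) 1 ler01 (eL i) (eL j).
  by exists (B, b).
have aeq : {ae P, forall w, forall ij, \forall n \near \oo, forall x, Sigma x ->
    `|Gamma2 (Lop_hat n (fun j => xi j w) (t n)) (e ij.1) (e ij.2) x -
      Gamma2 (Lop Sigma mu (t n)) (e ij.1) (e ij.2) x| <=
    (q ij).1 * n%:R `^ (- (q ij).2)}.
  apply: (@filter_forall _ _ _ _ (ae_filter_ringOfSetsType P)) => ij.
  by have [] := qP ij.
refine (@filterS _ _ (ae_filter_ringOfSetsType P) _ _ _ _); last exact: aeq.
move=> w wq; pose r n := \sum_(i < N) \sum_(j < N)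
  M * M * ((q (i, j)).1 * n%:R `^ (- (q (i, j)).2)).
apply: (@ereal_sup_cvg0 _ _ r).
- move=> n; exists (ereal_sup [set (err w n (dotv 0) x)%:E | x in Sigma]), (dotv 0) => //.
  by exists 0 => //; rewrite /enorm /dotv big1 ?sqrtr0 ?(ltW M0)// => i _; rewrite mxE mul0r.
- move=> n _ [f _ <-]; apply: (@le_trans _ _ (err w n f x0)%:E).
    by rewrite lee_fin normr_ge0.
  by apply: ereal_sup_ubound; exists x0.
- have wn : \forall n \near \oo, forall ij x, Sigma x ->
      `|Gamma2 (Lop_hat n (fun j => xi j w) (t n)) (e ij.1) (e ij.2) x -
        Gamma2 (Lop Sigma mu (t n)) (e ij.1) (e ij.2) x| <=
      (q ij).1 * n%:R `^ (- (q ij).2) by exact: filter_forall.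
  near=> n => _ [f [zeta zetaM ->] <-].
  have n0 : (0 < n)%N by near: n; exists 1%N.
  have wn' : forall ij x, Sigma x ->
      `|Gamma2 (Lop_hat n (fun j => xi j w) (t n)) (e ij.1) (e ij.2) x -
        Gamma2 (Lop Sigma mu (t n)) (e ij.1) (e ij.2) x| <=
      (q ij).1 * n%:R `^ (- (q ij).2) by near: n.
  apply: ge_ereal_sup => _ [x Sx <-]; rewrite lee_fin /err.
  have -> : dotv zeta = fun y => \sum_(i < N) zeta 0 i * e i y by [].
  have Ge i : bounded_measurable Sigma (e i) :=
    lipschitz_bounded_measurable cptSigma xi_Sigma ler01 (eL i).
  have tau01 : 0 < kernel_scale d sigma n <= 1.
    by rewrite kernel_scale_gt0// kernel_scale_le1.
  have LS := Lop_Gamma2_sum smSigma cptSigma vol_mu (xi_Sigma 0) (xi_unif 0)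
    (index_enum 'I_N) (fun i => zeta 0 i) x tau01 Ge.
  rewrite sqr_kernel_scale in LS; rewrite LS {LS}.
  have algT := @function_algebra_all R N.
  have mF := mean_functional_empirical n0 (fun j => xi_Sigma j w).
  have linT : forall (c : R) (g h : 'rV[R]_N -> R), True -> True ->
      Lop_hat n (fun j => xi j w) (t n) (fun y => g y + c * h y) =
      fun y => Lop_hat n (fun j => xi j w) (t n) g y +
        c * Lop_hat n (fun j => xi j w) (t n) h y.
    by move=> c g h _ _; rewrite Lop_hatE; exact: (mean_laplacian_lin _ _ algT mF).
  rewrite (Gamma2_sum algT (fun _ _ => I) linT)//.
  apply: double_sum_dist_le => [i|i j]; last exact: (wn' (i, j)).
  exact: le_trans (coord_le_enorm _ _) zetaM.
- rewrite /r [X in _ --> X](_ : _ = \sum_(i < N) \sum_(j < N) M * M * 0); last first.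
    by apply/esym; rewrite big1// => i _; rewrite big1// => j _; rewrite mulr0.
  apply: cvg_sum_real => i; apply: cvg_sum_real => j; apply: cvgM; first exact: cvg_cst.
  by apply: cvg_rate0; have [] := qP (i, j).
Unshelve. all: by end_near.
Qed.
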